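(* Fix $h\in(0,1]$ and $\Delta t>0$ and consider the Galerkin Milstein scheme $$X_h^{j+1}=\bigl(D^{\mathrm{det}}+D^{\mathrm{EM},j}+D^{\mathrm{M},j}\bigr)X_h^j,\quad j\in\mathbb{N}_0,\qquad X_h^0=P_hX_0,$$ where $$D^{\mathrm{det}}=R(\Delta tA_h)+r_{\mathrm d}^{-1}(\Delta tA_h)\,\Delta t\,P_hF,\qquad D^{\mathrm{EM},j}=r_{\mathrm d}^{-1}(\Delta tA_h)P_hG(\cdot)\Delta L^j,$$ $$D^{\mathrm{M},j}=\sum_{k,\ell=1}^\infty r_{\mathrm d}^{-1}(\Delta tA_h)\sqrt{\mu_k\mu_\ell}\,P_hG(G(\cdot)f_k)f_\ell\int_{t_j}^{t_{j+1}}\!\int_{t_j}^s\mathrm{d}L_k(r)\,\mathrm{d}L_\ell(s).$$ Assume that the bilinear mapping $C'(u_1,u_2)=r_{\mathrm d}^{-1}(\Delta tA_h)P_hG(G(\cdot)u_1)u_2$, $u_1,u_2\in U$, can be uniquely extended to a mapping $C'\in L(U^{(2)};L(V_h))$. Then the zero solution of the Milstein scheme is asymptotically mean-square stable if and only if $$\mathcal{S}=D^{\mathrm{det}}\otimes D^{\mathrm{det}}+\Delta t\,(C\otimes C)q+\frac{\Delta t^2}{2}(C'\otimes C')q'$$ satisfies $\rho(\mathcal{S})<1$, where $\rho$ denotes the spectral radius, $q=\sum_{k=1}^\infty\mu_k\,f_k\otimes f_k\in U^{(2)}$, $q'=\sum_{k,\ell=1}^\infty\mu_k\mu_\ell\,(f_k\otimes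 f_\ell)\otimes(f_k\otimes f_\ell)\in U^{(4)}$, and $C\in L(U;L(V_h))$ is given by $Cu=r_{\mathrm d}^{-1}(\Delta tA_h)P_hG(\cdot)u$.
   Context: $(\Omega,\mathcal{A},(\mathcal{F}_t)_{t\ge0},P)$ is a complete filtered probability space satisfying the usual conditions; $H$ and $U$ are real separable Hilbert spaces. $-A:\mathcal{D}(-A)\subset H\to H$ is densely defined, self-adjoint and positive definite with compact inverse; $F\in L(H)$; $G\in L(H;L(U;H))$, i.e. $G$ is bounded and linear from $H$ to the bounded linear operators $U\to H$. $X_0\in L^2(\Omega;H)$ is $\mathcal{F}_0$-measurable. $L$ is a $U$-valued square-integrable $Q$-L\'evy process with respect to $(\mathcal{F}_t)$ (adapted, $L(t)-L(s)$ independent of $\mathcal{F}_s$ for $s<t$) that is a martingale; its covariance operator $Q\in L(U)$ is self-adjoint, positive semidefinite and of trace class, with orthonormal eigenbasis $(f_k,k\in\mathbb{N})$ of $U$ and eigenvalues $\mu_1\ge\mu_2\ge\dots\ge0$, $Qf_k=\mu_kf_k$. $L$ has the expansion $L(t)=\sum_{k=1}^\infty\sqrt{\mu_k}L_k(t)f_k$ with real-valued, square-integrable, uncorrelated, mean-zero L\'evy processes $L_k$ with $\mathbb{E}[L_k(t)^2]=t$ (for $\mu_k>0$, $L_k(t)=\mu_k^{-1/2}\langle L(t),f_k\rangle_U$). $t_j=j\Delta t$, $\Delta L^j=L(t_{j+1})-L(t_j)$, and $\int_a^b\int_a^s\mathrm{d}L_k(r)\,\mathrm{d}L_\ell(s)=\int_a^b(L_k(s-)-L_k(a))\,\mathrm{d}L_\ell(s)$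 is the iterated stochastic integral. $\dot H^1=\mathcal{D}((-A)^{1/2})$ with inner product $\langle\cdot,\cdot\rangle_1=\langle(-A)^{1/2}\cdot,(-A)^{1/2}\cdot\rangle_H$. $V_h\subset\dot H^1\subset H$ is a subspace of finite dimension $N_h$, with the norm of $H$; $P_h$ is the $H$-orthogonal projection onto $V_h$; $-A_h:V_h\to V_h$ is defined by $\langle-A_hv,w\rangle_H=\langle v,w\rangle_1$ for all $v,w\in V_h$. It is self-adjoint and positive definite, with eigenvalues $0<\lambda_{h,1}\le\dots\le\lambda_{h,N_h}$ and corresponding $H$-orthonormal eigenvectors $e_{h,1},\dots,e_{h,N_h}$. $R=r_{\mathrm n}/r_{\mathrm d}$ ($r_{\mathrm n},r_{\mathrm d}$ polynomials) is a rational approximation of some order $p$ of the exponential function, i.e. there are constants $c,\delta>0$ with $|R(z)-\exp(z)|\le c|z|^{p+1}$ for all $z\in\mathbb{C}$, $|z|<\delta$; it is assumed that $r_{\mathrm d}(-\Delta t\lambda_{h,k})\ne0$ for $k=1,\dots,N_h$, and $$R(\Delta tA_h)v=\sum_{k=1}^{N_h}\frac{r_{\mathrm n}(-\Delta t\lambda_{h,k})}{r_{\mathrm d}(-\Delta t\lambda_{h,k})}\langle v,e_{h,k}\rangle_He_{h,k},\qquad r_{\mathrm d}^{-1}(\Delta tA_h)v=\sum_{k=1}^{N_h}\frac{1}{r_{\mathrm d}(-\Delta t\lambda_{h,k})}\langle v,e_{h,k}\rangle_He_{h,k}.$$ For a Hilbert space $K$, $K^{(2)}=K\otimes K$ is the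 Hilbert tensor product, and $U^{(4)}=U^{(2)}\otimes U^{(2)}$. For $D_1,D_2\in L(V_h)$, $D_1\otimes D_2\in L(V_h^{(2)})$ satisfies $(D_1\otimes D_2)(v\otimes w)=D_1v\otimes D_2w$. $C\otimes C:U^{(2)}\to L(V_h^{(2)})$ and $C'\otimes C':U^{(4)}\to L(V_h^{(2)})$ are the bounded linear maps with $(C\otimes C)(u_1\otimes u_2)=(Cu_1)\otimes(Cu_2)$ and $(C'\otimes C')(w_1\otimes w_2)=(C'w_1)\otimes(C'w_2)$. The extension of $C'$ is via $C'(u_1\otimes u_2)=C'(u_1,u_2)$; explicitly $C'(u_1,u_2)v=r_{\mathrm d}^{-1}(\Delta tA_h)P_hG(G(v)u_1)u_2$ for $v\in V_h$. The zero solution of the scheme is $X_{h,\mathrm e}^j=0$ for all $j$. It is mean-square stable if for every $\varepsilon>0$ there is $\delta>0$ such that $\mathbb{E}[\|X_h^j\|_H^2]<\varepsilon$ for all $j\in\mathbb{N}_0$ whenever ($X_h^0\in L^2(\Omega;V_h)$ is $\mathcal{F}_0$-measurable and) $\mathbb{E}[\|X_h^0\|_H^2]<\delta$. It is asymptotically mean-square stable if it is mean-square stable and there is $\delta>0$ such that $\mathbb{E}[\|X_h^0\|_H^2]<\delta$ implies $\lim_{j\to\infty}\mathbb{E}[\|X_h^j\|_H^2]=0$. *)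

(* Defs.v *)
From HB Require Import structures.
From mathcomp Require Import all_boot all_order all_algebra.
From mathcomp Require Import all_classical all_reals all_analysis.
From mathcomp Require Import complex.

Set Implicit Arguments.
Unset Strict Implicit.
Unset Printing Implicit Defensive.

Import Order.TTheory GRing.Theory Num.Theory.
Import numFieldNormedType.Exports.
Local Open Scope classical_set_scope.
Local Open Scope ring_scope.

HB.mixin Record isHilbert (R : realType) (V : Type)
    of CompleteNormedModule R V := {
  dot : V -> V -> R;
  dotC : forall x y, dot x y = dot y x;
  dot_linearl : forall a x y z, dot (a *: x + y) z = a * dot x z + dot y z;
  dot_norm : forall x, dot x x = `|x| ^+ 2
}.

#[short(type="hilbertType")]
HB.structure Definition Hilbert (R : realType) :=
  {V of isHilbert R V & CompleteNormedModule R V}.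

Section linear_structures.
Variable R : realType.

Definition separable (T : topologicalType) :=
  exists2 D : set T, countable D & dense D.

Definition lspan (K : lmodType R) (A : set K) : set K :=
  [set x | exists n (c : 'I_n -> R) (z : 'I_n -> K),
    (forall i, A (z i)) /\ x = \sum_i c i *: z i].

Definition linear_subspace (K : lmodType R) (V : set K) :=
  V 0 /\ forall a x y, V x -> V y -> V (a *: x + y).

Definition linear_on (K K' : lmodType R) (V : set K) (T : K -> K') :=
  forall a x y, V x -> V y -> T (a *: x + y) = a *: T x + T y.

Definition is_subspace_of_dim (K : lmodType R) (V : set K) (N : nat) :=
  exists b : 'I_N -> K,
    (forall c : 'I_N -> R, \sum_i c i *: b i = 0 -> forall i, c i = 0) /\
    V = [set x | exists c : 'I_N -> R, x = \sum_i c i *: b i].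

(* Elements of L(K1; L(K2; K3)) are represented in uncurried form. *)
Definition bounded_bilinear_on (K1 K2 K3 : normedModType R)
    (E1 : set K1) (E2 : set K2) (B : K1 -> K2 -> K3) :=
  [/\ forall y, E2 y -> linear_on E1 (B ^~ y),
      forall x, E1 x -> linear_on E2 (B x) &
      exists M : R, forall x y, E1 x -> E2 y -> `|B x y| <= M * `|x| * `|y|].

Definition bounded_linear (K K' : normedModType R) (T : K -> K') :=
  linear T /\ exists M : R, forall x, `|T x| <= M * `|x|.

End linear_structures.

Section hilbert.
Variable R : realType.

Definition orthonormal_family (K : hilbertType R) (I : eqType) (e : I -> K) :=
  forall i j, dot (e i) (e j) = (i == j)%:R.

Definition hilbert_basis (K : hilbertType R) (f : nat -> K) :=
  orthonormal_family f /\ dense (lspan (range f)).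

Definition is_orthogonal_projection (K : hilbertType R) (V : set K)
    (T : K -> K) :=
  forall x, V (T x) /\ forall v, V v -> dot (x - T x) v = 0.

(* The Hilbert tensor product is determined up to a unitary isomorphism by
   this property: [t] realises [K] as the Hilbert tensor product of the closed
   subspaces [E1] and [E2]. Values of [t] outside [E1 * E2] are irrelevant. *)
Record is_hilbert_tensor (K1 K2 K : hilbertType R) (E1 : set K1) (E2 : set K2)
    (t : K1 -> K2 -> K) : Prop := {
  tensor_bilinear : bounded_bilinear_on E1 E2 t;
  tensor_dot : forall x x' y y', E1 x -> E1 x' -> E2 y -> E2 y' ->
    dot (t x y) (t x' y') = dot x x' * dot y y';
  tensor_dense : dense (lspan [set t x y | x in E1 & y in E2])
}.

(* [T] is the operator [D1 (x) D2] on the tensor product [t : V -> V -> K]. *)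
Definition is_operator_tensor (H K : hilbertType R) (V : set H)
    (t : H -> H -> K) (D1 D2 : H -> H) (T : K -> K) :=
  bounded_linear T /\
  forall v w, V v -> V w -> T (t v w) = t (D1 v) (D2 w).

(* [CC : W (x) W -> L(V (x) V)] is the map [C (x) C] for [C : W -> L(V)]. *)
Definition is_map_tensor (W W2 H K : hilbertType R) (V : set H)
    (tW : W -> W -> W2) (tV : H -> H -> K) (C : W -> H -> H)
    (CC : W2 -> K -> K) :=
  bounded_bilinear_on setT setT CC /\
  forall w1 w2, is_operator_tensor V tV (C w1) (C w2) (CC (tW w1 w2)).

(* [C' : W (x) W -> L(V)] extends the bilinear map [B : W -> W -> L(V)]. *)
Definition is_bounded_extension (W W2 H : hilbertType R) (V : set H)
    (t : W -> W -> W2) (B : W -> W -> H -> H) (C' : W2 -> H -> H) :=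
  [/\ bounded_bilinear_on setT V C',
      forall w v, V v -> V (C' w v) &
      forall u1 u2 v, V v -> C' (t u1 u2) v = B u1 u2 v].

Definition is_unique_bounded_extension (W W2 H : hilbertType R) (V : set H)
    (t : W -> W -> W2) (B : W -> W -> H -> H) (C' : W2 -> H -> H) :=
  is_bounded_extension V t B C' /\
  forall C'', is_bounded_extension V t B C'' ->
    forall w v, V v -> C'' w v = C' w v.

(* [x + i y] is an eigenvector of the complexification of [T], with
   eigenvalue [z = a + i b]: [T x + i T y = (a + i b) (x + i y)]. *)
Definition complex_eigenvalue (K : lmodType R) (T : K -> K) (z : R[i]) :=
  exists x y : K, [/\ (x, y) <> (0, 0),
    T x = complex.Re z *: x - complex.Im z *: y &
    T y = complex.Im z *: x + complex.Re z *: y].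

(* To be used on finite-dimensional spaces only. *)
Definition spectral_radius (K : lmodType R) (T : K -> K) : R :=
  sup [set Normc.normc z | z in [set z | complex_eigenvalue T z]].

End hilbert.

Section operators.
Variables (R : realType) (H : hilbertType R).

(* An unbounded operator is a domain [D] and a function of which only the
   values on [D] matter. *)
Record is_self_adjoint (D : set H) (T : H -> H) : Prop := {
  sa_domain : linear_subspace D;
  sa_dense : dense D;
  sa_linear : linear_on D T;
  sa_symmetric : forall x y, D x -> D y -> dot (T x) y = dot x (T y);
  (* the domain of the adjoint is not larger than [D] *)
  sa_adjoint : forall y, (exists z, forall x, D x -> dot (T x) y = dot x z) ->
    D y
}.

Definition positive_definite (D : set H) (T : H -> H) :=
  forall x, D x -> x != 0 -> 0 < dot (T x) x.

Definition positive_semidefinite (D : set H) (T : H -> H) :=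
  forall x, D x -> 0 <= dot (T x) x.

Definition has_compact_inverse (D : set H) (T : H -> H) :=
  exists S : H -> H, [/\ linear S,
    forall y, D (S y) /\ T (S y) = y,
    forall x, D x -> S (T x) = x &
    precompact (S @` [set x | `|x| <= 1])].

(* [(D', T')] is the (unique) positive self-adjoint square root of [(D, T)]. *)
Record is_square_root (D : set H) (T : H -> H) (D' : set H) (T' : H -> H) :
    Prop := {
  sqrt_self_adjoint : is_self_adjoint D' T';
  sqrt_positive : positive_semidefinite D' T';
  sqrt_domain : D = [set x | D' x /\ D' (T' x)];
  sqrt_square : forall x, D x -> T' (T' x) = T x
}.

(* Trace class, for a positive semidefinite operator. *)
Definition trace_class (f : nat -> H) (Q : H -> H) :=
  cvgn (series (fun k => dot (Q (f k)) (f k))).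

(* [Th] represents on [V] the form [<v, w>_1 = <T' v, T' w>]. *)
Definition is_galerkin_operator (T' : H -> H) (V : set H) (Th : H -> H) :=
  forall v, V v -> V (Th v) /\
    forall w, V w -> dot (Th v) w = dot (T' v) (T' w).

Record is_eigenbasis (V : set H) (Th : H -> H) (N : nat) (lam : 'I_N -> R)
    (e : 'I_N -> H) : Prop := {
  eb_mem : forall k, V (e k);
  eb_orthonormal : orthonormal_family e;
  eb_eigen : forall k, Th (e k) = lam k *: e k;
  eb_pos : forall k, 0 < lam k;
  eb_sorted : forall i j : 'I_N, (i <= j)%N -> lam i <= lam j
}.

(* [g (dt * A_h)], where the [lam k] are the eigenvalues of [- A_h]. *)
Definition functional_calculus (N : nat) (lam : 'I_N -> R) (e : 'I_N -> H)
    (dt : R) (g : R -> R) (v : H) : H :=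
  \sum_k (g (- (dt * lam k)) * dot v (e k)) *: e k.

End operators.

Section rational_approximation.
Variable R : realType.

Definition cexp (z : R[i]) : R[i] :=
  let: Complex a b := z in Complex (expR a * cos b) (expR a * sin b).

Definition ceval (r : {poly R}) (z : R[i]) : R[i] :=
  (map_poly (real_complex R) r).[z].

Definition is_rational_exp_approximation (rn rd : {poly R}) (p : nat) :=
  exists c delta : R, [/\ 0 < c, 0 < delta &
    forall z : R[i], Normc.normc z < delta ->
      ceval rd z != 0 /\
      Normc.normc (ceval rn z / ceval rd z - cexp z)
        <= c * Normc.normc z ^+ p.+1].

End rational_approximation.

(* Processes and filtrations are indexed by [R]; only times [0 <= t] matter. *)
Section stochastics.
Variables (R : realType) (d : measure_display) (Omega : measurableType d).
Variable P : probability Omega R.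

Definition measurable_wrt (T : topologicalType) (G : set (set Omega))
    (X : Omega -> T) :=
  forall B : set T, <<s open >> B -> G (X @^-1` B).

Definition mean_square (K : normedModType R) (X : Omega -> K) : \bar R :=
  'E_P[(fun w => `|X w| ^+ 2)%R]%E.

Record is_usual_filtration (Filt : R -> set (set Omega)) : Prop := {
  filt_complete_space : measure_is_complete P;
  filt_sigma_algebra : forall t, 0 <= t -> sigma_algebra setT (Filt t);
  filt_measurable : forall t, 0 <= t -> Filt t `<=` measurable;
  filt_increasing : forall s t, 0 <= s -> s <= t -> Filt s `<=` Filt t;
  filt_null : P.-negligible `<=` Filt 0;
  filt_right_continuous : forall t, 0 <= t ->
    Filt t = \bigcap_(s in [set s | t < s]) Filt s
}.

Variable Filt : R -> set (set Omega).

Section levy.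
Variable U : hilbertType R.
Implicit Types L : R -> Omega -> U.

Definition is_cadlag (x : R -> U) :=
  (forall t, 0 <= t -> x r @[r --> t^'+] --> x t) /\
  (forall t, 0 < t -> cvg (x r @[r --> t^'-])).

Record is_levy_process L : Prop := {
  levy_adapted : forall t : R, 0 <= t -> measurable_wrt (Filt t) (L t);
  levy_zero : {ae P, forall w, L 0 w = 0};
  levy_independent : forall s t : R, 0 <= s -> s < t ->
    forall (A : set Omega) (B : set U), Filt s A -> <<s open >> B ->
    let E := [set w | B (L t w - L s w)] in
    P (A `&` E) = (P A * P E)%E;
  levy_stationary : forall s t u : R, 0 <= s -> 0 <= t -> 0 <= u ->
    forall B : set U, <<s open >> B ->
    P [set w | B (L (s + u) w - L s w)] = P [set w | B (L (t + u) w - L t w)];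
  levy_continuous : forall t eps : R, 0 <= t -> 0 < eps ->
    P [set w | eps < `|L s w - L t w|]
      @[s --> within (fun s : R => 0 <= s) (nbhs t)] --> 0%E;
  levy_cadlag : {ae P, forall w, is_cadlag (fun t => L t w)}
}.

Definition square_integrable L :=
  forall t, 0 <= t -> (mean_square (L t) < +oo)%E.

(* For square-integrable adapted processes; the [U]-valued identity
   [E[1_A L(t)] = E[1_A L(s)]] is tested against the elements of [U]. *)
Definition is_martingale L :=
  forall s t, 0 <= s -> s <= t -> forall A, Filt s A -> forall x : U,
    (\int[P]_(w in A) (dot (L t w) x)%:E =
     \int[P]_(w in A) (dot (L s w) x)%:E)%E.

Definition is_covariance_operator L (Q : U -> U) :=
  forall s t, 0 <= s -> 0 <= t -> forall x y : U,
    'E_P[(fun w => dot (L s w) x * dot (L t w) y)%R]%E =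
    (Num.min s t * dot (Q x) y)%:E.

(* The coordinate processes [L_k] of the expansion
   [L(t) = \sum_k sqrt mu_k L_k(t) f_k]; if [mu_k = 0] then [L_k = 0] here,
   which is harmless since [L_k] then only occurs multiplied by 0. *)
Definition levy_coord (mu : nat -> R) (f : nat -> U) L (k : nat) (t : R)
    (w : Omega) : R :=
  (Num.sqrt (mu k))^-1 * dot (L t w) (f k).

End levy.

(* The process [\sum_(i < sp_size) sp_val i 1_(]sp_time i, sp_time i.+1])]. *)
Record simple_process := SimpleProcess {
  sp_size : nat;
  sp_time : nat -> R;
  sp_val : nat -> Omega -> R
}.

Definition simple_predictable (a b : R) (phi : simple_process) :=
  [/\ sp_time phi 0 = a, sp_time phi (sp_size phi) = b,
      forall i, (i < sp_size phi)%N -> sp_time phi i <= sp_time phi i.+1,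
      forall i, (i < sp_size phi)%N ->
        measurable_wrt (Filt (sp_time phi i)) (sp_val phi i) &
      exists M : R, forall i w, (i < sp_size phi)%N -> `|sp_val phi i w| <= M].

Definition simple_value (phi : simple_process) (s : R) (w : Omega) : R :=
  \sum_(i < sp_size phi)
    sp_val phi i w * \1_`]sp_time phi i, sp_time phi i.+1] s.

Definition simple_integral (phi : simple_process) (M : R -> Omega -> R)
    (w : Omega) : R :=
  \sum_(i < sp_size phi)
    sp_val phi i w * (M (sp_time phi i.+1) w - M (sp_time phi i) w).

(* [I] is (a version of) the Ito integral of [phi] over ]a, b] with respect to
   the martingale [M], as the L^2-limit of integrals of simple predictable
   processes approximating [phi]. The isometry is that of L^2(P (x) ds), which
   is the one of a Levy martingale [M] with [E[M(t)^2] = t]. *)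
Definition is_ito_integral (M : R -> Omega -> R) (a b : R)
    (phi : R -> Omega -> R) (I : Omega -> R) :=
  measurable_fun setT I /\
  exists phin : nat -> simple_process,
    [/\ forall n, simple_predictable a b (phin n),
        (\int[P]_w \int[@lebesgue_measure R]_(s in `]a, b])
           ((simple_value (phin n) s w - phi s w) ^+ 2)%:E)%E
           @[n --> \oo] --> 0%E &
        'E_P[(fun w => (I w - simple_integral (phin n) M w) ^+ 2)%R]%E
           @[n --> \oo] --> 0%E].

Definition is_iterated_integral (M1 M2 : R -> Omega -> R) (a b : R)
    (I : Omega -> R) :=
  is_ito_integral M2 a b
    (fun s w => lim (M1 r w @[r --> s^'-]) - M1 a w) I.

(* [D = \sum_(k, l) T k l] in [L^2(Omega; L(V))], [V] finite-dimensional; [D]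
   is a representative which is pathwise a linear operator on [V]. *)
Definition is_random_operator_series (H : hilbertType R) (V : set H)
    (T : nat -> nat -> Omega -> H -> H) (D : Omega -> H -> H) :=
  [/\ forall w, linear_on V (D w),
      forall w v, V v -> V (D w v),
      forall v, V v -> measurable_wrt measurable (fun w => D w v) &
      forall v, V v ->
        mean_square (fun w => D w v - \sum_(k < n) \sum_(l < n) T k l w v)
          @[n --> \oo] --> 0%E].

Fixpoint milstein (H : hilbertType R) (Ddet : H -> H)
    (DEM DM : nat -> Omega -> H -> H) (x0 : Omega -> H) (j : nat)
    (w : Omega) : H :=
  if j is i.+1 then
    let x := milstein Ddet DEM DM x0 i w in Ddet x + DEM i w x + DM i w x
  else x0 w.

Section stability.
Variables (H : hilbertType R) (V : set H).
(* [scheme x0 j] is the solution at step [j] with initial value [x0] *)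
Variable scheme : (Omega -> H) -> nat -> Omega -> H.

Definition is_initial_value (x0 : Omega -> H) :=
  [/\ forall w, V (x0 w), measurable_wrt (Filt 0) x0 &
      (mean_square x0 < +oo)%E].

Definition mean_square_stable :=
  forall eps : R, 0 < eps -> exists2 delta : R, 0 < delta &
    forall x0, is_initial_value x0 -> (mean_square x0 < delta%:E)%E ->
      forall j, (mean_square (scheme x0 j) < eps%:E)%E.

Definition asymptotically_mean_square_stable :=
  mean_square_stable /\
  exists2 delta : R, 0 < delta &
    forall x0, is_initial_value x0 -> (mean_square x0 < delta%:E)%E ->
      mean_square (scheme x0 j) @[j --> \oo] --> 0%E.

End stability.
End stochastics.

(* Main.v *)
(* Proof idea. Write X^{j+1} = D_j X^j with random operators D_j on V_h. Everything
   rests on E[X^{j+1} (x) Y^{j+1}] = S E[X^j (x) Y^j] for two solutions X and Y, that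
   is, in coordinates with respect to the eigenbasis e, on the conditional moments
     E[d_{ik} d_{i'k'} | F_{t_j}] = <S (e_k (x) e_k'), e_i (x) e_i'>
   of the matrix entries d of D_j being constants. Increments of L are independent of
   the past, and an iterated integral is the L^2-limit of Riemann sums
   sum_i (L_k(s_i) - L_k(t_j)) (L_l(s_{i+1}) - L_l(s_i)); by the Ito isometry for step
   processes this follows from convergence of the integrands in L^2(P (x) ds), which
   Fatou's lemma gives. The conditional moments of Riemann sums are explicit, only
   the diagonal terms survive (the L_k are uncorrelated), and they pass to the limit.
   The entries of D_j are F_{t_{j+1}}-measurable because the filtration is complete.
   Stability is then equivalent to S^j -> 0: using pairs of solutions, and not only
   X = Y, also covers the antisymmetric tensors. Finally S^j -> 0 iff all eigenvalues
   of S lie in the open unit disc. *)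
From HB Require Import structures.
Require Import Defs.
From mathcomp Require Import all_boot all_order all_algebra.
From mathcomp Require Import all_classical all_reals all_analysis.
From mathcomp Require Import measurable_realfun complex.
From mathcomp Require Import simple_functions measurable_fun_approximation.
From mathcomp Require Import ring lra.

Set Implicit Arguments.
Unset Strict Implicit.
Unset Printing Implicit Defensive.

Import Order.TTheory GRing.Theory Num.Theory.
Import numFieldNormedType.Exports HBNNSimple.
Local Open Scope classical_set_scope.
Local Open Scope ring_scope.

(** * Moments of real random variables *)

(** The definition of the Ito integral provides, for each iterated integral separately, some
    sequence of simple processes. Mixed moments of two integrals cannot be read off from two
    unrelated sequences, so both are shown to be limits of Riemann sums on one common equidistant
    grid. The factor dt^2/2 of S is the limit of the sums of (s_i - t_j)(s_{i+1} - s_i), which equal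
    dt^2/2 (1 - 1/(m+1)) on m+1 cells. Only second moments of L are available, and its coordinates
    are uncorrelated but possibly dependent. Products are therefore controlled by independence of
    the past alone: a coefficient is known at the left endpoint of its interval, so its square is
    independent of the squared increment and expectations factorise. A constant conditional mean is
    encoded by testing against past events and extended afterwards to integrable weights, because
    the weight x_k y_k' built from two solutions is merely integrable. The mean-square norm sees
    only the diagonal tensors e_i (x) e_i; all other entries of S^j are reached from it by
    Cauchy-Schwarz. *)

Section moments.
Context {R : realType} {d : measure_display} {Omega : measurableType d}.
Variable P : probability Omega R.
Implicit Types X Y Z : Omega -> R.

Definition L1 X : Prop := P.-integrable setT (EFin \o X).
Definition Ex X : R := (\int[P]_w X w)%R.
Definition L2 X : Prop := measurable_fun setT X /\ L1 (fun w => X w ^+ 2).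

Lemma L1_meas X : L1 X -> measurable_fun setT X.
Proof. by move=> /integrableP[/measurable_EFinP]. Qed.

Lemma L1D X Y : L1 X -> L1 Y -> L1 (fun w => X w + Y w).
Proof.
by move=> hX hY; exact: (integrableD measurableT hX hY).
Qed.

Lemma L1Z c X : L1 X -> L1 (fun w => c * X w).
Proof.
by move=> hX; exact: (integrableZl measurableT c hX).
Qed.

Lemma L1N X : L1 X -> L1 (fun w => - X w).
Proof.
move=> hX; have := L1Z (-1) hX; congr L1; apply/funext => w; rewrite mulN1r//.
Qed.

Lemma L1B X Y : L1 X -> L1 Y -> L1 (fun w => X w - Y w).
Proof. by move=> hX /L1N; apply: L1D. Qed.

Lemma L1_cst c : L1 (fun=> c).
Proof. exact: finite_measure_integrable_cst. Qed.

Lemma L1_sum (I : Type) (s : seq I) (p : pred I) (X : I -> Omega -> R) :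
  (forall i, L1 (X i)) -> L1 (fun w => \sum_(i <- s | p i) X i w).
Proof.
move=> hX; elim: s => [|i s IH].
  by under [X in L1 X]funext do rewrite big_nil; exact: L1_cst.
under [X in L1 X]funext do rewrite big_cons; case: (p i) => //.
exact: L1D.
Qed.

Lemma L1_le X Y : measurable_fun setT X -> L1 Y ->
  (forall w, `|X w| <= Y w) -> L1 X.
Proof.
move=> mX hY XY; apply: (le_integrable measurableT _ _ hY).
  exact/measurable_EFinP.
by move=> w _ /=; rewrite lee_fin (le_trans (XY w))// ler_norm.
Qed.

Lemma ExD X Y : L1 X -> L1 Y -> Ex (fun w => X w + Y w) = Ex X + Ex Y.
Proof. by move=> hX hY; rewrite /Ex RintegralD. Qed.

Lemma ExB X Y : L1 X -> L1 Y -> Ex (fun w => X w - Y w) = Ex X - Ex Y.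
Proof. by move=> hX hY; rewrite /Ex RintegralB. Qed.

Lemma ExZ c X : L1 X -> Ex (fun w => c * X w) = c * Ex X.
Proof. by move=> hX; rewrite /Ex RintegralZl. Qed.

Lemma Ex_cst c : Ex (fun=> c) = c.
Proof. rewrite /Ex Rintegral_cst//; transitivity (c * fine (P setT)) => //.
by rewrite probability_setT mulr1. Qed.

Lemma Ex_sum (I : Type) (s : seq I) (p : pred I) (X : I -> Omega -> R) :
  (forall i, L1 (X i)) ->
  Ex (fun w => \sum_(i <- s | p i) X i w) = \sum_(i <- s | p i) Ex (X i).
Proof.
move=> hX; elim: s => [|i s IH].
  by rewrite big_nil; under [X in Ex X]funext do rewrite big_nil; exact: Ex_cst.
rewrite big_cons -IH; under [X in Ex X]funext do rewrite big_cons.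
case: (p i) => //.
rewrite ExD//; exact: L1_sum.
Qed.

Lemma Ex_ge0 X : (forall w, 0 <= X w) -> 0 <= Ex X.
Proof. by move=> X0; apply: Rintegral_ge0. Qed.

Lemma Ex_le X Y : L1 X -> L1 Y -> (forall w, X w <= Y w) -> Ex X <= Ex Y.
Proof. by move=> hX hY XY; apply: le_Rintegral. Qed.

Lemma EFin_Ex X : L1 X -> (Ex X)%:E = (\int[P]_w (X w)%:E)%E.
Proof. by move=> hX; rewrite /Ex /Rintegral fineK// integrable_fin_num. Qed.

Lemma L1_norm X : L1 X -> L1 (fun w => `|X w|).
Proof. by move=> hX; exact: (integrable_norm hX). Qed.

Lemma Ex_norm X : L1 X -> `|Ex X| <= Ex (fun w => `|X w|).
Proof. by move=> hX; apply: le_normr_Rintegral. Qed.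

Lemma ge0_L1 X : measurable_fun setT X -> (forall w, 0 <= X w) ->
  (\int[P]_w (X w)%:E < +oo)%E -> L1 X.
Proof.
move=> mX X0 fX; apply/integrableP; split; first exact/measurable_EFinP.
by under eq_integral => w _ do rewrite /= ger0_norm//.
Qed.

Lemma L2_meas X : L2 X -> measurable_fun setT X.
Proof. by case. Qed.

Lemma L2_sqr X : L2 X -> L1 (fun w => X w ^+ 2).
Proof. by case. Qed.

Lemma L2M X Y : L2 X -> L2 Y -> L1 (fun w => X w * Y w).
Proof.
move=> [mX hX] [mY hY]; apply: (L1_le _ (L1D hX hY)).
  exact: measurable_funM.
move=> w; rewrite normrM -(real_normK (num_real (X w))).
rewrite -(real_normK (num_real (Y w))).
by have := normr_ge0 (X w); have := normr_ge0 (Y w); nra.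
Qed.

Lemma L2D X Y : L2 X -> L2 Y -> L2 (fun w => X w + Y w).
Proof.
move=> hX hY; split; first by apply: measurable_funD; exact: L2_meas.
have := L1D (L1D (L2_sqr hX) (L2_sqr hY)) (L1Z 2 (L2M hX hY)).
by congr L1; apply/funext => w; ring.
Qed.

Lemma L2Z c X : L2 X -> L2 (fun w => c * X w).
Proof.
move=> hX; split.
  by apply: measurable_funM => //; exact: L2_meas.
have := L1Z (c ^+ 2) (L2_sqr hX).
by congr L1; apply/funext => w; ring.
Qed.

Lemma L2N X : L2 X -> L2 (fun w => - X w).
Proof.
move=> hX; have := L2Z (-1) hX; congr L2; apply/funext => w; rewrite mulN1r//.
Qed.

Lemma L2B X Y : L2 X -> L2 Y -> L2 (fun w => X w - Y w).
Proof. by move=> hX /L2N; apply: L2D. Qed.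

Lemma L2_cst c : L2 (fun=> c).
Proof. by split => //; exact: L1_cst. Qed.

Lemma L2_sum (I : Type) (s : seq I) (p : pred I) (X : I -> Omega -> R) :
  (forall i, L2 (X i)) -> L2 (fun w => \sum_(i <- s | p i) X i w).
Proof.
move=> hX; elim: s => [|i s IH].
  by under [X in L2 X]funext do rewrite big_nil; exact: L2_cst.
under [X in L2 X]funext do rewrite big_cons; case: (p i) => //.
exact: L2D.
Qed.

Lemma L2_L1 X : L2 X -> L1 X.
Proof.
by move=> hX; have := L2M hX (L2_cst 1); congr L1; apply/funext => w; rewrite mulr1.
Qed.

Lemma L2_indic X A : measurable A -> L2 X -> L2 (fun w => \1_A w * X w).
Proof.
move=> mA hX; have m1 : measurable_fun setT (\1_A : Omega -> R) by [].
split; first by apply: measurable_funM => //; exact: L2_meas.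
apply: (L1_le _ (L2_sqr hX)).
  apply: measurable_funX; apply: measurable_funM => //; exact: L2_meas.
move=> w; rewrite indicE; case: (w \in A); rewrite ?mul1r ?mul0r.
  by rewrite ger0_norm// sqr_ge0.
by rewrite expr0n normr0 sqr_ge0.
Qed.

Lemma L1_indic X A : measurable A -> L1 X -> L1 (fun w => \1_A w * X w).
Proof.
move=> mA hX; apply: (L1_le _ (L1_norm hX)).
  by apply: measurable_funM => //; exact: L1_meas.
move=> w; rewrite indicE; case: (w \in A); rewrite ?mul1r ?mul0r ?normr0//.
Qed.

(** The form s^2 a + t^2 b - 2 s t c is nonnegative, being the mean of (s X - t Y)^2. *)
Lemma Ex_CS X Y : L2 X -> L2 Y ->
  Ex (fun w => X w * Y w) ^+ 2 <=
  Ex (fun w => X w ^+ 2) * Ex (fun w => Y w ^+ 2).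
Proof.
move=> hX hY; set a := Ex (fun w => X w ^+ 2); set b := Ex (fun w => Y w ^+ 2).
set c := Ex _.
have q (s t : R) : 0 <= s ^+ 2 * a + t ^+ 2 * b - 2 * s * t * c.
  have -> : s ^+ 2 * a + t ^+ 2 * b - 2 * s * t * c =
      Ex (fun w => (s * X w - t * Y w) ^+ 2).
    rewrite /a /b /c -!ExZ; try by [exact: L2_sqr|exact: L2M].
    rewrite -ExD -?ExB; try by repeat
       (apply: L1D || apply: L1Z || apply: L2_sqr || apply: L2M).
    by congr Ex; apply/funext => w; ring.
  by apply: Ex_ge0 => w; exact: sqr_ge0.
have a0 : 0 <= a by apply: Ex_ge0 => w; exact: sqr_ge0.
have b0 : 0 <= b by apply: Ex_ge0 => w; exact: sqr_ge0.
(* The points (c, a) and (b, c) give a (ab - c^2) >= 0 and b (ab - c^2) >= 0. If a = b = 0, the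
   point (1, c) gives -2 c^2 >= 0. *)
have := q c a; have := q b c; have := q 1 c; have := q 1 (-c); have := q c 1.
have [->|an0] := eqVneq a 0; first have [->|bn0] := eqVneq b 0.
- by nra.
- move=> _ _ _; have {}b0 : 0 < b by rewrite lt_neqAle eq_sym bn0.
  have := q b c; nra.
- have {}a0 : 0 < a by rewrite lt_neqAle eq_sym an0.
  move=> _ _ _ _ H.
  rewrite -subr_ge0 -(pmulr_rge0 _ a0); nra.
Qed.

Lemma Ex_sq_ge0 X : 0 <= Ex (fun w => X w ^+ 2).
Proof. by apply: Ex_ge0 => w; exact: sqr_ge0. Qed.

Lemma Ex_sqD X Y : L2 X -> L2 Y -> Ex (fun w => (X w + Y w) ^+ 2) <=
  2 * Ex (fun w => X w ^+ 2) + 2 * Ex (fun w => Y w ^+ 2).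
Proof.
move=> hX hY; rewrite -!ExZ; try exact: L2_sqr.
rewrite -ExD; try by apply: L1Z; exact: L2_sqr.
apply: Ex_le; first exact: L2_sqr (L2D _ _).
  by apply: L1D; apply: L1Z; exact: L2_sqr.
by move=> w; have := sqr_ge0 (X w - Y w); nra.
Qed.

End moments.

(** * Sub-sigma-algebras and independence *)

Section borel.
Context {R : realType}.

(** Bridges the Borel sets used by [measurable_wrt], generated by open sets, and the sigma-algebra
    carried by the type of reals. *)
Lemma borel_realE (B : set R) : <<s open>> B <-> measurable B.
Proof.
split=> [|mB].
  apply: smallest_sub => [|A]; last exact: open_measurable.
  split=> [|A mA|A mA]; [exact: measurable0| |exact: bigcupT_measurable].
  by rewrite setTD; exact: measurableC.
have : (@RGenOpens.G R).-sigma.-measurable B by rewrite -RGenOpens.measurableE.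
apply: smallest_sub => [|A [x [y ->]]]; first exact: smallest_sigma_algebra.
by apply: sub_sigma_algebra; exact: interval_open.
Qed.

Lemma continuous_borel (T : topologicalType) (phi : T -> R) (B : set R) :
  continuous phi -> measurable B -> <<s open>> (phi @^-1` B).
Proof.
move=> /continuousP cphi /borel_realE; move: B.
apply: (@smallest_sub _ _ _ [set B | <<s open>> (phi @^-1` B)]) => [|A oA].
  split=> [|A|A] /=.
  - by rewrite preimage_set0; exact: sigma_algebra0.
  - by rewrite setTD => /sigma_algebraCD; rewrite setTD.
  - by move=> mA; rewrite preimage_bigcup; exact: sigma_algebra_bigcup mA.
by apply: sub_sigma_algebra; exact: cphi.
Qed.

End borel.

Section sub_sigma_algebra.
Context {R : realType} {d : measure_display} {Omega : measurableType d}.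
Implicit Types (F : set (set Omega)) (X Y : Omega -> R).

(** The sigma-algebra is a plain set of sets, since a filtration puts many of them on one carrier.
    [fmeasP] moves to the generated measurable type to inherit the closure properties. *)
Definition fmeas F X := forall B : set R, measurable B -> F (X @^-1` B).

Variable F : set (set Omega).
Hypothesis hF : sigma_algebra setT F.

Lemma fmeasP X :
  fmeas F X <-> measurable_fun (setT : set (g_sigma_algebraType F)) X.
Proof.
split=> [fX _ B mB|fX B mB].
  rewrite setTI; apply: sub_sigma_algebra; exact: fX.
have := fX measurableT B mB; rewrite setTI.
by apply: smallest_sub.
Qed.

Lemma fmeas_cst c : fmeas F (fun=> c).
Proof. by apply/fmeasP; exact: measurable_cst. Qed.

Lemma fmeas_indic A : F A -> fmeas F (\1_A).
Proof.
move=> FA; apply/fmeasP.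
apply: (@measurable_indic _ (g_sigma_algebraType F) R setT A).
exact: sub_sigma_algebra.
Qed.

Lemma fmeasD X Y : fmeas F X -> fmeas F Y -> fmeas F (fun w => X w + Y w).
Proof. by move=> /fmeasP ? /fmeasP ?; apply/fmeasP; exact: measurable_funD. Qed.

Lemma fmeasB X Y : fmeas F X -> fmeas F Y -> fmeas F (fun w => X w - Y w).
Proof. by move=> /fmeasP ? /fmeasP ?; apply/fmeasP; exact: measurable_funB. Qed.

Lemma fmeasM X Y : fmeas F X -> fmeas F Y -> fmeas F (fun w => X w * Y w).
Proof. by move=> /fmeasP ? /fmeasP ?; apply/fmeasP; exact: measurable_funM. Qed.

Lemma fmeasZ c X : fmeas F X -> fmeas F (fun w => c * X w).
Proof. by move=> fX; apply: fmeasM => //; exact: fmeas_cst. Qed.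

Lemma fmeas_sum (I : Type) (s : seq I) (p : pred I) (X : I -> Omega -> R) :
  (forall i, fmeas F (X i)) -> fmeas F (fun w => \sum_(i <- s | p i) X i w).
Proof.
move=> hX; elim: s => [|i s IH].
  by under [X in fmeas _ X]funext do rewrite big_nil; exact: fmeas_cst.
under [X in fmeas _ X]funext do rewrite big_cons; case: (p i) => //.
exact: fmeasD.
Qed.

Lemma fmeas_cvg (X_ : nat -> Omega -> R) X : (forall n, fmeas F (X_ n)) ->
  (forall w, X_ n w @[n --> \oo] --> X w) -> fmeas F X.
Proof.
move=> hX XX; apply/fmeasP.
apply: (@measurable_fun_cvg _ (g_sigma_algebraType F) R setT X_) => [n|w _].
  by apply/fmeasP.
exact: XX.
Qed.

Lemma fmeas_maxr0 X : fmeas F X -> fmeas F (fun w => Num.max (X w) 0).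
Proof.
move=> /fmeasP ?; apply/fmeasP; apply: measurable_maxr => //.
Qed.

End sub_sigma_algebra.

Lemma fmeas_measurable (R : realType) d (Omega : measurableType d)
    (F : set (set Omega)) (X : Omega -> R) :
  F `<=` measurable -> fmeas F X -> measurable_fun setT X.
Proof. by move=> Fm fX _ B mB; rewrite setTI; apply/Fm/fX. Qed.

Lemma fmeas_sub (R : realType) d (Omega : measurableType d)
    (F F' : set (set Omega)) (X : Omega -> R) :
  F `<=` F' -> fmeas F X -> fmeas F' X.
Proof. by move=> FF' fX B mB; apply/FF'/fX. Qed.

Lemma fmeas_continuous (R : realType) d (Omega : measurableType d)
    (F : set (set Omega)) (T : topologicalType) (X : Omega -> T) (phi : T -> R) :
  continuous phi -> measurable_wrt F X -> fmeas F (fun w => phi (X w)).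
Proof.
by move=> cphi fX B mB; apply: (fX (phi @^-1` B)); exact: continuous_borel.
Qed.

Section independence.
Context {R : realType} {d : measure_display} {Omega : measurableType d}.
Variable P : probability Omega R.
Implicit Types X Y : Omega -> R.

(* The joint law of independent variables is the product of their laws. *)
Lemma indep_Ex X Y : L1 P X -> L1 P Y ->
  (forall A B : set R, measurable A -> measurable B ->
    P (X @^-1` A `&` Y @^-1` B) = (P (X @^-1` A) * P (Y @^-1` B))%E) ->
  L1 P (fun w => X w * Y w) /\ Ex P (fun w => X w * Y w) = Ex P X * Ex P Y.
Proof.
move=> iX iY XY; have mX := L1_meas iX; have mY := L1_meas iY.
have mZ : measurable_fun setT (fun w => (X w, Y w)).
  exact: measurable_fun_pair.
pose Xr : {RV P >-> R} := HB.pack X (isMeasurableFun.Build _ _ _ _ X mX).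
pose Yr : {RV P >-> R} := HB.pack Y (isMeasurableFun.Build _ _ _ _ Y mY).
pose Zr : {RV P >-> (R * R)%type} :=
  HB.pack (fun w => (X w, Y w)) (isMeasurableFun.Build _ _ _ _ (fun w => (X w, Y w)) mZ).
have lawZ (A : set (R * R)) : measurable A ->
    (distribution P Xr \x distribution P Yr)%E A = distribution P Zr A.
  apply: product_measure_unique => {}A B mA mB.
  exact: XY.
have mf : measurable_fun setT (fun z : R * R => `|(z.1 * z.2)%:E|%E).
  apply: measurableT_comp => //; apply/measurable_EFinP.
  by apply: measurable_funM; [exact: measurable_fst|exact: measurable_snd].
have mg : measurable_fun setT (fun z : R * R => (z.1 * z.2)%:E).
  apply/measurable_EFinP.
  by apply: measurable_funM; [exact: measurable_fst|exact: measurable_snd].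
have eqlaw (h : R * R -> \bar R) : measurable_fun setT h ->
    (\int[distribution P Zr]_z h z =
     \int[distribution P Xr \x distribution P Yr]_z h z)%E.
  move=> mh; apply: eq_measure_integral => A mA _.
  exact/esym/lawZ.
have abs : (\int[P]_w `|(X w * Y w)%:E| =
    \int[distribution P Xr \x distribution P Yr]_z `|(z.1 * z.2)%:E|)%E.
  by rewrite -eqlaw// (ge0_integral_distribution Zr).
have mE : measurable_fun setT (fun y : R => `|y%:E|%E).
  by apply: measurableT_comp => //; exact/measurable_EFinP.
have iabsY : (\int[distribution P Yr]_y `|y%:E| = \int[P]_w `|(Y w)%:E|)%E.
  by rewrite (ge0_integral_distribution Yr).
have iabsX : (\int[distribution P Xr]_y `|y%:E| = \int[P]_w `|(X w)%:E|)%E.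
  by rewrite (ge0_integral_distribution Xr).
have prodabs : (\int[distribution P Xr \x distribution P Yr]_z `|(z.1 * z.2)%:E| =
    (\int[P]_w `|(X w)%:E|) * (\int[P]_w `|(Y w)%:E|))%E.
  rewrite fubini_tonelli1// -iabsX -iabsY -ge0_integralZr//; last first.
    by apply: integral_ge0.
  apply: eq_integral => x _; rewrite /fubini_F/= -ge0_integralZl//.
  by apply: eq_integral => y _; rewrite /= normrM EFinM.
have finX : (\int[P]_w `|(X w)%:E| < +oo)%E by have /integrableP[] := iX.
have finY : (\int[P]_w `|(Y w)%:E| < +oo)%E by have /integrableP[] := iY.
have fin : (\int[distribution P Xr \x distribution P Yr]_z `|(z.1 * z.2)%:E| < +oo)%E.
  by rewrite prodabs lte_mul_pinfty//;
    [exact: integral_ge0|rewrite ge0_fin_numE//; exact: integral_ge0].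
have iXY : L1 P (fun w => X w * Y w).
  apply/integrableP; split; last by rewrite abs.
  by apply/measurable_EFinP; exact: measurable_funM.
split=> //; apply: EFin_inj; rewrite EFin_Ex// EFinM !EFin_Ex//.
have ig : (distribution P Xr \x distribution P Yr)%E.-integrable setT
    (fun z => (z.1 * z.2)%:E) by apply/integrableP; split.
transitivity (\int[distribution P Xr \x distribution P Yr]_z (z.1 * z.2)%:E)%E.
  by rewrite -eqlaw// (integral_distribution (X:=Zr)).
have iY' : (distribution P Yr).-integrable setT EFin.
  by apply/integrableP; split; rewrite ?iabsY//; exact/measurable_EFinP.
have iX' : (distribution P Xr).-integrable setT EFin.
  by apply/integrableP; split; rewrite ?iabsX//; exact/measurable_EFinP.
rewrite -integral12_prod_meas1//.
have eY : (\int[P]_w (Y w)%:E = \int[distribution P Yr]_y y%:E)%E.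
  by rewrite (integral_distribution (X:=Yr))//; exact: EFin_measurable.
have eX : (\int[P]_w (X w)%:E = \int[distribution P Xr]_y y%:E)%E.
  by rewrite (integral_distribution (X:=Xr))//; exact: EFin_measurable.
rewrite eX eY.
have := integrable_fin_num measurableT iY'.
case E : (\int[distribution P Yr]_y y%:E)%E => [c| |]// _.
rewrite -integralZr//; apply: eq_integral => x _.
rewrite /fubini_F/= -E -integralZl//.
Qed.

End independence.

(** * Conditional moments and L2 limits *)

Section L2_limits.
Context {R : realType} {d : measure_display} {Omega : measurableType d}.
Variable P : probability Omega R.
Implicit Types X Y Z : Omega -> R.

Definition L2cvg (Xs : nat -> Omega -> R) X :=
  [/\ forall n, L2 P (Xs n), L2 P X &
      Ex P (fun w => (X w - Xs n w) ^+ 2) @[n --> \oo] --> (0 : R)].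

Lemma L2cvg_cst X : L2 P X -> L2cvg (fun=> X) X.
Proof.
move=> hX; split => //.
under eq_fun do (under [X in Ex _ X]funext do rewrite subrr expr0n/=).
by rewrite Ex_cst; exact: cvg_cst.
Qed.

Lemma L2_norm X : L2 P X -> L2 P (fun w => `|X w|).
Proof.
move=> [mX hX]; split; first exact: measurableT_comp.
by move: hX; congr L1; apply/funext => w; rewrite real_normK// num_real.
Qed.

Lemma Ex_abs_CS X Y : L2 P X -> L2 P Y -> Ex P (fun w => `|X w * Y w|) <=
  Num.sqrt (Ex P (fun w => X w ^+ 2)) * Num.sqrt (Ex P (fun w => Y w ^+ 2)).
Proof.
move=> hX hY; rewrite -sqrtrM ?Ex_sq_ge0//.
rewrite -(ler_pXn2r (n:=2))// ?nnegrE ?sqrtr_ge0//; last exact: Ex_ge0.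
rewrite sqr_sqrtr; last by rewrite mulr_ge0// Ex_sq_ge0.
have := Ex_CS (L2_norm hX) (L2_norm hY).
under [X in Ex _ X ^+ 2]funext do rewrite -normrM.
congr (_ <= Ex P _ * Ex P _); apply/funext => w; by rewrite real_normK// num_real.
Qed.

(** Convergence in L^1 is the mode in which conditional second moments pass to the limit. Each of
    the three terms of the expansion around (X, Y) is bounded by Cauchy-Schwarz. *)
Lemma L2cvg_mul (Xs : nat -> Omega -> R) X (Ys : nat -> Omega -> R) Y : L2cvg Xs X -> L2cvg Ys Y ->
  Ex P (fun w => `|X w * Y w - Xs n w * Ys n w|) @[n --> \oo] --> (0 : R).
Proof.
move=> [hXs hX cX] [hYs hY cY].
pose a n := Num.sqrt (Ex P (fun w => (X w - Xs n w) ^+ 2)).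
pose b n := Num.sqrt (Ex P (fun w => (Y w - Ys n w) ^+ 2)).
have a0 : a n @[n --> \oo] --> (0 : R).
  by rewrite -sqrtr0; apply: (cvg_comp _ _ cX); exact: sqrt_continuous.
have b0 : b n @[n --> \oo] --> (0 : R).
  by rewrite -sqrtr0; apply: (cvg_comp _ _ cY); exact: sqrt_continuous.
pose x := Num.sqrt (Ex P (fun w => X w ^+ 2)).
pose y := Num.sqrt (Ex P (fun w => Y w ^+ 2)).
apply: (@squeeze_cvgr _ _ _ _ (fun=> 0) (fun n => a n * y + x * b n + a n * b n)).
- near=> n; rewrite Ex_ge0//=.
  have hXB := L2B hX (hXs n); have hYB := L2B hY (hYs n).
  have i1 := L1_norm (L2M hXB hY); have i2 := L1_norm (L2M hX hYB).
  have i3 := L1_norm (L2M hXB hYB).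
  apply: le_trans (lerD (lerD (Ex_abs_CS hXB hY) (Ex_abs_CS hX hYB))
                        (Ex_abs_CS hXB hYB)).
  rewrite -!ExD//; last exact: L1D.
  apply: Ex_le.
  - by apply/L1_norm/L1B; exact: L2M.
  - by apply: L1D => //; exact: L1D.
  move=> w; have -> : X w * Y w - Xs n w * Ys n w =
    (X w - Xs n w) * Y w + X w * (Y w - Ys n w) - (X w - Xs n w) * (Y w - Ys n w).
    by ring.
  by rewrite (le_trans (ler_normB _ _))// lerD2r ler_normD.
- exact: cvg_cst.
- rewrite -[X in _ --> X](_ : 0 * y + x * 0 + 0 * 0 = 0); last first.
    by rewrite !mulr0 mul0r !addr0.
  by repeat apply: cvgD; apply: cvgM => //; exact: cvg_cst.
Unshelve. all: by end_near. Qed.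

End L2_limits.

Section conditional_moments.
Context {R : realType} {d : measure_display} {Omega : measurableType d}.
Variable P : probability Omega R.
Variable F : set (set Omega).
Hypothesis hF : sigma_algebra setT F.
Hypothesis Fm : F `<=` measurable.
Implicit Types X Y Z : Omega -> R.

(* The conditional expectation of [Y] given [F] is the constant [c]. *)
Definition cond_mean Y c := L1 P Y /\
  forall A, F A -> Ex P (fun w => \1_A w * Y w) = c * Ex P (\1_A).

Lemma L1_set A : F A -> L1 P (\1_A).
Proof.
move=> FA; have := @L1_indic _ _ _ P _ _ (Fm FA) (L1_cst P 1).
by congr L1; apply/funext => w; rewrite mulr1.
Qed.

Lemma cond_mean_L1 Y c : cond_mean Y c -> L1 P Y. Proof. by case. Qed.

Lemma cond_mean_eq Y c c' : cond_mean Y c -> c = c' -> cond_mean Y c'.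
Proof. by move=> h <-. Qed.

Lemma cond_mean_cst c : cond_mean (fun=> c) c.
Proof.
split=> [|A FA]; first exact: L1_cst.
by rewrite -ExZ; [congr Ex; apply/funext => w; rewrite mulrC|exact: L1_set].
Qed.

Lemma cond_meanD Y c Z c' : cond_mean Y c -> cond_mean Z c' -> cond_mean (fun w => Y w + Z w) (c + c').
Proof.
move=> [iY hY] [iZ hZ]; split=> [|A FA]; first exact: L1D.
rewrite mulrDl -hY// -hZ// -ExD; try (apply: L1_indic => //; exact: Fm).
by congr Ex; apply/funext => w; rewrite mulrDr.
Qed.

Lemma cond_meanZ a Y c : cond_mean Y c -> cond_mean (fun w => a * Y w) (a * c).
Proof.
move=> [iY hY]; split=> [|A FA]; first exact: L1Z.
rewrite -mulrA -hY// -ExZ; last by (apply: L1_indic => //; exact: Fm).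
by congr Ex; apply/funext => w; rewrite mulrCA.
Qed.

Lemma cond_mean_sum (I : Type) (s : seq I) (p : pred I) (Y : I -> Omega -> R) c :
  (forall i, cond_mean (Y i) (c i)) ->
  cond_mean (fun w => \sum_(i <- s | p i) Y i w) (\sum_(i <- s | p i) c i).
Proof.
move=> hY; elim: s => [|i s IH].
  by rewrite big_nil; under [X in cond_mean X]funext do rewrite big_nil; exact: cond_mean_cst.
rewrite big_cons; under [X in cond_mean X]funext do rewrite big_cons.
by case: (p i) => //; exact: cond_meanD.
Qed.

(** The test functions are indicators, bounded by 1, so L^1 convergence suffices. *)
Lemma cond_mean_cvg (Ys : nat -> Omega -> R) c_ Y c : (forall n, cond_mean (Ys n) (c_ n)) ->
  L1 P Y -> Ex P (fun w => `|Y w - Ys n w|) @[n --> \oo] --> (0 : R) ->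
  c_ n @[n --> \oo] --> c -> cond_mean Y c.
Proof.
move=> hYs iY YY cc; split=> // A FA.
have cv : Ex P (fun w => \1_A w * Ys n w) @[n --> \oo] --> Ex P (fun w => \1_A w * Y w).
  apply/cvgrPdist_le => e e0; move/cvgrPdist_le: YY => /(_ e e0).
  apply: filterS => n; rewrite sub0r normrN ger0_norm; last exact: Ex_ge0.
  apply: le_trans.
  have j1 := L1_indic (Fm FA) iY.
  have j2 := L1_indic (Fm FA) (cond_mean_L1 (hYs n)).
  have i1 := L1B j1 j2.
  rewrite -ExB//; apply: (le_trans (Ex_norm i1)); apply: Ex_le.
  - exact: L1_norm.
  - by apply/L1_norm/L1B => //; exact: cond_mean_L1 (hYs n).
  move=> w; rewrite -mulrBr normrM; apply: ler_piMl => //.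
  by rewrite indicE; case: (w \in A); rewrite ?normr1 ?normr0.
have cv' : Ex P (fun w => \1_A w * Ys n w) @[n --> \oo] --> c * Ex P (\1_A).
  under eq_fun do rewrite (hYs _).2//.
  by apply: cvgM => //; exact: cvg_cst.
exact: (cvg_unique _ cv cv').
Qed.

Lemma cond_mean_mul_cvg (Xs Ys : nat -> Omega -> R) X Y c_ c :
  L2cvg P Xs X -> L2cvg P Ys Y ->
  (forall n, cond_mean (fun w => Xs n w * Ys n w) (c_ n)) ->
  c_ n @[n --> \oo] --> c -> cond_mean (fun w => X w * Y w) c.
Proof.
move=> XX YY h cc; apply: cond_mean_cvg h _ (L2cvg_mul XX YY) cc.
by case: XX YY => [_ ? _] [_ ? _]; exact: L2M.
Qed.

Lemma indep_cond_mean Y : L1 P Y ->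
  (forall A (B : set R), F A -> measurable B ->
    P (A `&` Y @^-1` B) = (P A * P (Y @^-1` B))%E) ->
  forall X, L1 P X -> fmeas F X ->
  L1 P (fun w => X w * Y w) /\ Ex P (fun w => X w * Y w) = Ex P X * Ex P Y.
Proof.
move=> iY ind X iX fX; apply: indep_Ex => // A B mA mB.
by apply: ind => //; exact: fX.
Qed.

(** From indicators to simple weights by linearity, then to X by monotone convergence, for which the
    products with Y >= 0 are monotone too. Integrability of the product is part of the result: its
    integral is c E[X]. *)
Lemma cond_mean_ext_ge0 X Y c : cond_mean Y c -> (forall w, 0 <= Y w) ->
  L1 P X -> fmeas F X -> (forall w, 0 <= X w) ->
  L1 P (fun w => X w * Y w) /\ Ex P (fun w => X w * Y w) = c * Ex P X.
Proof.
move=> [iY hY] Y0 iX fX X0.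
(* Measurability for the type generated by F makes the level sets of the simple approximations
   events of F. *)
have mX : measurable_fun (setT : set (g_sigma_algebraType F)) (EFin \o X).
  by apply/measurable_EFinP/fmeasP.
pose Xn n (w : Omega) : R := nnsfun_approx measurableT mX n w.
have Xn0 n w : 0 <= Xn n w by [].
have XnX w : Xn n w @[n --> \oo] --> X w.
  have := @cvg_nnsfun_approx _ _ _ _ measurableT _ mX _ w Logic.I.
  by move=> /(_ (fun x _ => X0 x)) /fine_cvg.
have ndX w : {homo Xn ^~ w : n m / (n <= m)%N >-> n <= m}.
  by move=> n m nm; have := nd_nnsfun_approx measurableT mX nm => /lefP/(_ w).
have XnE n : exists (s : seq R) (A : R -> set Omega), (forall r, F (A r)) /\
    Xn n = (fun w => \sum_(r <- s) r * \1_(A r) w).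
  pose f := nnsfun_approx measurableT mX n.
  exists (finmap.enum_fset (fset_set (range f))), (fun r => f @^-1` [set r]).
  split=> [r|].
    have := @measurable_sfunP _ _ _ _ f _ (measurable_set1 r).
    by apply: smallest_sub.
  by apply/funext => w; rewrite /Xn -/f fimfunE fsbig_finite//.
have iXn n : L1 P (Xn n).
  have [s [A [FA ->]]] := XnE n.
  by apply: L1_sum => r; apply/L1Z/L1_set.
have EXn n : L1 P (fun w => Xn n w * Y w) /\
    Ex P (fun w => Xn n w * Y w) = c * Ex P (Xn n).
  have [s [A [FA ->]]] := XnE n.
  have ii r : L1 P (fun w => r * (\1_(A r) w * Y w)).
    by apply/L1Z/L1_indic => //; exact/Fm.
  have -> : (fun w => (\sum_(r <- s) r * \1_(A r) w) * Y w) =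
      (fun w => \sum_(r <- s) r * (\1_(A r) w * Y w)).
    by apply/funext => w; rewrite mulr_suml; apply: eq_bigr => r _; rewrite mulrA.
  split; first exact: L1_sum.
  rewrite !Ex_sum//; last by move=> r; apply/L1Z/L1_set.
  rewrite mulr_sumr; apply: eq_bigr => r _.
  rewrite !ExZ ?hY//; [by ring|exact: L1_set|].
  by apply: L1_indic => //; exact/Fm.
have mcv (W : nat -> Omega -> R) (W' : Omega -> R) : (forall n, L1 P (W n)) ->
   (forall n w, 0 <= W n w) ->
   (forall w, {homo W ^~ w : n m / (n <= m)%N >-> n <= m}) ->
   (forall w, W n w @[n --> \oo] --> W' w) ->
   (Ex P (W n))%:E @[n --> \oo] --> (\int[P]_w (W' w)%:E)%E.
  move=> iW W0 ndW WW.
  rewrite (_ : (fun n => (Ex P (W n))%:E) = (fun n => \int[P]_w (W n w)%:E)%E);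
    last by apply/funext => n; rewrite EFin_Ex.
  have -> : (\int[P]_w (W' w)%:E = \int[P]_w limn (fun n => (W n w)%:E))%E.
    apply: eq_integral => w _; apply/esym/cvg_lim => //.
    by apply: cvg_EFin; [exact: nearW|exact: WW].
  apply: cvg_monotone_convergence => //.
  - by move=> n; apply/measurable_EFinP/L1_meas.
  - by move=> n w _; rewrite lee_fin.
  - by move=> w _ n m nm; rewrite lee_fin ndW.
have cX := mcv _ _ iXn Xn0 ndX XnX.
have cXY := mcv (fun n w => Xn n w * Y w) (fun w => X w * Y w).
have {}cXY := cXY (fun n => (EXn n).1) (fun n w => mulr_ge0 (Xn0 n w) (Y0 w)).
have {}cXY := cXY (fun w n m nm => ler_wpM2r (Y0 w) (ndX w _ _ nm)).
have {cXY} : (Ex P (fun w => Xn n w * Y w))%:E @[n --> \oo] -->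
    (\int[P]_w (X w * Y w)%:E)%E.
  by apply: cXY => w; apply: cvgM; [exact: XnX|exact: cvg_cst].
under eq_fun do rewrite (EXn _).2.
rewrite -EFin_Ex// in cX.
have cX' : (c * Ex P (Xn n))%:E @[n --> \oo] --> (c * Ex P X)%:E.
  by apply: cvg_EFin; [exact: nearW|apply: cvgM; [exact: cvg_cst|move/fine_cvg: cX]].
move=> /(cvg_unique _ cX') => /(_ (@ereal_hausdorff _)) E.
have iXY : L1 P (fun w => X w * Y w).
  apply: ge0_L1; [|by move=> w; rewrite mulr_ge0|by rewrite -E ltry].
  by apply: measurable_funM; [exact: L1_meas iX|exact: L1_meas iY].
by split=> //; apply: EFin_inj; rewrite EFin_Ex.
Qed.

End conditional_moments.

Section conditional_moments_ext.
Context {R : realType} {d : measure_display} {Omega : measurableType d}.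
Variable P : probability Omega R.
Variable F : set (set Omega).
Hypothesis hF : sigma_algebra setT F.
Hypothesis Fm : F `<=` measurable.
Implicit Types X Y Z : Omega -> R.

(** Splits the weight into its positive and negative parts, both F-measurable and integrable. *)
Lemma cond_mean_ext_nonneg X Y c : cond_mean P F Y c -> (forall w, 0 <= Y w) ->
  L1 P X -> fmeas F X ->
  L1 P (fun w => X w * Y w) /\ Ex P (fun w => X w * Y w) = c * Ex P X.
Proof.
move=> hY Y0 iX fX.
have aux Z : L1 P Z -> fmeas F Z -> let Zp := fun w => Num.max (Z w) 0 in
    [/\ L1 P Zp, L1 P (fun w => Zp w * Y w) & Ex P (fun w => Zp w * Y w) = c * Ex P Zp].
  move=> iZ fZ Zp; have fZp : fmeas F Zp by exact: fmeas_maxr0.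
  have iZp : L1 P Zp.
    apply: L1_le (L1_norm iZ) _; first exact: fmeas_measurable fZp.
    by move=> w; rewrite /Zp ger0_norm ?le_max ?lexx ?orbT// ge_max ler_norm/=.
  have [|h1 h2] := cond_mean_ext_ge0 hF Fm hY Y0 iZp fZp => //.
  by move=> w; rewrite /Zp le_max lexx orbT.
have [i1 i2 e1] := aux _ iX fX.
have fN : fmeas F (fun w => -1 * X w) by exact: fmeasZ.
have [j1 j2 e2] := aux _ (L1Z (-1) iX) fN.
have XE w : X w = Num.max (X w) 0 - Num.max (-1 * X w) 0.
  rewrite mulN1r; case/orP: (le_total 0 (X w)) => x0.
    by rewrite max_l// max_r ?subr0// oppr_le0.
  by rewrite max_r ?max_l ?oppr_ge0// opprK add0r.
have -> : (fun w => X w * Y w) =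
    (fun w => Num.max (X w) 0 * Y w - Num.max (-1 * X w) 0 * Y w).
  by apply/funext => w; rewrite -mulrBl -XE.
split; first exact: L1B.
by rewrite ExB// e1 e2 -mulrBr -ExB//; congr (_ * Ex P _); apply/funext => w; rewrite -XE.
Qed.

(* Polarization: the weight [X] is tested against the squares of [D + D'] and [D - D']. *)
Lemma cond_mean_ext X D D' a b c : L2 P D -> L2 P D' ->
  cond_mean P F (fun w => D w * D w) a -> cond_mean P F (fun w => D' w * D' w) b ->
  cond_mean P F (fun w => D w * D' w) c -> L1 P X -> fmeas F X ->
  L1 P (fun w => X w * (D w * D' w)) /\
  Ex P (fun w => X w * (D w * D' w)) = c * Ex P X.
Proof.
move=> lD lD' ha hb hc iX fX.
have p2 (s : R) : cond_mean P F (fun w => (D w + s * D' w) ^+ 2) (a + s ^+ 2 * b + 2 * s * c).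
  have := cond_meanD Fm (cond_meanD Fm ha (cond_meanZ Fm (s ^+ 2) hb)) (cond_meanZ Fm (2 * s) hc).
  by congr cond_mean; apply/funext => w; ring.
have [i1 e1] := cond_mean_ext_nonneg (p2 1) (fun w => sqr_ge0 _) iX fX.
have [i2 e2] := cond_mean_ext_nonneg (p2 (-1)) (fun w => sqr_ge0 _) iX fX.
have -> : (fun w => X w * (D w * D' w)) = (fun w => 4^-1 *
    (X w * (D w + 1 * D' w) ^+ 2 - X w * (D w + -1 * D' w) ^+ 2)).
  by apply/funext => w; field.
by split; [apply/L1Z/L1B|rewrite ExZ ?ExB ?e1 ?e2//; [field|exact: L1B]].
Qed.

(** A product of two square-integrable variables is in general only integrable. Here X^2 is an
    admissible weight for D^2, which gives E[X^2 D^2] = a E[X^2]. *)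
Lemma cond_mean_L2 X D a : L2 P D -> cond_mean P F (fun w => D w * D w) a ->
  L2 P X -> fmeas F X -> L2 P (fun w => D w * X w).
Proof.
move=> lD ha lX fX.
have fX2 : fmeas F (fun w => X w ^+ 2) by exact: fmeasM.
have [i _] := cond_mean_ext lD lD ha ha ha (L2_sqr lX) fX2.
split; first by apply: measurable_funM; [exact: L2_meas lD|exact: L2_meas lX].
by move: i; congr L1; apply/funext => w; ring.
Qed.

End conditional_moments_ext.

(** * Measurability of limits in a complete sub-sigma-algebra *)

Section completeness.
Context {R : realType} {d : measure_display} {Omega : measurableType d}.
Variable P : probability Omega R.
Variable F : set (set Omega).
Hypothesis hF : sigma_algebra setT F.
Hypothesis Fm : F `<=` measurable.
Hypothesis Fnull : P.-negligible `<=` F.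

Lemma sigma_algebraTI A B : F A -> F B -> F (A `&` B).
Proof.
move=> FA FB; have := @measurableI _ (g_sigma_algebraType F) A B.
by rewrite /measurable/= (smallest_id hF); apply.
Qed.

Lemma sigma_algebraTU A B : F A -> F B -> F (A `|` B).
Proof.
move=> FA FB; have := @measurableU _ (g_sigma_algebraType F) A B.
by rewrite /measurable/= (smallest_id hF); apply.
Qed.

Lemma sigma_algebraTC A : F A -> F (~` A).
Proof. by case: hF => _ + _ => /[apply]; rewrite setTD. Qed.

(** Cut off at the null set N, the sequence converges everywhere. On N nothing is known about X, but
    every subset of N is negligible and thus lies in F. *)
Lemma fmeas_ae_cvg (Xs : nat -> Omega -> R) (X : Omega -> R) :
  (forall n, fmeas F (Xs n)) ->
  {ae P, forall w, Xs n w @[n --> \oo] --> X w} -> fmeas F X.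
Proof.
move=> fXs [N [mN PN sub]].
have FN : F N by apply: Fnull; exists N; split.
have FC := sigma_algebraTC FN.
pose Z w := \1_(~` N) w * X w.
have fZ : fmeas F Z.
  apply: (@fmeas_cvg _ _ _ F hF (fun n w => \1_(~` N) w * Xs n w)) => [n|w].
    by apply: fmeasM => //; exact: fmeas_indic.
  rewrite /Z indicE; case: (boolP (w \in ~` N)) => wN.
    apply: cvgM; first exact: cvg_cst.
    by apply: contrapT => h; move: wN; rewrite inE; apply; exact: sub.
  by under eq_fun do rewrite mul0r; rewrite mul0r; exact: cvg_cst.
move=> B mB.
have -> : X @^-1` B = (~` N `&` Z @^-1` B) `|` (N `&` X @^-1` B).
  apply/seteqP; split=> w /=; rewrite /Z.
    have [wN|wN] := pselect (N w); first by right.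
    by left; split=> //; rewrite indicE mem_set// mul1r.
  by move=> [[wN]|[]//]; rewrite indicE mem_set// mul1r.
apply: sigma_algebraTU; first by apply: sigma_algebraTI => //; exact: fZ.
apply: Fnull; exists N; split=> //; exact: subIsetl.
Qed.

(* A subsequence with summable squared distances converges almost surely. *)
Lemma fmeas_L2cvg (Xs : nat -> Omega -> R) (X : Omega -> R) :
  (forall n, fmeas F (Xs n)) -> L2cvg P Xs X -> fmeas F X.
Proof.
move=> fXs [hXs hX cX].
have sel (k : nat) : exists n, Ex P (fun w => (X w - Xs n w) ^+ 2) <= 2^-1 ^+ k.
  have p0 : 0 < 2^-1 ^+ k :> R by rewrite exprn_gt0.
  move/cvgrPdist_le : cX => /(_ _ p0) [n _ /(_ n (leqnn n))] /=.
  by rewrite sub0r normrN ger0_norm ?Ex_sq_ge0// => ?; exists n.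
have {sel} [nu hnu] := choice sel.
apply: (@fmeas_ae_cvg (fun k => Xs (nu k))); first by move=> n; exact: fXs.
pose g k w := (X w - Xs (nu k) w) ^+ 2.
have ig k : L1 P (g k) by apply/L2_sqr/L2B.
have mg k : measurable_fun setT (EFin \o g k) by apply/measurable_EFinP/L1_meas.
have g0 k w : (0 <= (g k w)%:E)%E by rewrite lee_fin sqr_ge0.
have sumE : (\int[P]_w (\sum_(0 <= k <oo) (g k w)%:E) < +oo)%E.
  rewrite integral_nneseries//.
  apply: (@le_lt_trans _ _ (\sum_(0 <= k <oo) (2^-1 ^+ k : R)%:E)%E).
    apply: lee_nneseries => [*|k *]; first by apply: integral_ge0 => *; exact: g0.
    by rewrite -EFin_Ex// lee_fin; exact: hnu.
  have := @cvg_geometric_series R 1 2^-1.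
  rewrite ger0_norm// invf_lt1// ltr1n => /(_ isT) cg.
  have -> : (\sum_(0 <= k <oo) (2^-1 ^+ k : R)%:E = (1 * (1 - 2^-1)^-1)%:E)%E.
    apply/cvg_lim => //.
    rewrite (_ : (fun n => _) = EFin \o series (geometric 1 2^-1)).
      by apply: cvg_EFin => //; exact: nearW.
    apply/funext => n; rewrite sumEFin; congr EFin.
    by rewrite /series/=; apply: eq_bigr => k _; rewrite /geometric/= mul1r.
  exact: ltry.
have mS : measurable_fun setT (fun w => \sum_(0 <= k <oo) (g k w)%:E)%E.
  apply: (@ge0_emeasurable_sum _ _ _ setT (fun k w => (g k w)%:E) xpredT).
    by move=> k w _ _; exact: g0.
  by move=> k _; exact: mg.
have S0 w : (0 <= \sum_(0 <= k <oo) (g k w)%:E)%E by apply: nneseries_ge0.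
have iS : P.-integrable setT (fun w => \sum_(0 <= k <oo) (g k w)%:E)%E.
  apply/integrableP; split=> //.
  by under eq_integral do rewrite gee0_abs//.
have := integrable_ae measurableT iS; apply: filterS => w /(_ Logic.I) fS.
have cs : cvgn (series (fun k => g k w)).
  apply: nondecreasing_is_cvgn.
    by apply: nondecreasing_series => k _ _; exact: sqr_ge0.
  exists (fine (\sum_(0 <= k <oo) (g k w)%:E)%E) => _ [n _ <-].
  rewrite -lee_fin fineK// /series/= -sumEFin.
  by apply: nneseries_lim_ge.
have g2 : Num.sqrt (g k w) @[k --> \oo] --> (0 : R).
  rewrite -sqrtr0; apply: (cvg_comp _ _ (cvg_series_cvg_0 cs)).
  exact: sqrt_continuous.
apply/cvgrPdist_le => e e0; move/cvgrPdist_le : g2 => /(_ e e0).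
apply: filterS => k; rewrite sub0r normrN ger0_norm ?sqrtr_ge0//.
by rewrite /g sqrtr_sqr.
Qed.

End completeness.

(** * Hilbert spaces *)

Section hilbert_theory.
Context {R : realType} {K : hilbertType R}.
Implicit Types x y z : K.

Lemma dotDl x y z : dot (x + y) z = dot x z + dot y z.
Proof. by rewrite -[x in LHS]scale1r dot_linearl mul1r. Qed.

Lemma dot0l z : dot 0 z = 0 :> R.
Proof. by have := dotDl 0 0 z; rewrite addr0; lra. Qed.

Lemma dotZl a x z : dot (a *: x) z = a * dot x z.
Proof. by rewrite -[a *: x]addr0 dot_linearl dot0l addr0. Qed.

Lemma dotDr x y z : dot x (y + z) = dot x y + dot x z.
Proof. by rewrite dotC dotDl !(dotC x). Qed.

Lemma dotZr a x z : dot x (a *: z) = a * dot x z.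
Proof. by rewrite dotC dotZl dotC. Qed.

Lemma dot0r x : dot x 0 = 0 :> R. Proof. by rewrite dotC dot0l. Qed.

Lemma dotNl x z : dot (- x) z = - dot x z.
Proof. by rewrite -scaleN1r dotZl mulN1r. Qed.

Lemma dotNr x z : dot x (- z) = - dot x z.
Proof. by rewrite dotC dotNl dotC. Qed.

Lemma dotBl x y z : dot (x - y) z = dot x z - dot y z.
Proof. by rewrite dotDl dotNl. Qed.

Lemma dotBr x y z : dot x (y - z) = dot x y - dot x z.
Proof. by rewrite dotDr dotNr. Qed.

Lemma dot_suml (I : Type) (s : seq I) (p : pred I) (u : I -> K) z :
  dot (\sum_(i <- s | p i) u i) z = \sum_(i <- s | p i) dot (u i) z.
Proof.
by apply: (big_morph (fun v => dot v z)) => [v w|]; rewrite ?dotDl ?dot0l.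
Qed.

Lemma dot_sumr (I : Type) (s : seq I) (p : pred I) (u : I -> K) z :
  dot z (\sum_(i <- s | p i) u i) = \sum_(i <- s | p i) dot z (u i).
Proof.
by apply: (big_morph (fun v => dot z v)) => [v w|]; rewrite ?dotDr ?dot0r.
Qed.

Lemma dot_ge0 x : 0 <= dot x x :> R.
Proof. by rewrite dot_norm sqr_ge0. Qed.

Lemma dot_CS x y : `|dot x y| <= `|x| * `|y| :> R.
Proof.
have [->|y0] := eqVneq y 0; first by rewrite dot0r !normr0 mulr0.
have yy0 : 0 < dot y y :> R by rewrite dot_norm exprn_gt0// normr_gt0.
have := dot_ge0 (dot y y *: x - dot x y *: y).
rewrite !(dotBl, dotBr, dotZl, dotZr) (dotC y x) => h.
have {}h : dot x y ^+ 2 <= dot x x * dot y y.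
  by rewrite -subr_ge0 -(pmulr_rge0 _ yy0); move: h; nra.
rewrite -(ler_pXn2r (n:=2))// ?nnegrE ?mulr_ge0//.
by rewrite real_normK ?num_real// exprMn -!dot_norm.
Qed.

Lemma dot_continuousl z : continuous (fun x => dot x z : R).
Proof.
move=> x; apply/cvgrPdist_le => e e0.
have n0 : 0 < `|z| + 1 by rewrite ltr_wpDl.
have d0 : 0 < e / (`|z| + 1) by rewrite divr_gt0.
near=> y; rewrite -dotBl; apply: (le_trans (dot_CS _ _)).
have : `|x - y| <= e / (`|z| + 1).
  by near: y; apply: cvgr_dist_le => //; exact: cvg_id.
rewrite ler_pdivlMr// => h; apply: le_trans h; apply: ler_wpM2l => //.
by rewrite lerDl.
Unshelve. all: by end_near. Qed.

Lemma dense_near (D : set K) x (e : R) : dense D -> 0 < e ->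
  exists2 y, D y & `|x - y| < e.
Proof.
move=> dD e0; have [||y [/= by_ Dy]] := dD (ball x e).
- by exists x; exact: ballxx.
- exact: ball_open.
- by exists y => //; move: by_; rewrite -ball_normE.
Qed.

(** If x were nonzero, some y in D would satisfy |x - y| < |x|, and then |x|^2 = <x, x - y> <
    |x|^2. *)
Lemma dense_orthogonal (D : set K) x : dense D ->
  (forall y, D y -> dot x y = 0 :> R) -> x = 0.
Proof.
move=> dD xD; apply: contrapT => /eqP x0.
have nx : 0 < `|x| by rewrite normr_gt0.
have [y Dy] := dense_near x dD nx; have := dot_CS x (x - y).
rewrite dotBr (xD y)// subr0 dot_norm ger0_norm ?sqr_ge0// expr2 ler_pM2l//.
by move=> h /(le_lt_trans h); rewrite ltxx.
Qed.

Lemma lspan_orthogonal (A : set K) x : (forall y, A y -> dot x y = 0 :> R) ->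
  forall y, lspan A y -> dot x y = 0 :> R.
Proof.
move=> xA y [n [c [z [Az ->]]]]; rewrite dot_sumr big1// => i _.
by rewrite dotZr xA// mulr0.
Qed.

Lemma pythagoras x y : dot x y = 0 :> R -> `|x + y| ^+ 2 = `|x| ^+ 2 + `|y| ^+ 2 :> R.
Proof.
by move=> xy; rewrite -!dot_norm !(dotDl, dotDr) (dotC y x) xy; lra.
Qed.

Lemma orthonormal_dot_sum (I : finType) (e : I -> K) (c : I -> R) j :
  orthonormal_family e -> dot (\sum_i c i *: e i) (e j) = c j.
Proof.
move=> oe; rewrite dot_suml (bigD1 j)//= dotZl oe eqxx mulr1 big1 ?addr0// => i ij.
by rewrite dotZl oe (negbTE ij) mulr0.
Qed.

Lemma orthonormal_norm (I : finType) (e : I -> K) (c : I -> R) :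
  orthonormal_family e -> `|\sum_i c i *: e i| ^+ 2 = \sum_i c i ^+ 2 :> R.
Proof.
move=> oe; rewrite -dot_norm dot_sumr; apply: eq_bigr => j _.
by rewrite dotZr orthonormal_dot_sum.
Qed.

Definition fourier (f : nat -> K) n x := \sum_(k < n) dot x (f k) *: f k.

Lemma fourier_orthogonal (f : nat -> K) n x k : orthonormal_family f ->
  (k < n)%N -> dot (x - fourier f n x) (f k) = 0 :> R.
Proof.
move=> of_ kn; rewrite dotBl dot_suml (bigD1 (Ordinal kn))//= dotZl of_ eqxx mulr1.
rewrite big1 ?addr0 ?subrr// => i ik; rewrite dotZl of_.
by move: ik; rewrite -val_eqE/= => /negbTE ->; rewrite mulr0.
Qed.

Lemma fourier_le (f : nat -> K) n x : orthonormal_family f ->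
  `|x - fourier f n x| <= `|x|.
Proof.
move=> of_; rewrite -(ler_pXn2r (n:=2))// ?nnegrE//.
have : dot (x - fourier f n x) (fourier f n x) = 0 :> R.
  by rewrite dot_sumr big1// => k _; rewrite dotZr fourier_orthogonal// mulr0.
by move=> /pythagoras; rewrite subrK => ->; rewrite lerDl sqr_ge0.
Qed.

(** Best approximation: a finite combination of basis vectors lies within e of x. Once n exceeds all
    its indices, Pythagoras shows that the Fourier sum is at least as close. *)
Lemma cvg_fourier (f : nat -> K) x : hilbert_basis f ->
  fourier f n x @[n --> \oo] --> x.
Proof.
move=> [of_ df]; apply/cvgrPdist_lt => e e0.
have [y [m [c [z [fz ->]]]] xy] := dense_near x df e0.
have sel i : exists k, f k = z i by have [k _ <-] := fz i; exists k.
have {sel} [nu nuz] := choice sel.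
exists (\max_i (nu i)).+1 => // n /= nn.
apply: le_lt_trans xy; rewrite -(ler_pXn2r (n:=2))// ?nnegrE//.
set y' := \sum_i _.
have : dot (x - fourier f n x) (fourier f n x - y') = 0 :> R.
  rewrite dotBr dot_sumr big1 ?sub0r; last first.
    by move=> k _; rewrite dotZr fourier_orthogonal// mulr0.
  rewrite dot_sumr big1 ?oppr0// => i _; rewrite dotZr -nuz fourier_orthogonal ?mulr0//.
  by apply: leq_trans nn; rewrite ltnS; exact: leq_bigmax.
by move=> /pythagoras; rewrite addrA subrK => ->; rewrite lerDl sqr_ge0.
Qed.

End hilbert_theory.

(** * Moments of Levy increments *)

Section levy_increments.
Context {R : realType} {d : measure_display} {Omega : measurableType d}.
Variable P : probability Omega R.
Variable Filt : R -> set (set Omega).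
Hypothesis HFilt : is_usual_filtration P Filt.
Variable U : hilbertType R.
Variable L : R -> Omega -> U.
Hypothesis HL : is_levy_process P Filt L.
Hypothesis HL2 : square_integrable P L.
Hypothesis HLm : is_martingale P Filt L.
Variable Q : U -> U.
Hypothesis HQsa : forall x y, dot (Q x) y = dot x (Q y) :> R.
Hypothesis HQL : is_covariance_operator P L Q.
Implicit Types (x y : U) (s t : R) (X Y xi eta : Omega -> R).

Let sF t : 0 <= t -> sigma_algebra setT (Filt t).
Proof. exact: filt_sigma_algebra HFilt t. Qed.

Let Fm t : 0 <= t -> Filt t `<=` measurable.
Proof. exact: filt_measurable HFilt t. Qed.

Lemma fmeas_filt s t X : 0 <= s -> s <= t -> fmeas (Filt s) X -> fmeas (Filt t) X.
Proof. by move=> s0 st; apply: fmeas_sub; exact: (filt_increasing HFilt). Qed.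

Definition inc x s t (w : Omega) : R := dot (L t w) x - dot (L s w) x.

Lemma incE x s t w : inc x s t w = dot (L t w - L s w) x.
Proof. by rewrite dotBl. Qed.

Lemma inc_split x s t r w : inc x s r w = inc x s t w + inc x t r w.
Proof. by rewrite /inc; ring. Qed.

Lemma fmeas_levy t x : 0 <= t -> fmeas (Filt t) (fun w => dot (L t w) x).
Proof.
move=> t0; apply: (@fmeas_continuous _ _ _ _ _ _ (fun u => dot u x)).
  exact: dot_continuousl.
exact: levy_adapted HL _ t0.
Qed.

Lemma sqr_norm_continuous (K : hilbertType R) : continuous (fun u : K => `|u| ^+ 2 : R).
Proof.
move=> u; apply: (@continuous_comp _ _ _ (fun u : K => `|u| : R) (fun r => r ^+ 2)).
  exact: norm_continuous.
exact: exprn_continuous.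
Qed.

Lemma L2_levy t x : 0 <= t -> L2 P (fun w => dot (L t w) x).
Proof.
move=> t0; have fx := fmeas_levy x t0.
split; first exact: fmeas_measurable (Fm t0) fx.
have fn : fmeas (Filt t) (fun w => `|L t w| ^+ 2).
  apply: (@fmeas_continuous _ _ _ _ _ _ (fun u : U => `|u| ^+ 2)).
    exact: sqr_norm_continuous.
  exact: levy_adapted HL _ t0.
have iN : L1 P (fun w => `|L t w| ^+ 2).
  apply: ge0_L1 => [|w|]; [exact: fmeas_measurable (Fm t0) fn|exact: sqr_ge0|].
  by have := HL2 t0; rewrite /mean_square unlock.
apply: (L1_le _ (L1Z (`|x| ^+ 2) iN)).
  by apply: measurable_funX; exact: fmeas_measurable (Fm t0) fx.
move=> w; rewrite ger0_norm ?sqr_ge0// -exprMn mulrC.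
rewrite -(real_normK (num_real (dot _ _))) lerXn2r ?nnegrE ?mulr_ge0//.
exact: dot_CS.
Qed.

Lemma L2_inc x s t : 0 <= s -> 0 <= t -> L2 P (inc x s t).
Proof. by move=> s0 t0; apply: L2B; exact: L2_levy. Qed.

Lemma fmeas_inc x s t : 0 <= s -> s <= t -> fmeas (Filt t) (inc x s t).
Proof.
move=> s0 st; have t0 := le_trans s0 st.
apply: fmeasB; [exact: sF|exact: fmeas_levy|].
exact: fmeas_filt (fmeas_levy x s0).
Qed.

Lemma Ex_inc x s t : 0 <= s -> s <= t -> Ex P (inc x s t) = 0.
Proof.
move=> s0 st; have t0 := le_trans s0 st.
rewrite ExB; try exact/L2_L1/L2_levy.
apply/eqP; rewrite subr_eq0; apply/eqP; apply: EFin_inj.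
rewrite !EFin_Ex; try exact/L2_L1/L2_levy.
apply: HLm => //.
by have [h0 hC _] := sF s0; rewrite -(setD0 setT); exact: hC.
Qed.

Lemma Ex_levyM x y s t : 0 <= s -> s <= t ->
  Ex P (fun w => dot (L s w) x * dot (L t w) y) = s * dot (Q x) y.
Proof.
move=> s0 st; have t0 := le_trans s0 st.
apply: EFin_inj; rewrite EFin_Ex; last by apply: L2M; exact: L2_levy.
by have := HQL s0 t0 x y; rewrite unlock min_l.
Qed.

Lemma cov_sym x y : dot (Q x) y = dot (Q y) x :> R.
Proof. by rewrite HQsa dotC. Qed.

Lemma Ex_incM x y s t : 0 <= s -> s <= t ->
  Ex P (fun w => inc x s t w * inc y s t w) = (t - s) * dot (Q x) y.
Proof.
move=> s0 st; have t0 := le_trans s0 st.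
have -> : (fun w => inc x s t w * inc y s t w) =
  fun w => (dot (L t w) x * dot (L t w) y + dot (L s w) x * dot (L s w) y) -
    (dot (L s w) x * dot (L t w) y + dot (L s w) y * dot (L t w) x).
  by apply/funext => w; rewrite /inc; ring.
have l2 r z : 0 <= r -> L2 P (fun w => dot (L r w) z) by exact: L2_levy.
rewrite ExB ?ExD ?Ex_levyM//; try by repeat (apply: L1D || apply: L2M || exact: l2).
by rewrite (cov_sym y x); ring.
Qed.

Lemma levy_indep (phi : U -> R) s t X : continuous phi -> 0 <= s -> s <= t ->
  L1 P (fun w => phi (L t w - L s w)) -> L1 P X -> fmeas (Filt s) X ->
  L1 P (fun w => X w * phi (L t w - L s w)) /\
  Ex P (fun w => X w * phi (L t w - L s w)) =
    Ex P X * Ex P (fun w => phi (L t w - L s w)).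
Proof.
(* Independence is given for s < t only. For s = t the increment is 0 and the factor is the constant
   [phi 0]. *)
move=> cphi s0; rewrite le_eqVlt => /predU1P[<- _ iX _|st iphi iX fX].
  have -> : (fun w => phi (L s w - L s w)) = fun=> phi 0.
    by apply/funext => w; rewrite subrr.
  have -> : (fun w => X w * phi (L s w - L s w)) = fun w => phi 0 * X w.
    by apply/funext => w; rewrite subrr mulrC.
  by rewrite ExZ// Ex_cst mulrC; split => //; exact: L1Z.
apply: (@indep_cond_mean _ _ _ P (Filt s)) => // A B FA mB.
exact: (levy_independent HL s0 st FA (continuous_borel cphi mB)).
Qed.

Lemma incM_continuous x y : continuous (fun u : U => dot u x * dot u y : R).
Proof.
by move=> u; apply: cvgM; exact: dot_continuousl.
Qed.

Lemma Ex_indep_inc x s t X : 0 <= s -> s <= t -> L1 P X -> fmeas (Filt s) X ->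
  L1 P (fun w => X w * inc x s t w) /\ Ex P (fun w => X w * inc x s t w) = 0.
Proof.
move=> s0 st iX fX; have t0 := le_trans s0 st.
have E : inc x s t = fun w => dot (L t w - L s w) x.
  by apply/funext => w; rewrite incE.
have := @levy_indep (fun u => dot u x) s t X (@dot_continuousl _ _ x) s0 st.
rewrite -E (_ : (fun w => X w * dot (L t w - L s w) x) = fun w => X w * inc x s t w).
  by rewrite Ex_inc// mulr0; apply=> //; exact/L2_L1/L2_inc.
by rewrite E.
Qed.

Lemma Ex_indep_incM x y s t X : 0 <= s -> s <= t -> L1 P X -> fmeas (Filt s) X ->
  L1 P (fun w => X w * (inc x s t w * inc y s t w)) /\
  Ex P (fun w => X w * (inc x s t w * inc y s t w)) =
    Ex P X * ((t - s) * dot (Q x) y).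
Proof.
move=> s0 st iX fX; have t0 := le_trans s0 st.
have E : (fun w => inc x s t w * inc y s t w) =
    fun w => dot (L t w - L s w) x * dot (L t w - L s w) y.
  by apply/funext => w; rewrite !incE.
have := @levy_indep (fun u => dot u x * dot u y) s t X (@incM_continuous x y) s0 st.
rewrite -E (_ : (fun w => X w * (dot (L t w - L s w) x * dot (L t w - L s w) y)) =
                fun w => X w * (inc x s t w * inc y s t w)).
  by rewrite Ex_incM//; apply=> //; apply: L2M; exact: L2_inc.
by apply/funext => w; rewrite !incE.
Qed.

(** Fourth moments are not at hand: xi^2 and the squared increment are independent, so their product
    is integrable. *)
Lemma L2_mul_inc x s t xi : 0 <= s -> s <= t -> L2 P xi -> fmeas (Filt s) xi ->
  L2 P (fun w => xi w * inc x s t w).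
Proof.
move=> s0 st lxi fxi; have t0 := le_trans s0 st.
split.
  by apply: measurable_funM; [exact: L2_meas lxi|exact/L2_meas/L2_inc].
have f2 : fmeas (Filt s) (fun w => xi w ^+ 2) by apply: fmeasM => //; exact: sF.
have [i _] := Ex_indep_incM x x s0 st (L2_sqr lxi) f2.
by move: i; congr L1; apply/funext => w; ring.
Qed.

(** The length of the intersection of ]a, b] and ]c, e]. It is both the time factor in the
    covariance of two increments and the L^2 pairing of the two indicators, which is the source of
    the isometry. *)
Definition overlap (a b c e : R) : R := Num.max 0 (Num.min b e - Num.max a c).

Lemma overlapC a b c e : overlap a b c e = overlap c e a b.
Proof. by rewrite /overlap minC maxC maxC (maxC a c). Qed.

(** The longer increment is split at b; the part after b has mean zero given the past of b. *)
Lemma Ex_inc_common x y c b e X : 0 <= c -> c <= b -> b <= e ->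
  L1 P X -> fmeas (Filt c) X ->
  L1 P (fun w => X w * (inc x c b w * inc y c e w)) /\
  Ex P (fun w => X w * (inc x c b w * inc y c e w)) =
    dot (Q x) y * Ex P X * (b - c).
Proof.
move=> c0 cb be iX fX; have b0 := le_trans c0 cb.
have -> : (fun w => X w * (inc x c b w * inc y c e w)) =
  fun w => X w * (inc x c b w * inc y c b w) + (X w * inc x c b w) * inc y b e w.
  by apply/funext => w; rewrite (inc_split y c b e); ring.
have [i1 e1] := Ex_indep_incM x y c0 cb iX fX.
have [i2 _] := Ex_indep_inc x c0 cb iX fX.
have f2 : fmeas (Filt b) (fun w => X w * inc x c b w).
  apply: fmeasM; [exact: sF|exact: fmeas_filt fX|exact: fmeas_inc].
have [i3 e3] := Ex_indep_inc y b0 be i2 f2.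
by split; [exact: L1D|rewrite ExD// e1 e3; ring].
Qed.

Lemma Ex_inc_common_min x y c b e X : 0 <= c -> c <= b -> c <= e ->
  L1 P X -> fmeas (Filt c) X ->
  L1 P (fun w => X w * (inc x c b w * inc y c e w)) /\
  Ex P (fun w => X w * (inc x c b w * inc y c e w)) =
    dot (Q x) y * Ex P X * (Num.min b e - c).
Proof.
move=> c0 cb ce iX fX; case/orP: (le_total b e) => be.
  by rewrite min_l//; exact: Ex_inc_common.
rewrite min_r// cov_sym.
have -> : (fun w => X w * (inc x c b w * inc y c e w)) =
    fun w => X w * (inc y c e w * inc x c b w).
  by apply/funext => w; rewrite (mulrC (inc y _ _ _)).
exact: Ex_inc_common.
Qed.

(** The part of the first increment before time c is known at c, hence it pairs to zero with the
    increment starting there. What remains starts at c as well. *)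
Lemma Ex_inc_pair_le x y a b c e xi eta :
  0 <= a -> a <= b -> a <= c -> c <= e ->
  L2 P xi -> fmeas (Filt a) xi -> L2 P eta -> fmeas (Filt c) eta ->
  Ex P (fun w => (xi w * inc x a b w) * (eta w * inc y c e w)) =
    dot (Q x) y * Ex P (fun w => xi w * eta w) * overlap a b c e.
Proof.
move=> a0 ab ac ce lxi fxi leta feta.
have c0 := le_trans a0 ac; have b0 := le_trans a0 ab; have e0 := le_trans c0 ce.
rewrite /overlap (max_r ac).
have vanish b' : a <= b' -> b' <= c ->
  let X := fun w => xi w * inc x a b' w * eta w in
  L1 P (fun w => X w * inc y c e w) /\ Ex P (fun w => X w * inc y c e w) = 0.
  move=> ab' b'c X; apply: Ex_indep_inc => //.
    by apply: L2M => //; exact: L2_mul_inc.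
  apply: fmeasM => //; first exact: sF.
  apply: fmeasM; [exact: sF|exact: fmeas_filt fxi|].
  by apply: fmeas_filt (fmeas_inc x a0 ab') => //; exact: le_trans ab'.
case/orP: (le_total b c) => bc.
  rewrite max_l; last by rewrite subr_le0 ge_min bc.
  rewrite mulr0 -(vanish b ab bc).2; congr Ex; apply/funext => w; ring.
rewrite max_r; last by rewrite subr_ge0 le_min bc ce.
have [i1 e1] := vanish c ac (lexx c).
have fxe : fmeas (Filt c) (fun w => xi w * eta w).
  by apply: fmeasM => //; [exact: sF|exact: fmeas_filt fxi].
have [i2 e2] := Ex_inc_common_min x y c0 bc ce (L2M lxi leta) fxe.
rewrite -e2 -[RHS]add0r -e1 -ExD//; congr Ex; apply/funext => w.
by rewrite (inc_split x a c b); ring.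
Qed.

Lemma Ex_inc_pair x y a b c e xi eta :
  0 <= a -> a <= b -> 0 <= c -> c <= e ->
  L2 P xi -> fmeas (Filt a) xi -> L2 P eta -> fmeas (Filt c) eta ->
  Ex P (fun w => (xi w * inc x a b w) * (eta w * inc y c e w)) =
    dot (Q x) y * Ex P (fun w => xi w * eta w) * overlap a b c e.
Proof.
move=> a0 ab c0 ce lxi fxi leta feta; case/orP: (le_total a c) => ac.
  exact: Ex_inc_pair_le.
rewrite overlapC cov_sym (_ : (fun w => xi w * eta w) = fun w => eta w * xi w).
  rewrite -Ex_inc_pair_le//; congr Ex; apply/funext => w; ring.
by apply/funext => w; rewrite mulrC.
Qed.

End levy_increments.

(** * Ito isometry *)

Section overlap_integral.
Context {R : realType}.
Local Notation leb := (@lebesgue_measure R).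
Implicit Types a b c e : R.

Lemma indic_itvI a b c e : (fun s => \1_(`]a, b]) s * \1_(`]c, e]) s : R) =
  \1_(`]Num.max a c, Num.min b e]) :> (R -> R).
Proof.
apply/funext => s; rewrite !indicE !mem_setE !in_itv/= gt_max le_min -natrM mulnb.
by congr ((nat_of_bool _)%:R); do 4 case: (_ <= _) || case: (_ < _).
Qed.

Lemma integrable_indic_itvM a b c e :
  leb.-integrable setT (fun s => (\1_(`]a, b]) s * \1_(`]c, e]) s)%:E).
Proof.
rewrite (_ : (fun s => _) = EFin \o (\1_(`]Num.max a c, Num.min b e]) : R -> R)).
  exact: integrable_indic_itv.
by rewrite -indic_itvI.
Qed.

Lemma integral_indic_itvM a b c e :
  (\int[leb]_s (\1_(`]a, b]) s * \1_(`]c, e]) s)%:E = (overlap a b c e)%:E)%E.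
Proof.
rewrite (_ : (fun s => _) = EFin \o (\1_(`]Num.max a c, Num.min b e]) : R -> R));
  last by rewrite -indic_itvI.
rewrite integral_indic// setIT.
transitivity (leb (`]Num.max a c, Num.min b e]%classic : set R)) => //.
rewrite lebesgue_measure_itv/= lte_fin /overlap.
case: ltP => h; first by rewrite (@max_r _ _ 0) ?EFinB// subr_ge0 ltW.
by rewrite (@max_l _ _ 0)// subr_le0.
Qed.

End overlap_integral.

Section ito_isometry.
Context {R : realType} {d : measure_display} {Omega : measurableType d}.
Variable P : probability Omega R.
Variable Filt : R -> set (set Omega).
Hypothesis HFilt : is_usual_filtration P Filt.
Variable U : hilbertType R.
Variable L : R -> Omega -> U.
Hypothesis HL : is_levy_process P Filt L.
Hypothesis HL2 : square_integrable P L.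
Hypothesis HLm : is_martingale P Filt L.
Variable Q : U -> U.
Hypothesis HQsa : forall x y, dot (Q x) y = dot x (Q y) :> R.
Hypothesis HQL : is_covariance_operator P L Q.

Local Notation leb := (@lebesgue_measure R).

Variables (I : finType) (a b : I -> R) (xi : I -> Omega -> R).

(** Any finite family of intervals is allowed, overlapping or not. The difference of two step
    processes is then again one, over a disjoint union of indices, and no common refinement of
    partitions is needed. *)
Definition step_value (z : Omega * R) : R :=
  \sum_i xi i z.1 * \1_(`]a i, b i]) z.2.

Definition step_integral (y : U) (w : Omega) : R :=
  \sum_i xi i w * inc L y (a i) (b i) w.

Hypothesis a0 : forall i, 0 <= a i.
Hypothesis ab : forall i, a i <= b i.
Hypothesis lxi : forall i, L2 P (xi i).
Hypothesis fxi : forall i, fmeas (Filt (a i)) (xi i).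

Lemma measurable_step_value :
  measurable_fun (setT : set (Omega * R)) step_value.
Proof.
apply: measurable_sum => i; apply: measurable_funM.
  by apply: measurableT_comp; [exact: L2_meas (lxi i)|exact: measurable_fst].
have mi : measurable_fun setT (\1_(`]a i, b i]) : R -> R) by exact: measurable_indic.
exact: (measurableT_comp mi measurable_snd).
Qed.

Lemma L2_step_integral y : L2 P (step_integral y).
Proof.
by apply: L2_sum => i; exact: (L2_mul_inc HFilt HL HL2 HQsa HQL).
Qed.

Lemma step_value_norm : (\int[P]_w \int[leb]_s (step_value (w, s) ^+ 2)%:E =
  (\sum_i \sum_j Ex P (fun w => xi i w * xi j w) * overlap (a i) (b i) (a j) (b j))%:E)%E.
Proof.
pose V w := \sum_i \sum_j (xi i w * xi j w) * overlap (a i) (b i) (a j) (b j).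
transitivity (\int[P]_w (V w)%:E)%E.
  apply: eq_integral => w _.
  have sq s : step_value (w, s) ^+ 2 = \sum_i \sum_j (xi i w * xi j w) *
      (\1_(`]a i, b i]) s * \1_(`]a j, b j]) s).
    rewrite expr2 mulr_suml; apply: eq_bigr => i _; rewrite mulr_sumr.
    by apply: eq_bigr => j _ /=; ring.
  under eq_integral do rewrite sq pair_big/= -sumEFin.
  rewrite integral_sum//; last first.
    by move=> ij; under eq_fun do rewrite EFinM;
      apply: integrableZl => //; exact: integrable_indic_itvM.
  rewrite /V pair_big/= -sumEFin; apply: eq_bigr => ij _.
  under eq_integral do rewrite EFinM.
  rewrite integralZl//; last exact: integrable_indic_itvM.
  by rewrite integral_indic_itvM -EFinM.
have iV i j : L1 P (fun w => (xi i w * xi j w) * overlap (a i) (b i) (a j) (b j)).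
  have := L1Z (overlap (a i) (b i) (a j) (b j)) (L2M (lxi i) (lxi j)).
  by congr L1; apply/funext => w; rewrite mulrC.
rewrite -EFin_Ex; last by apply: L1_sum => i; exact: L1_sum.
rewrite /V Ex_sum; last by move=> i; exact: L1_sum.
congr EFin; apply: eq_bigr => i _; rewrite Ex_sum//; apply: eq_bigr => j _.
rewrite [RHS]mulrC -ExZ; last exact: L2M.
by congr Ex; apply/funext => w; rewrite mulrC.
Qed.

(** Both sides expand into the same double sum of E[xi_i xi_j] times overlaps, by [Ex_inc_pair] on
    the left and by integrating products of indicators on the right. *)
Lemma ito_isometry y : (Ex P (fun w => step_integral y w ^+ 2))%:E =
  ((dot (Q y) y)%:E * \int[P]_w \int[leb]_s (step_value (w, s) ^+ 2)%:E)%E.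
Proof.
rewrite step_value_norm -EFinM; congr EFin.
have l2 i : L2 P (fun w => xi i w * inc L y (a i) (b i) w).
  exact: (L2_mul_inc HFilt HL HL2 HQsa HQL).
have sq : (fun w => step_integral y w ^+ 2) = fun w => \sum_i \sum_j
    (xi i w * inc L y (a i) (b i) w) * (xi j w * inc L y (a j) (b j) w).
  by apply/funext => w; rewrite expr2 mulr_suml; apply: eq_bigr => i _; rewrite mulr_sumr.
rewrite sq Ex_sum; last by move=> i; apply: L1_sum => j; exact: L2M.
rewrite mulr_sumr; apply: eq_bigr => i _.
rewrite Ex_sum; last by move=> j; exact: L2M.
rewrite mulr_sumr; apply: eq_bigr => j _.
by rewrite (Ex_inc_pair HFilt HL HL2 HLm HQsa HQL)// mulrA.
Qed.

End ito_isometry.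

(** * Riemann sums of iterated integrals *)

Section extended_limits.
Context {R : realType}.

Lemma limn_einf_le (u : (\bar R)^nat) (c : \bar R) m :
  (forall n, (m <= n)%N -> (u n <= c)%E) -> (limn_einf u <= c)%E.
Proof.
move=> uc; rewrite limn_einf_lim; apply: lime_le; first exact: is_cvg_einfs.
near=> n; apply: (@le_trans _ _ (u (maxn n m))); last by apply: uc; exact: leq_maxr.
by apply: ereal_inf_lbound; exists (maxn n m) => //=; exact: leq_maxl.
Unshelve. all: by end_near. Qed.

Lemma cvge0_small (u : (\bar R)^nat) (eps : R) : u n @[n --> \oo] --> 0%E -> 0 < eps ->
  \forall n \near \oo, (u n <= eps%:E)%E.
Proof.
move=> /fine_cvgP[fu u0] e0; near=> n.
have fn : u n \is a fin_num by near: n.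
rewrite -(fineK fn) lee_fin; apply: (le_trans (ler_norm _)).
near: n; move/cvgrPdist_le : u0 => /(_ _ e0).
by apply: filterS => n; rewrite sub0r normrN.
Unshelve. all: by end_near. Qed.

End extended_limits.

(** * The squared norm of L^2(P (x) ds) *)

Section product_norm.
Context {R : realType} {d : measure_display} {Omega : measurableType d}.
Variable P : probability Omega R.
Local Notation leb := (@lebesgue_measure R).
Implicit Types h g k : Omega * R -> R.

Definition sqint h : \bar R := (\int[P \x leb]_z (h z ^+ 2)%:E)%E.

Lemma measurable_sqr h : measurable_fun setT h ->
  measurable_fun setT (fun z => (h z ^+ 2)%:E).
Proof. by move=> mh; apply/measurable_EFinP; exact: measurable_funX. Qed.

Lemma sqintE h : measurable_fun setT h ->
  (sqint h = \int[P]_w \int[leb]_s (h (w, s) ^+ 2)%:E)%E.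
Proof.
move=> mh; rewrite /sqint fubini_tonelli1//; first exact: measurable_sqr.
by move=> z; rewrite lee_fin sqr_ge0.
Qed.

(** With time as the outer variable, two Riemann processes can be compared at a fixed s, where their
    difference is a single increment. *)
Lemma sqintE2 h : measurable_fun setT h ->
  (sqint h = \int[leb]_s \int[P]_w (h (w, s) ^+ 2)%:E)%E.
Proof.
move=> mh; rewrite /sqint fubini_tonelli2//; first exact: measurable_sqr.
by move=> z; rewrite lee_fin sqr_ge0.
Qed.

Lemma sqint_le h g k : measurable_fun setT h -> measurable_fun setT g ->
  measurable_fun setT k -> (forall z, h z ^+ 2 <= 2 * g z ^+ 2 + 2 * k z ^+ 2) ->
  (sqint h <= 2%:E * sqint g + 2%:E * sqint k)%E.
Proof.
move=> mh mg mk hgk.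
have p0 (l : Omega * R -> R) z : (0 <= (l z ^+ 2)%:E :> \bar R)%E.
  by rewrite lee_fin sqr_ge0.
have q0 (l : Omega * R -> R) z : (0 <= 2%:E * (l z ^+ 2)%:E :> \bar R)%E.
  by apply: mule_ge0.
have mq (l : Omega * R -> R) : measurable_fun setT l ->
    measurable_fun setT (fun z => (2%:E * (l z ^+ 2)%:E)%E).
  by move=> ml; apply: measurable_funeM; exact: measurable_sqr.
have zl (l : Omega * R -> R) : measurable_fun setT l ->
    (2%:E * sqint l = \int[P \x leb]_z (2%:E * (l z ^+ 2)%:E))%E.
  by move=> ml; rewrite ge0_integralZl//; exact: measurable_sqr.
rewrite !zl// -ge0_integralD//; [|exact: mq|exact: mq].
apply: ge0_le_integral => //; first exact: measurable_sqr.
  by apply: emeasurable_funD; exact: mq.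
by move=> z _; rewrite -!EFinM -EFinD lee_fin.
Qed.

Lemma sqintD h g k : measurable_fun setT h -> measurable_fun setT g ->
  measurable_fun setT k ->
  (sqint (fun z => (h z - k z)%R) <= 2%:E * sqint (fun z => (h z - g z)%R) +
    2%:E * sqint (fun z => (g z - k z)%R))%E.
Proof.
move=> mh mg mk; apply: sqint_le; try exact: measurable_funB.
by move=> z; have := sqr_ge0 ((h z - g z) - (g z - k z)); nra.
Qed.

End product_norm.

Section riemann_sums.
Context {R : realType} {d : measure_display} {Omega : measurableType d}.
Variable P : probability Omega R.
Variable Filt : R -> set (set Omega).
Hypothesis HFilt : is_usual_filtration P Filt.
Variable U : hilbertType R.
Variable L : R -> Omega -> U.
Hypothesis HL : is_levy_process P Filt L.
Hypothesis HL2 : square_integrable P L.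
Hypothesis HLm : is_martingale P Filt L.
Variable Q : U -> U.
Hypothesis HQsa : forall x y, dot (Q x) y = dot x (Q y) :> R.
Hypothesis HQL : is_covariance_operator P L Q.

Local Notation leb := (@lebesgue_measure R).

Variables (a b : R).
Hypothesis a0 : 0 <= a.
Hypothesis ab : a < b.

(** The index m stands for m+1 cells, so the divisor never vanishes. *)
Definition mesh (m : nat) : R := (b - a) / m.+1%:R.
Definition grid m (i : nat) : R := a + i%:R * mesh m.

Lemma mesh_gt0 m : 0 < mesh m.
Proof. by rewrite divr_gt0// subr_gt0. Qed.

Lemma grid0 m : grid m 0 = a.
Proof. by rewrite /grid mul0r addr0. Qed.

Lemma grid_last m : grid m m.+1 = b.
Proof. by rewrite /grid /mesh mulrCA divff ?mulr1 ?subrKC// pnatr_eq0. Qed.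

Lemma grid_le m i j : (i <= j)%N -> grid m i <= grid m j.
Proof. by move=> ij; rewrite lerD2l ler_pM2r ?mesh_gt0// ler_nat. Qed.

Lemma grid_ge m i : a <= grid m i.
Proof. by rewrite -[X in X <= _](grid0 m); exact: grid_le. Qed.

Lemma gridS m i : grid m i.+1 = grid m i + mesh m.
Proof. by rewrite /grid -natr1; ring. Qed.

Lemma grid_locate m s : a < s -> s <= b ->
  exists i : 'I_m.+1, grid m i < s <= grid m i.+1.
Proof.
move=> as_ sb; have ex : exists i, s <= grid m i.+1.
  by exists m; rewrite grid_last.
have [i si imin] := ex_minnP ex.
have im : (i < m.+1)%N by rewrite ltnS; apply: imin; rewrite grid_last.
exists (Ordinal im); rewrite /= si andbT.
case: i si imin {im} => [|i] si imin; first by rewrite grid0.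
by rewrite ltNge; apply/negP => /imin; rewrite ltnn.
Qed.

Variable N : set Omega.
Hypothesis mN : measurable N.
Hypothesis PN : P N = 0%E.
Hypothesis cadN : forall w, ~ N w -> is_cadlag (fun t => L t w).

(** Kills the paths that may fail to be cadlag. Completeness of the filtration makes this factor
    measurable at every time. *)
Let rho : Omega -> R := \1_(~` N).

Definition riemann_coef (x : U) m (i : nat) (w : Omega) : R :=
  rho w * inc L x a (grid m i) w.

Definition riemann_sum_value x m : Omega * R -> R :=
  step_value (fun i : 'I_m.+1 => grid m i) (fun i => grid m i.+1)
    (fun i => riemann_coef x m i).

Definition riemann_sum (x y : U) m : Omega -> R :=
  step_integral L (fun i : 'I_m.+1 => grid m i) (fun i => grid m i.+1)
    (fun i => riemann_coef x m i) y.

Let sF t : 0 <= t -> sigma_algebra setT (Filt t).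
Proof. exact: filt_sigma_algebra HFilt t. Qed.

Lemma null_compl_filt t : 0 <= t -> Filt t (~` N).
Proof.
move=> t0; apply: sigma_algebraTC; first exact: sF.
apply: (filt_increasing HFilt (lexx 0) t0).
by apply: (filt_null HFilt); exists N; split.
Qed.

Lemma fmeas_riemann_coef x m i : fmeas (Filt (grid m i)) (riemann_coef x m i).
Proof.
have g0 : 0 <= grid m i := le_trans a0 (grid_ge m i).
apply: fmeasM; first exact: sF.
  by apply: fmeas_indic; [exact: sF|exact: null_compl_filt].
exact: (fmeas_inc HFilt HL x a0 (grid_ge m i)).
Qed.

Lemma L2_riemann_coef x m i : L2 P (riemann_coef x m i).
Proof.
have g0 : 0 <= grid m i := le_trans a0 (grid_ge m i).
by apply: L2_indic; [exact: measurableC|exact: (L2_inc HFilt HL HL2)].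
Qed.

Lemma measurable_riemann_sum_value x m : measurable_fun setT (riemann_sum_value x m).
Proof. by apply: (@measurable_step_value _ _ _ P) => i; exact: L2_riemann_coef. Qed.

Lemma L2_riemann_sum x y m : L2 P (riemann_sum x y m).
Proof.
apply: (L2_step_integral HFilt HL HL2 HQsa HQL) => i.
- exact: le_trans a0 (grid_ge m i).
- exact: grid_le.
- exact: L2_riemann_coef.
- exact: fmeas_riemann_coef.
Qed.

Lemma riemann_sum_value_out x m w s : s \notin `]a, b] -> riemann_sum_value x m (w, s) = 0.
Proof.
move=> sD; rewrite /riemann_sum_value /step_value big1// => i _ /=.
rewrite indicE memNset ?mulr0//= in_itv/= => /andP[gi si]; move/negP: sD; apply.
rewrite in_itv/= (le_lt_trans (grid_ge m i) gi) (le_trans si)//.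
by rewrite -(grid_last m); exact: grid_le.
Qed.

(** Exactly one cell ]grid i, grid (i+1)] contains s. Its left endpoint t is strictly smaller than s
    and within one mesh of it, so t approaches s from the left as the mesh shrinks. *)
Lemma riemann_sum_value_in x m s : a < s -> s <= b ->
  exists t, [/\ a <= t, t < s, s <= t + mesh m &
    forall w, riemann_sum_value x m (w, s) = rho w * inc L x a t w].
Proof.
move=> as_ sb; have [i /andP[gi si]] := grid_locate m as_ sb.
exists (grid m i); split => //; first exact: grid_ge.
  by rewrite -gridS.
move=> w; rewrite /riemann_sum_value /step_value (bigD1 i)//= indicE mem_set/=; last first.
  by rewrite in_itv/= gi si.
rewrite mulr1 big1 ?addr0// => j ji; rewrite indicE memNset ?mulr0//= in_itv/=.
move=> /andP[js sj]; have /orP[ij|ij] : (i < j)%N || (j < i)%N by rewrite -neq_ltn eq_sym.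
  by have := lt_le_trans js (le_trans si (grid_le m ij)); rewrite ltxx.
by have := lt_le_trans gi (le_trans sj (grid_le m ij)); rewrite ltxx.
Qed.

Let q x : R := dot (Q x) x.

Lemma cov_ge0 x : 0 <= q x.
Proof.
have b0 : 0 < b := le_lt_trans a0 ab.
have := Ex_incM HFilt HL HL2 HQsa HQL x x (lexx 0) (ltW b0).
rewrite subr0 => E; rewrite -(pmulr_rge0 _ b0) -E; apply: Ex_ge0 => w.
by rewrite -expr2 sqr_ge0.
Qed.

Lemma inc_sq_le x t t' c : 0 <= t -> t <= t' -> t' - t <= c ->
  (\int[P]_w ((rho w * inc L x t t' w) ^+ 2)%:E <= (c * q x)%:E)%E.
Proof.
move=> t0 tt' c0; have t'0 := le_trans t0 tt'.
have li : L2 P (inc L x t t') by exact: (L2_inc HFilt HL HL2).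
have lr : L2 P (fun w => rho w * inc L x t t' w).
  by apply: L2_indic => //; exact: measurableC.
rewrite -EFin_Ex; last exact: L2_sqr.
rewrite lee_fin; apply: (@le_trans _ _ ((t' - t) * q x)).
  rewrite -(Ex_incM HFilt HL HL2 HQsa HQL x x t0 tt').
  apply: Ex_le; [exact: L2_sqr|exact: L2M|move=> w; rewrite -expr2 exprMn].
  rewrite ler_piMl ?sqr_ge0// /rho indicE.
  by case: (w \in _); rewrite ?expr1n ?expr0n.
by rewrite ler_wpM2r// cov_ge0.
Qed.

(** At each s the two processes are evaluated at times t, t' that lie within one mesh, respectively,
    to the left of s. Their difference is an increment over a time span of at most the sum of the
    meshes. *)
Lemma sqint_riemann_sum_diff x m m' :
  (sqint P (fun z => (riemann_sum_value x m' z - riemann_sum_value x m z)%R)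
    <= ((b - a) * ((mesh m + mesh m') * q x))%:E)%E.
Proof.
set c := (mesh m + mesh m') * q x.
rewrite sqintE2; last by apply: measurable_funB; exact: measurable_riemann_sum_value.
have mD : measurable (`]a, b]%classic : set R) by [].
have -> : (((b - a) * c)%:E = \int[leb]_s (c * \1_(`]a, b]) s)%:E)%E.
  under eq_integral do rewrite EFinM.
  rewrite integralZl//; last exact: integrable_indic_itv.
  rewrite integral_indic// setIT mulrC EFinM; congr (_ * _)%E.
  transitivity (leb (`]a, b]%classic : set R)) => //.
  by rewrite lebesgue_measure_itv/= lte_fin ab EFinB.
apply: ge0_le_integral => //.
- by move=> s _; apply: integral_ge0 => w _; rewrite lee_fin sqr_ge0.
- have mh : measurable_fun setT (fun z => ((riemann_sum_value x m' z - riemann_sum_value x m z) ^+ 2)%:E).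
    by apply: measurable_sqr; apply: measurable_funB; exact: measurable_riemann_sum_value.
  have p0 z : (0 <= ((riemann_sum_value x m' z - riemann_sum_value x m z) ^+ 2)%:E)%E.
    by rewrite lee_fin sqr_ge0.
  exact: (measurable_fun_fubini_tonelli_G (m1 := P) _ mh p0).
- by apply/measurable_EFinP; apply: measurable_funM => //; exact: measurable_indic.
move=> s _; rewrite indicE mem_setE; case: (boolP (s \in `]a, b])); last first.
  move=> sD; rewrite mulr0; under eq_integral do rewrite !riemann_sum_value_out// subr0 expr0n/=.
  by rewrite integral0.
rewrite in_itv/= => /andP[as_ sb]; rewrite mulr1.
have [t [at_ ts st tE]] := riemann_sum_value_in x m as_ sb.
have [t' [at' t's st' tE']] := riemann_sum_value_in x m' as_ sb.
have t0 := le_trans a0 at_; have t0' := le_trans a0 at'.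
have := mesh_gt0 m; have := mesh_gt0 m' => h1 h2.
case/orP: (le_total t t') => tt'.
  rewrite (eq_integral (fun w => ((rho w * inc L x t t' w) ^+ 2)%:E)).
    by apply: inc_sq_le => //; lra.
  by move=> w _; rewrite tE tE' (inc_split L x a t t'); congr EFin; ring.
rewrite (eq_integral (fun w => ((rho w * inc L x t' t w) ^+ 2)%:E)).
  by apply: inc_sq_le => //; lra.
by move=> w _; rewrite tE tE' (inc_split L x a t' t); congr EFin; ring.
Qed.

(** Both cut-offs are kept so that the Riemann processes converge to it at every point, not only
    almost everywhere. Joint measurability then follows from that of the approximations. *)
Definition left_limit_value x (z : Omega * R) : R :=
  rho z.1 * \1_(`]a, b]) z.2 *
  (lim (dot (L r z.1) x @[r --> z.2^'-]) - dot (L a z.1) x).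

Lemma cvg_mesh : mesh m @[m --> \oo] --> (0 : R).
Proof.
rewrite -(mulr0 (b - a)); apply: cvgM; first exact: cvg_cst.
exact: cvg_harmonic.
Qed.

Lemma cvg_riemann_sum_value x z : riemann_sum_value x m z @[m --> \oo] --> left_limit_value x z.
Proof.
case: z => w s; rewrite /left_limit_value/=.
have [sD|sD] := boolP (s \in `]a, b]); last first.
  rewrite indicE mem_setE (negbTE sD) mulr0 mul0r.
  under eq_fun do rewrite riemann_sum_value_out//; exact: cvg_cst.
move: sD; rewrite in_itv/= => /andP[as_ sb].
rewrite indicE mem_set/= ?in_itv/= ?as_ ?sb// mulr1.
have [wN|wN] := pselect (N w).
  have r0 : rho w = 0 by rewrite /rho indicE memNset//= => /(_ wN).
  rewrite r0 mul0r (_ : (fun m => _) = fun=> 0); first exact: cvg_cst.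
  apply/funext => m; have [t [_ _ _ ->]] := riemann_sum_value_in x m as_ sb.
  by rewrite r0 mul0r.
have r1 : rho w = 1 by rewrite /rho indicE mem_set.
have [_ /(_ s (le_lt_trans a0 as_)) cL] := cadN wN.
have cd : dot (L r w) x @[r --> s^'-] --> dot (lim (L r w @[r --> s^'-])) x.
  exact: (cvg_comp _ _ cL (@dot_continuousl _ _ x _)).
rewrite (cvg_lim _ cd)//; set l := dot (lim _) x in cd *.
rewrite r1 mul1r; apply/cvgrPdist_le => e e0.
move/cvgrPdist_le : cd => /(_ _ e0)[del /= del0 near_s].
have : \forall m \near \oo, mesh m < del.
  move/cvgrPdist_lt : cvg_mesh => /(_ _ del0); apply: filterS => m.
  by rewrite sub0r normrN gtr0_norm// mesh_gt0.
apply: filterS => m mdel.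
have [t [at_ ts st ->]] := riemann_sum_value_in x m as_ sb.
rewrite r1 mul1r (_ : _ - inc L x a t w = l - dot (L t w) x); last first.
  by rewrite /inc; ring.
have := near_s t; rewrite /= gtr0_norm ?subr_gt0//; apply=> //.
by apply: le_lt_trans mdel; rewrite lerBlDr addrC.
Qed.

Lemma measurable_left_limit_value x : measurable_fun setT (left_limit_value x).
Proof.
apply: (measurable_fun_cvg (h := riemann_sum_value x)) => [m|z _].
  exact: measurable_riemann_sum_value.
exact: cvg_riemann_sum_value.
Qed.

Lemma sqint_riemann_sum_value x m :
  (sqint P (fun z => (left_limit_value x z - riemann_sum_value x m z)%R)
    <= ((b - a) * (2 * mesh m * q x))%:E)%E.
Proof.
pose h m' z := ((riemann_sum_value x m' z - riemann_sum_value x m z) ^+ 2)%:E.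
have hE z : ((left_limit_value x z - riemann_sum_value x m z) ^+ 2)%:E = limn_einf (h ^~ z).
  rewrite limn_einf_lim; apply/esym/cvg_lim => //; apply: cvg_einfs.
  apply: cvg_EFin; first exact: nearW.
  have c1 : riemann_sum_value x m' z - riemann_sum_value x m z @[m' --> \oo] -->
      left_limit_value x z - riemann_sum_value x m z.
    by apply: cvgB; [exact: cvg_riemann_sum_value|exact: cvg_cst].
  by rewrite [X in _ --> X]expr2; apply: cvgM.
rewrite /sqint; under eq_integral do rewrite hE.
apply: (le_trans (fatou _ measurableT _ _)) => [m'|m' z _|].
- by apply: measurable_sqr; apply: measurable_funB; exact: measurable_riemann_sum_value.
- by rewrite lee_fin sqr_ge0.
(* Only the tail m' >= m matters for the lower limit; there the mesh of m' is at most that of m,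
   whence the factor 2. *)
apply: (@limn_einf_le _ _ _ m) => m' mm'; apply: (le_trans (sqint_riemann_sum_diff x m m')).
rewrite lee_fin ler_pM2l ?subr_gt0// ler_wpM2r ?cov_ge0// mulr2n mulrDl mul1r lerD2l.
by rewrite ler_pM2l ?subr_gt0// lef_pV2 ?posrE// ler_nat ltnS.
Qed.

End riemann_sums.

(** * Ito integrals as mean-square limits of Riemann sums *)

Section ito_riemann.
Context {R : realType} {d : measure_display} {Omega : measurableType d}.
Variable P : probability Omega R.
Variable Filt : R -> set (set Omega).
Hypothesis HFilt : is_usual_filtration P Filt.
Variable U : hilbertType R.
Variable L : R -> Omega -> U.
Hypothesis HL : is_levy_process P Filt L.
Hypothesis HL2 : square_integrable P L.
Hypothesis HLm : is_martingale P Filt L.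
Variable Q : U -> U.
Hypothesis HQsa : forall x y, dot (Q x) y = dot x (Q y) :> R.
Hypothesis HQL : is_covariance_operator P L Q.

Local Notation leb := (@lebesgue_measure R).

Variables (a b : R).
Hypothesis a0 : 0 <= a.
Hypothesis ab : a < b.
Variable N : set Omega.
Hypothesis mN : measurable N.
Hypothesis PN : P N = 0%E.
Hypothesis cadN : forall w, ~ N w -> is_cadlag (fun t => L t w).

Lemma ae_setC (A : set Omega) : ~` N `<=` A -> {ae P, forall w, A w}.
Proof.
move=> NA; exists N; split => // w /= wA; apply: contrapT => wN; apply: wA.
exact: NA.
Qed.

Section simple_process.
Variable phi : simple_process R Omega.
Hypothesis sphi : simple_predictable Filt a b phi.

Lemma sp_time_ge i : (i <= sp_size phi)%N -> a <= sp_time phi i.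
Proof.
case: sphi => h0 _ hmon _ _; elim: i => [|i IH] ilt; first by rewrite h0.
by apply: le_trans (hmon _ ilt); apply: IH; exact: ltnW.
Qed.

Lemma sp_time_le i : (i <= sp_size phi)%N -> sp_time phi i <= b.
Proof.
case: sphi => _ hb hmon _ _ ile.
have aux k : (k <= sp_size phi)%N -> sp_time phi (sp_size phi - k)%N <= b.
  elim: k => [|k IH] kle; first by rewrite subn0 hb.
  apply: le_trans (IH (ltnW kle)).
  have := hmon (sp_size phi - k.+1)%N; rewrite subnSK//; apply.
  exact: leq_subr.
by have := aux (sp_size phi - i)%N (leq_subr _ _); rewrite subKn.
Qed.

Lemma fmeas_sp_val (i : 'I_(sp_size phi)) : fmeas (Filt (sp_time phi i)) (sp_val phi i).
Proof.
case: sphi => _ _ _ hm _ B mB; apply: (hm i (ltn_ord i) B).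
exact/borel_realE.
Qed.

Lemma L2_sp_val (i : 'I_(sp_size phi)) : L2 P (sp_val phi i).
Proof.
have t0 : 0 <= sp_time phi i.
  by apply: (le_trans a0); apply: sp_time_ge; exact: ltnW.
have mv : measurable_fun setT (sp_val phi i).
  exact: fmeas_measurable (filt_measurable HFilt t0) (fmeas_sp_val i).
have [_ _ _ _ [M hM]] := sphi.
split=> //; apply: (L1_le _ (L1_cst P (M ^+ 2))); first exact: measurable_funX.
move=> w; rewrite ger0_norm ?sqr_ge0// -(real_normK (num_real _)).
by rewrite lerXn2r ?nnegrE//; [exact: le_trans (hM i w (ltn_ord i))|exact: hM].
Qed.

Definition sp_step : Omega * R -> R :=
  step_value (fun i : 'I_(sp_size phi) => sp_time phi i)
    (fun i => sp_time phi i.+1) (fun i => sp_val phi i).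

Definition sp_int y : Omega -> R :=
  step_integral L (fun i : 'I_(sp_size phi) => sp_time phi i)
    (fun i => sp_time phi i.+1) (fun i => sp_val phi i) y.

Lemma sp_time0 (i : 'I_(sp_size phi)) : 0 <= sp_time phi i.
Proof. by apply: (le_trans a0); apply: sp_time_ge; exact: ltnW. Qed.

Lemma sp_timeS (i : 'I_(sp_size phi)) : sp_time phi i <= sp_time phi i.+1.
Proof. by case: sphi => _ _ + _ _; apply. Qed.

Lemma L2_sp_int y : L2 P (sp_int y).
Proof.
apply: (L2_step_integral HFilt HL HL2 HQsa HQL) => i.
- exact: sp_time0.
- exact: sp_timeS.
- exact: L2_sp_val.
- exact: fmeas_sp_val.
Qed.

Lemma measurable_sp_step : measurable_fun setT sp_step.
Proof. by apply: (@measurable_step_value _ _ _ P) => i; exact: L2_sp_val. Qed.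

Lemma sp_step_out w s : s \notin `]a, b] -> sp_step (w, s) = 0.
Proof.
move=> sD; rewrite /sp_step /step_value big1// => i _ /=.
rewrite indicE memNset ?mulr0//= in_itv/= => /andP[gi si]; move/negP: sD; apply.
rewrite in_itv/= (le_lt_trans _ gi) ?sp_time_ge ?(le_trans si) ?sp_time_le//.
exact: ltnW.
Qed.

(* Both integrals are step integrals over the disjoint union of the two families. *)
Lemma Ex_sp_int_riemann_sum x y m :
  (Ex P (fun w => (sp_int y w - riemann_sum L a b N x y m w) ^+ 2))%:E =
  ((dot (Q y) y)%:E * sqint P (fun z => (sp_step z - riemann_sum_value L a b N x m z)%R))%E.
Proof.
pose I := ('I_(sp_size phi) + 'I_m.+1)%type.
pose ta (i : I) := match i with inl i => sp_time phi i | inr i => grid a b m i end.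
pose tb (i : I) := match i with inl i => sp_time phi i.+1 | inr i => grid a b m i.+1 end.
pose xi (i : I) w := match i with
  inl i => sp_val phi i w | inr i => - riemann_coef L a b N x m i w end.
have h1 i : 0 <= ta i.
  by case: i => i /=; [exact: sp_time0|exact: le_trans a0 (grid_ge ab m i)].
have h2 i : ta i <= tb i by case: i => i /=; [exact: sp_timeS|exact: grid_le].
have h3 i : L2 P (xi i).
  case: i => i /=; first exact: L2_sp_val.
  by apply: L2N; exact: (L2_riemann_coef HFilt HL HL2).
have h4 i : fmeas (Filt (ta i)) (xi i).
  case: i => i /=; first exact: fmeas_sp_val.
  have fr := fmeas_riemann_coef HFilt HL a0 ab mN PN x m i.
  have g0 : 0 <= grid a b m i by exact: le_trans a0 (grid_ge ab m i).
  have := fmeasZ (filt_sigma_algebra HFilt g0) (-1) fr.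
  by congr fmeas; apply/funext => w; rewrite mulN1r.
have eI w : step_integral L ta tb xi y w = sp_int y w - riemann_sum L a b N x y m w.
  rewrite /step_integral big_sumType/= /sp_int /riemann_sum /step_integral -sumrN.
  by congr (_ + _); apply: eq_bigr => i _; rewrite mulNr.
have eV z : step_value ta tb xi z = sp_step z - riemann_sum_value L a b N x m z.
  rewrite /step_value big_sumType/= /sp_step /riemann_sum_value /step_value -sumrN.
  by congr (_ + _); apply: eq_bigr => i _; rewrite mulNr.
have := ito_isometry HFilt HL HL2 HLm HQsa HQL h1 h2 h3 h4 y.
rewrite -sqintE; last exact: (@measurable_step_value _ _ _ P).
rewrite (_ : step_value ta tb xi = fun z => sp_step z - riemann_sum_value L a b N x m z);
  last exact/funext.
by move=> <-; congr ((Ex P _)%:E); apply/funext => w; rewrite eI.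
Qed.

(** The left side is the distance in the definition of the Ito integral, whose integrand carries no
    cut-off at N. Both inner integrals agree off N, and completeness of P transfers measurability in
    w. *)
Lemma sp_step_left_limit x :
  (\int[P]_w \int[leb]_(s in `]a, b])
     ((simple_value phi s w -
       (lim (dot (L r w) x @[r --> s^'-]) - dot (L a w) x)) ^+ 2)%:E)%E =
  sqint P (fun z => sp_step z - left_limit_value L a b N x z).
Proof.
have mll := measurable_left_limit_value HFilt HL HL2 a0 ab mN cadN x.
have mh : measurable_fun setT (fun z => sp_step z - left_limit_value L a b N x z).
  by apply: measurable_funB => //; exact: measurable_sp_step.
rewrite sqintE//.
have p0 z : (0 <= ((sp_step z - left_limit_value L a b N x z) ^+ 2)%:E)%E.
  by rewrite lee_fin sqr_ge0.
have mi := measurable_fun_fubini_tonelli_F (m2 := leb) _ (measurable_sqr mh) p0.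
have ae : ae_eq P setT (fun w => \int[leb]_s
    ((sp_step (w, s) - left_limit_value L a b N x (w, s)) ^+ 2)%:E)%E
  (fun w => \int[leb]_(s in `]a, b]) ((simple_value phi s w -
       (lim (dot (L r w) x @[r --> s^'-]) - dot (L a w) x)) ^+ 2)%:E)%E.
  apply: ae_setC => w wN _; rewrite [RHS]integral_mkcond.
  apply: eq_integral => s _; rewrite patchE.
  case: ifPn; rewrite mem_setE => sD.
    by rewrite /left_limit_value/= !indicE mem_set// mem_setE sD !mul1r.
  rewrite sp_step_out// /left_limit_value/= [X in _ * X * _]indicE mem_setE.
  by rewrite (negbTE sD) mulr0 mul0r subr0 expr0n.
apply/esym/ge0_ae_eq_integral => //.
- exact: (ae_measurable_fun (filt_complete_space HFilt) ae).
- by move=> w _; apply: integral_ge0.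
- by move=> w _; apply: integral_ge0 => s _; rewrite lee_fin sqr_ge0.
Qed.

End simple_process.

(** With J_n the integrals of the given simple processes, I - R_m = (I - J_n) + (J_n - R_m). The
    isometry turns the last term into a distance of integrands, measured through [left_limit_value].
    As n grows, only the bound [B m] survives. *)
Lemma ito_L2cvg x y (I : Omega -> R) :
  is_ito_integral P Filt (fun t w => dot (L t w) y) a b
    (fun s w => lim (dot (L r w) x @[r --> s^'-]) - dot (L a w) x) I ->
  L2cvg P (riemann_sum L a b N x y) I.
Proof.
move=> [mI [phi [sphi cphi cI]]].
have lr m : L2 P (riemann_sum L a b N x y m) by exact: (L2_riemann_sum HFilt HL HL2 HQsa HQL).
have cI' : (\int[P]_w ((I w - sp_int (phi n) y w) ^+ 2)%:E)%E @[n --> \oo] --> 0%E.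
  by move: cI; rewrite unlock.
have ls n : L2 P (sp_int (phi n) y) by exact: L2_sp_int.
have lD n (e : R) : (\int[P]_w ((I w - sp_int (phi n) y w) ^+ 2)%:E <= e%:E)%E ->
    L2 P (fun w => I w - sp_int (phi n) y w) /\
    Ex P (fun w => (I w - sp_int (phi n) y w) ^+ 2) <= e.
  move=> h; have mD : measurable_fun setT (fun w => I w - sp_int (phi n) y w).
    by apply: measurable_funB => //; exact: L2_meas (ls n).
  have lD : L2 P (fun w => I w - sp_int (phi n) y w).
    split=> //; apply: ge0_L1 => [|w|]; [exact: measurable_funX|exact: sqr_ge0|].
    by apply: (le_lt_trans h); exact: ltry.
  by split=> //; rewrite -lee_fin EFin_Ex//; exact: L2_sqr.
(* I is only assumed measurable; it lies at finite mean-square distance from a square-integrable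
   [sp_int]. *)
have lI : L2 P I.
  have [n _ /(_ n (leqnn n)) /= h] := cvge0_small cI' ltr01.
  have [l _] := lD n _ h; have := L2D l (ls n).
  by congr L2; apply/funext => w; rewrite subrK.
split=> //.
pose qy := dot (Q y) y : R; pose qx := dot (Q x) x : R.
have qy0 : 0 <= qy by exact: (cov_ge0 HFilt HL HL2 HQsa HQL a0 ab).
(* The 4 comes from using (u + v)^2 <= 2 u^2 + 2 v^2 twice, once for integrals and once for
   integrands. *)
pose B m := 4 * qy * ((b - a) * (2 * mesh a b m * qx)).
have bound m : Ex P (fun w => (I w - riemann_sum L a b N x y m w) ^+ 2) <= B m.
  apply/ler_addgt0Pr => e e0.
  have k0 : 0 < 2 + 4 * qy by rewrite ltr_wpDr ?mulr_ge0.
  (* The total error is 2 del + 2 qy (2 del + 2 c) = (2 + 4 qy) del + 4 qy c, and its first part is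
     to equal e. *)
  pose del := e / (2 + 4 * qy); have del0 : 0 < del by rewrite divr_gt0.
  have [n h1 h2] : exists2 n,
      (\int[P]_w ((I w - sp_int (phi n) y w) ^+ 2)%:E <= del%:E)%E &
      (sqint P (fun z => (sp_step (phi n) z - left_limit_value L a b N x z)%R)
         <= del%:E)%E.
    have A1 := cvge0_small cI' del0; have A2 := cvge0_small cphi del0.
    have [n _ /(_ n (leqnn n)) [h1 h2]] := filterI A1 A2; exists n => //.
    by move: h2; rewrite /= (sp_step_left_limit (sphi n)).
  have [l1 e1] := lD n _ h1.
  have l2 : L2 P (fun w => sp_int (phi n) y w - riemann_sum L a b N x y m w) by exact: L2B.
  apply: (@le_trans _ _ (2 * del + 2 * (qy * (2 * del + 2 * ((b - a) * (2 * mesh a b m * qx)))))); last first.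
    rewrite /B -[e](@divfK _ (2 + 4 * qy)) ?gt_eqF// -/del.
    by rewrite le_eqVlt; apply/orP; left; apply/eqP; ring.
  have := Ex_sqD l1 l2.
  rewrite (_ : (fun w => (_ + _) ^+ 2) = fun w => (I w - riemann_sum L a b N x y m w) ^+ 2);
    last by apply/funext => w; congr (_ ^+ 2); ring.
  move=> /le_trans; apply; apply: lerD; first by rewrite ler_pM2l.
  rewrite ler_pM2l// -lee_fin (Ex_sp_int_riemann_sum (sphi n) x) EFinM.
  have q0E : (0 <= qy%:E)%E by rewrite lee_fin.
  apply: lee_wpmul2l => //.
  have ms := measurable_sp_step (sphi n).
  have ml := measurable_left_limit_value HFilt HL HL2 a0 ab mN cadN x.
  have mr := measurable_riemann_sum_value HFilt HL HL2 a0 ab mN x m.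
  apply: (le_trans (sqintD P ms ml mr)).
  pose c := (b - a) * (2 * mesh a b m * qx).
  apply: (@le_trans _ _ (2%:E * del%:E + 2%:E * c%:E)%E); last first.
    by rewrite -!EFinM -EFinD.
  apply: leeD; apply: lee_wpmul2l => //.
  exact: (sqint_riemann_sum_value HFilt HL HL2 HQsa HQL a0 ab mN cadN x m).
apply: (@squeeze_cvgr _ _ _ _ (fun=> 0) B).
- by near=> m; rewrite Ex_sq_ge0/=.
- exact: cvg_cst.
- rewrite /B -[X in _ --> X](_ : 4 * qy * ((b - a) * (2 * 0 * qx)) = 0); last first.
    by rewrite mulr0 mul0r !mulr0.
  apply: cvgM; first exact: cvg_cst.
  apply: cvgM; first exact: cvg_cst.
  apply: cvgM; last exact: cvg_cst.
  by apply: cvgM; [exact: cvg_cst|exact: cvg_mesh].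
Unshelve. all: by end_near. Qed.

End ito_riemann.

(** * Conditional moments of iterated integrals *)

Section iterated_integral_moments.
Context {R : realType} {d : measure_display} {Omega : measurableType d}.
Variable P : probability Omega R.
Variable Filt : R -> set (set Omega).
Hypothesis HFilt : is_usual_filtration P Filt.
Variable U : hilbertType R.
Variable L : R -> Omega -> U.
Hypothesis HL : is_levy_process P Filt L.
Hypothesis HL2 : square_integrable P L.
Hypothesis HLm : is_martingale P Filt L.
Variable Q : U -> U.
Hypothesis HQsa : forall x y, dot (Q x) y = dot x (Q y) :> R.
Hypothesis HQL : is_covariance_operator P L Q.

Variables (a b : R).
Hypothesis a0 : 0 <= a.
Hypothesis ab : a < b.
Variable N : set Omega.
Hypothesis mN : measurable N.
Hypothesis PN : P N = 0%E.
Hypothesis cadN : forall w, ~ N w -> is_cadlag (fun t => L t w).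

Local Notation rsm := (riemann_sum L a b N).
Local Notation rcf := (riemann_coef L a b N).
Local Notation F := (Filt a).
Let sF t : 0 <= t -> sigma_algebra setT (Filt t).
Proof. exact: filt_sigma_algebra HFilt t. Qed.
Let Fm t : 0 <= t -> Filt t `<=` measurable.
Proof. exact: filt_measurable HFilt t. Qed.

Let g0 m i : 0 <= grid a b m i.
Proof. exact: le_trans a0 (grid_ge ab m i). Qed.

Lemma overlap_grid m i j :
  overlap (grid a b m i) (grid a b m i.+1) (grid a b m j) (grid a b m j.+1) =
  if i == j then mesh a b m else 0.
Proof.
rewrite /overlap; have d0 := mesh_gt0 ab m.
case: eqVneq => [->|ij].
  by rewrite minxx maxxx gridS addrAC subrr add0r max_r// ltW.
rewrite max_l// subr_le0; have /orP[h|h] : (i < j)%N || (j < i)%N by rewrite -neq_ltn.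
  by rewrite ge_min !le_max (grid_le ab m h) !orbT.
by rewrite ge_min !le_max (grid_le ab m h) !orbT.
Qed.

Lemma Ex_null_compl X : L1 P X -> Ex P (fun w => \1_(~` N) w * X w) = Ex P X.
Proof.
move=> iX; have iNX := L1_indic (measurableC mN) iX.
apply: EFin_inj; rewrite !EFin_Ex//; apply: ae_eq_integral => //.
- exact/measurable_EFinP/(L1_meas iNX).
- exact/measurable_EFinP/(L1_meas iX).
by apply: (ae_setC mN PN) => w wN _ /=; rewrite indicE mem_set// mul1r.
Qed.

Lemma Ex_riemann_coef_pair x x' m i A : F A ->
  Ex P (fun w => (\1_A w * rcf x m i w) * rcf x' m i w) =
  dot (Q x) x' * (grid a b m i - a) * Ex P (\1_A).
Proof.
move=> FA; have mA : measurable A by exact: Fm FA.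
have iA : L1 P (\1_A) by exact: (L1_set _ (Fm a0) FA).
have fA : fmeas F (\1_A : Omega -> R) by apply: fmeas_indic => //; exact: sF.
rewrite -(Ex_null_compl iA).
have iX : L1 P (fun w => \1_(~` N) w * \1_A w).
  exact: L1_indic (measurableC mN) iA.
have fX : fmeas F (fun w => \1_(~` N) w * \1_A w : R).
  apply: fmeasM => //; first exact: sF.
  by apply: fmeas_indic; [exact: sF|exact: (null_compl_filt HFilt mN PN)].
have [_ E] := Ex_indep_incM HFilt HL HL2 HQsa HQL x x' a0 (grid_ge ab m i) iX fX.
transitivity (Ex P (fun w => \1_(~` N) w * \1_A w *
    (inc L x a (grid a b m i) w * inc L x' a (grid a b m i) w))).
  congr Ex; apply/funext => w; rewrite /riemann_coef !indicE.
  by case: (w \in ~` N); rewrite /=; ring.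
by rewrite E; ring.
Qed.

Lemma Ex_riemann_coef x m i A : F A -> Ex P (fun w => \1_A w * rcf x m i w) = 0.
Proof.
move=> FA; have mA : measurable A by exact: Fm FA.
have iX : L1 P (fun w => \1_(~` N) w * \1_A w).
  exact: L1_indic (measurableC mN) (L1_set _ (Fm a0) FA).
have fX : fmeas F (fun w => \1_(~` N) w * \1_A w : R).
  apply: fmeasM; first exact: sF.
    by apply: fmeas_indic; [exact: sF|exact: (null_compl_filt HFilt mN PN)].
  by apply: fmeas_indic => //; exact: sF.
have [_ E] := Ex_indep_inc HFilt HL HL2 HLm x a0 (grid_ge ab m i) iX fX.
rewrite -E; congr Ex; apply/funext => w; rewrite /riemann_coef; ring.
Qed.

Lemma L2_set_riemann_coef x m i A : F A -> L2 P (fun w => \1_A w * rcf x m i w).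
Proof. by move=> FA; apply: L2_indic; [exact: Fm FA|exact: (L2_riemann_coef HFilt HL HL2)]. Qed.

Lemma fmeas_set_riemann_coef x m i A : F A ->
  fmeas (Filt (grid a b m i)) (fun w => \1_A w * rcf x m i w).
Proof.
move=> FA; apply: fmeasM; first exact: sF.
  apply: (fmeas_filt HFilt a0 (grid_ge ab m i)).
  by apply: fmeas_indic => //; exact: sF.
exact: (fmeas_riemann_coef HFilt HL a0 ab mN PN).
Qed.

(** Distinct cells do not overlap. Cell i contributes (grid i - a) mesh = i mesh^2, and the sum over
    i <= m is m (m+1)/2 mesh^2 = (b - a)^2/2 m/(m+1). *)
Lemma cond_mean_riemann_sum_pair x y x' y' m :
  cond_mean P F (fun w => rsm x y m w * rsm x' y' m w)
    (dot (Q x) x' * dot (Q y) y' * ((b - a) ^+ 2 / 2 * (1 - harmonic m))).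
Proof.
have l2 := fun x y => L2_riemann_sum HFilt HL HL2 HQsa HQL a0 ab mN PN x y m.
split=> [|A FA]; first exact: L2M.
(* The test event A belongs to the past of a, so its indicator can be absorbed into the coefficient
   of one of the two sums. *)
pose X i w := (\1_A w * rcf x m i w) * inc L y (grid a b m i) (grid a b m i.+1) w.
pose X' i w := rcf x' m i w * inc L y' (grid a b m i) (grid a b m i.+1) w.
have lX i : L2 P (X i).
  apply: (L2_mul_inc HFilt HL HL2 HQsa HQL) => //.
  - exact: grid_le.
  - exact: L2_set_riemann_coef.
  - exact: fmeas_set_riemann_coef.
have lX' i : L2 P (X' i).
  apply: (L2_mul_inc HFilt HL HL2 HQsa HQL) => //.
  - exact: grid_le.
  - exact: (L2_riemann_coef HFilt HL HL2).
  - exact: (fmeas_riemann_coef HFilt HL a0 ab mN PN).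
have -> : (fun w => \1_A w * (rsm x y m w * rsm x' y' m w)) =
    fun w => \sum_(i < m.+1) \sum_(j < m.+1) X i w * X' j w.
  apply/funext => w; rewrite /riemann_sum /step_integral mulr_suml mulr_sumr.
  apply: eq_bigr => i _; rewrite !mulr_sumr.
  by apply: eq_bigr => j _; rewrite /X /X'; ring.
rewrite Ex_sum; last by move=> i; apply: L1_sum => j; exact: L2M.
have Eij (i j : 'I_m.+1) : Ex P (fun w => X i w * X' j w) =
    if i == j then dot (Q x) x' * dot (Q y) y' * mesh a b m ^+ 2 * i%:R * Ex P (\1_A) else 0.
  rewrite (Ex_inc_pair HFilt HL HL2 HLm HQsa HQL)//; first last.
  - exact: (fmeas_riemann_coef HFilt HL a0 ab mN PN).
  - exact: (L2_riemann_coef HFilt HL HL2).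
  - exact: fmeas_set_riemann_coef.
  - exact: L2_set_riemann_coef.
  - exact: grid_le.
  - exact: grid_le.
  rewrite overlap_grid val_eqE; case: eqVneq => [->|_]; last by rewrite mulr0.
  by rewrite Ex_riemann_coef_pair// /grid; ring.
transitivity (\sum_(i < m.+1) dot (Q x) x' * dot (Q y) y' * mesh a b m ^+ 2 * i%:R * Ex P (\1_A)).
  apply: eq_bigr => i _; rewrite Ex_sum; last by move=> j; exact: L2M.
  rewrite (bigD1 i)//= Eij eqxx big1 ?addr0// => j ji.
  by rewrite Eij eq_sym (negbTE ji).
rewrite -mulr_suml -mulr_sumr; congr (_ * _); rewrite -[LHS]mulrA -[RHS]mulrA.
rewrite -!mulrA; congr (_ * (_ * _)).
have -> : \sum_(i < m.+1) (i%:R : R) = m%:R * m.+1%:R / 2.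
  elim: m {X X' lX lX' Eij l2} => [|k IH]; first by rewrite big_ord1 mul0r mul0r.
  by rewrite big_ord_recr/= IH -(natr1 k.+1) -(natr1 k); field.
rewrite /mesh /harmonic/= -(natr1 m); field.
by rewrite natr1 pnatr_eq0.
Qed.

Lemma cond_mean_riemann_sum x y m : cond_mean P F (rsm x y m) 0.
Proof.
have l2 := L2_riemann_sum HFilt HL HL2 HQsa HQL a0 ab mN PN x y m.
split=> [|A FA]; first exact: L2_L1.
have h (i : 'I_m.+1) := Ex_indep_inc HFilt HL HL2 HLm y (g0 m i) (grid_le ab m (leqnSn i))
    (L2_L1 (L2_set_riemann_coef x m i FA)) (fmeas_set_riemann_coef x m i FA).
rewrite mul0r (_ : (fun w => \1_A w * rsm x y m w) =
  fun w => \sum_(i < m.+1) (\1_A w * rcf x m i w) * inc L y (grid a b m i) (grid a b m i.+1) w).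
  rewrite Ex_sum; last by move=> i; have [] := h i.
  by rewrite big1// => i _; have [] := h i.
apply/funext => w; rewrite /riemann_sum /step_integral mulr_sumr.
by apply: eq_bigr => i _; rewrite mulrA.
Qed.

(** The increment over ]a, b] is a step integral with coefficient 1. Each cell then leaves the mean
    of its coefficient on A, which is zero because the coefficient is an increment starting at a. *)
Lemma cond_mean_riemann_sum_inc x y z m : cond_mean P F (fun w => rsm x y m w * inc L z a b w) 0.
Proof.
have b0 : 0 <= b by exact: le_trans a0 (ltW ab).
have l2 := L2_riemann_sum HFilt HL HL2 HQsa HQL a0 ab mN PN x y m.
have lz : L2 P (inc L z a b) by exact: (L2_inc HFilt HL HL2).
split=> [|A FA]; first exact: L2M.
have lX (i : 'I_m.+1) : L2 P (fun w => (\1_A w * rcf x m i w) *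
    inc L y (grid a b m i) (grid a b m i.+1) w).
  apply: (L2_mul_inc HFilt HL HL2 HQsa HQL) => //.
  - exact: grid_le.
  - exact: L2_set_riemann_coef.
  - exact: fmeas_set_riemann_coef.
have lz1 : L2 P (fun w => 1 * inc L z a b w) by exact: L2Z.
rewrite mul0r (_ : (fun w => \1_A w * (rsm x y m w * inc L z a b w)) =
  fun w => \sum_(i < m.+1) ((\1_A w * rcf x m i w) *
    inc L y (grid a b m i) (grid a b m i.+1) w) * (1 * inc L z a b w)).
  rewrite Ex_sum; last by move=> i; exact: L2M.
  rewrite big1// => i _; rewrite (Ex_inc_pair HFilt HL HL2 HLm HQsa HQL)//; first last.
  - by apply: fmeas_cst; exact: sF.
  - exact: L2_cst.
  - exact: fmeas_set_riemann_coef.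
  - exact: L2_set_riemann_coef.
  - exact: ltW.
  - exact: grid_le.
  under [X in Ex _ X]funext do rewrite mulr1.
  by rewrite Ex_riemann_coef// mulr0 mul0r.
apply/funext => w; rewrite /riemann_sum /step_integral mulrA mulr_sumr mulr_suml.
by apply: eq_bigr => i _; rewrite mul1r mulrA.
Qed.

Lemma cond_mean_inc_pair x y : cond_mean P F (fun w => inc L x a b w * inc L y a b w)
  ((b - a) * dot (Q x) y).
Proof.
have b0 : 0 <= b by exact: le_trans a0 (ltW ab).
split=> [|A FA]; first by apply: L2M; exact: (L2_inc HFilt HL HL2).
have iA : L1 P (\1_A) by exact: (L1_set _ (Fm a0) FA).
have fA : fmeas F (\1_A : Omega -> R) by apply: fmeas_indic => //; exact: sF.
have [_ ->] := Ex_indep_incM HFilt HL HL2 HQsa HQL x y a0 (ltW ab) iA fA.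
by rewrite mulrC.
Qed.

Lemma cond_mean_inc x : cond_mean P F (inc L x a b) 0.
Proof.
have b0 : 0 <= b by exact: le_trans a0 (ltW ab).
split=> [|A FA]; first exact: (L2_L1 (L2_inc HFilt HL HL2 _ _ _)).
have iA : L1 P (\1_A) by exact: (L1_set _ (Fm a0) FA).
have fA : fmeas F (\1_A : Omega -> R) by apply: fmeas_indic => //; exact: sF.
have [_ ->] := Ex_indep_inc HFilt HL HL2 HLm x a0 (ltW ab) iA fA.
by rewrite mul0r.
Qed.

Definition iterated (x y : U) (I : Omega -> R) :=
  is_ito_integral P Filt (fun t w => dot (L t w) y) a b
    (fun s w => lim (dot (L r w) x @[r --> s^'-]) - dot (L a w) x) I.

Section limits.
Variables (x y : U) (I : Omega -> R).
Hypothesis HI : iterated x y I.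

Let cI : L2cvg P (rsm x y) I.
Proof. exact: (ito_L2cvg HFilt HL HL2 HLm HQsa HQL a0 ab mN PN cadN). Qed.

Lemma L2_iterated : L2 P I. Proof. by case: cI. Qed.

Lemma fmeas_iterated : fmeas (Filt b) I.
Proof.
have b0 : 0 <= b by exact: le_trans a0 (ltW ab).
apply: (fmeas_L2cvg _ _ _ cI); first exact: sF.
  apply: (subset_trans (filt_null HFilt)).
  exact: (filt_increasing HFilt (lexx 0) b0).
move=> m; apply: fmeas_sum => [|i]; first exact: sF.
have gb : grid a b m i.+1 <= b.
  by rewrite -[X in _ <= X](grid_last a b m); exact: grid_le.
have gi : grid a b m i <= grid a b m i.+1 by exact: grid_le.
apply: fmeasM; first exact: sF.
  apply: (fmeas_filt HFilt (g0 m i) (le_trans gi gb)).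
  exact: (fmeas_riemann_coef HFilt HL a0 ab mN PN).
exact: (fmeas_filt HFilt (g0 m i.+1) gb (fmeas_inc HFilt HL y (g0 m i) gi)).
Qed.

Lemma cond_mean_iterated : cond_mean P F I 0.
Proof.
(* A first moment is treated as the product with the constant variable 1. *)
have := cond_mean_mul_cvg (Fm a0) cI (L2cvg_cst (L2_cst P 1)) (c_ := fun=> 0) (c := 0).
rewrite (_ : (fun w => I w * 1) = I); last by apply/funext => w; rewrite mulr1.
apply; last exact: cvg_cst.
move=> m; have := cond_mean_riemann_sum x y m.
by congr cond_mean; apply/funext => w; rewrite mulr1.
Qed.

Lemma cond_mean_iterated_inc z : cond_mean P F (fun w => I w * inc L z a b w) 0.
Proof.
have b0 : 0 <= b by exact: le_trans a0 (ltW ab).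
have lz : L2 P (inc L z a b) by exact: (L2_inc HFilt HL HL2).
apply: (cond_mean_mul_cvg (Fm a0) cI (L2cvg_cst lz) (c_ := fun=> 0)); last exact: cvg_cst.
by move=> m; exact: cond_mean_riemann_sum_inc.
Qed.

End limits.

Lemma cond_mean_iterated_pair x y x' y' I I' : iterated x y I -> iterated x' y' I' ->
  cond_mean P F (fun w => I w * I' w) (dot (Q x) x' * dot (Q y) y' * ((b - a) ^+ 2 / 2)).
Proof.
move=> HI HI'.
have cI := ito_L2cvg HFilt HL HL2 HLm HQsa HQL a0 ab mN PN cadN HI.
have cI' := ito_L2cvg HFilt HL HL2 HLm HQsa HQL a0 ab mN PN cadN HI'.
apply: (cond_mean_mul_cvg (Fm a0) cI cI' (cond_mean_riemann_sum_pair x y x' y')).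
rewrite -[X in _ --> X](_ : dot (Q x) x' * dot (Q y) y' * ((b - a) ^+ 2 / 2 * (1 - 0)) = _);
  last by rewrite subr0 mulr1.
apply: cvgM; first exact: cvg_cst.
apply: cvgM; first exact: cvg_cst.
by apply: cvgB; [exact: cvg_cst|exact: cvg_harmonic].
Qed.

End iterated_integral_moments.

(** * Powers of matrices and the spectral radius *)

Lemma cvg_sumr (R : realType) (K : normedModType R) (I : Type) (s : seq I)
    (f : I -> nat -> K) (l : I -> K) : (forall i, f i n @[n --> \oo] --> l i) ->
  \sum_(i <- s) f i n @[n --> \oo] --> \sum_(i <- s) l i.
Proof.
move=> fl; elim: s => [|i s IH].
  by under eq_fun do rewrite big_nil; rewrite big_nil; exact: cvg_cst.
by under eq_fun do rewrite big_cons; rewrite big_cons; exact: cvgD.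
Qed.

Section spectral_power.
Context {R : realType}.
Local Notation C := (R[i]).
Local Notation normc := (@Normc.normc R).

Lemma normcD_le (x y : C) : normc (x + y) <= normc x + normc y.
Proof. exact: le_normcD. Qed.

Lemma normcM_eq (x y : C) : normc (x * y) = normc x * normc y.
Proof. exact: Normc.normcM. Qed.

Lemma normc_ge0 (x : C) : 0 <= normc x.
Proof. by case: x => a b; exact: sqrtr_ge0. Qed.

Lemma normc_real (x : R) : normc (real_complex R x) = `|x|.
Proof. by rewrite /Normc.normc/= expr0n addr0 sqrtr_sqr. Qed.

Lemma normcX (x : C) n : normc (x ^+ n) = normc x ^+ n.
Proof.
by elim: n => [|n IH]; rewrite ?Normc.normc1// !exprS normcM_eq IH.
Qed.

Lemma normc_sum (I : Type) (s : seq I) (F : I -> C) :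
  normc (\sum_(i <- s) F i) <= \sum_(i <- s) normc (F i).
Proof.
elim: s => [|i s IH]; first by rewrite !big_nil Normc.normc0.
by rewrite !big_cons (le_trans (normcD_le _ _))// lerD2l.
Qed.

Definition vnorm n (u : 'rV[C]_n) : R := \sum_i normc (u 0 i).

Lemma vnorm_ge0 n (u : 'rV[C]_n) : 0 <= vnorm u.
Proof. by apply: sumr_ge0 => i _; exact: normc_ge0. Qed.

Lemma vnormD n (u v : 'rV[C]_n) : vnorm (u + v) <= vnorm u + vnorm v.
Proof.
rewrite /vnorm -big_split/=; apply: ler_sum => i _; rewrite mxE.
exact: normcD_le.
Qed.

Lemma vnormZ n a (u : 'rV[C]_n) : vnorm (a *: u) = normc a * vnorm u.
Proof.
by rewrite /vnorm mulr_sumr; apply: eq_bigr => i _; rewrite mxE normcM_eq.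
Qed.

Lemma vnorm_coord n (u : 'rV[C]_n) i : normc (u 0 i) <= vnorm u.
Proof.
rewrite /vnorm (bigD1 i)//= lerDl; apply: sumr_ge0 => j _; exact: normc_ge0.
Qed.

(** Once b is below (e/2)(1 - r), the map x -> r x + (e/2)(1 - r) dominates the recursion. Its fixed
    point is e/2, so a_{J+n} <= r^n a_J + e/2. *)
Lemma contraction_cvg (a b : nat -> R) (r : R) : 0 <= r -> r < 1 ->
  (forall j, 0 <= a j) -> (forall j, a j.+1 <= r * a j + b j) ->
  b j @[j --> \oo] --> (0 : R) -> a j @[j --> \oo] --> (0 : R).
Proof.
move=> r0 r1 a0 ab cb; apply/cvgrPdist_le => e e0.
have r1' : 0 < 1 - r by rewrite subr_gt0.
have d0 : 0 < e / 2 * (1 - r) by rewrite mulr_gt0// divr_gt0.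
move/cvgrPdist_le : cb => /(_ _ d0)[J _ hJ].
have step n : a (J + n)%N <= r ^+ n * a J + e / 2.
  elim: n => [|n IH]; first by rewrite addn0 expr0 mul1r lerDl divr_ge0// ltW.
  rewrite addnS; apply: (le_trans (ab _)).
  have bn : b (J + n)%N <= e / 2 * (1 - r).
    have := hJ (J + n)%N (leq_addr _ _); rewrite /= sub0r normrN.
    exact/le_trans/ler_norm.
  apply: (@le_trans _ _ (r * (r ^+ n * a J + e / 2) + e / 2 * (1 - r))).
    by apply: lerD => //; exact: ler_wpM2l.
  by rewrite exprS; lra.
have cr : r ^+ n * a J @[n --> \oo] --> (0 : R).
  rewrite -(mul0r (a J)); apply: cvgM; last exact: cvg_cst.
  by apply: cvg_expr; rewrite ger0_norm.
have e2 : 0 < e / 2 by rewrite divr_gt0.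
move/cvgrPdist_le : cr => /(_ _ e2)[n0 _ hn].
exists (J + n0)%N => // m /= hm; rewrite sub0r normrN ger0_norm//.
have Jm : (J <= m)%N by apply: leq_trans hm; exact: leq_addr.
have := hn (m - J)%N; rewrite /= leq_subRL// => /(_ hm).
rewrite sub0r normrN ger0_norm ?mulr_ge0 ?exprn_ge0// => h.
have := step (m - J)%N; rewrite subnKC// => /le_trans; apply.
by lra.
Qed.

(* Peeling off one factor ['X - z] at a time. *)
Lemma annihilated_cvg n' (A : 'M[C]_n'.+1) (rs : seq C) :
  (forall z, z \in rs -> normc z < 1) -> forall u : 'rV[C]_n'.+1,
  u *m horner_mx A (\prod_(z <- rs) ('X - z%:P)) = 0 ->
  vnorm (u *m A ^+ j) @[j --> \oo] --> (0 : R).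
Proof.
elim: rs => [|z rs IH] hrs u.
  rewrite big_nil rmorph1 mulmx1 => ->.
  under eq_fun do rewrite mul0mx.
  rewrite (_ : vnorm 0 = 0); first exact: cvg_cst.
  by rewrite /vnorm big1// => i _; rewrite mxE Normc.normc0.
rewrite big_cons rmorphM/= mulmxA rmorphB/= horner_mx_X horner_mx_C => hu.
set v := u *m _ in hu.
have cv := IH (fun y ys => hrs y (mem_behead (s := z :: rs) ys)) v hu.
apply: (@contraction_cvg _ _ (normc z) _ _ _ _ cv).
- exact: normc_ge0.
- by apply: hrs; rewrite mem_head.
- by move=> j; exact: vnorm_ge0.
(* With v = u (A - z), the recursion is u A^(j+1) = z u A^j + v A^j. *)
move=> j; rewrite -vnormZ; apply: le_trans (vnormD _ _).
rewrite le_eqVlt; apply/orP; left; apply/eqP; congr vnorm.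
rewrite exprS mulmxA /v mulmxBr mulmxBl mul_mx_scalar scalemxAl.
by rewrite addrC subrK.
Qed.

Section real_matrix.
Variables (n : nat) (A : 'M[R]_n).
Let AC : 'M[C]_n := map_mx (real_complex R) A.

(** The characteristic polynomial splits over the complex numbers and annihilates the matrix by
    Cayley-Hamilton, so [annihilated_cvg] applies to every row. *)
Lemma power_cvg0 : (forall z, eigenvalue AC z -> normc z < 1) ->
  forall (u : 'rV[R]_n) i, (u *m A ^+ j) 0 i @[j --> \oo] --> (0 : R).
Proof.
(* A matrix of size 0 has no coordinate to consider; evaluating a polynomial at a matrix requires
   positive size. *)
case: n A @AC => [|n'] B BC hz u i; first by case: i.
have [rs ers] := closed_field_poly_normal (char_poly BC).
rewrite (monicP (char_poly_monic BC)) scale1r in ers.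
have hrs z : z \in rs -> normc z < 1.
  by move=> zrs; apply: hz; rewrite eigenvalue_root_char ers root_prod_XsubC.
pose uC : 'rV[C]_n'.+1 := map_mx (real_complex R) u.
have := @annihilated_cvg n' BC rs hrs uC.
rewrite -ers Cayley_Hamilton mulmx0 => /(_ erefl) cu.
apply/cvgrPdist_le => e e0; move/cvgrPdist_le : cu => /(_ _ e0).
apply: filterS => j; rewrite !sub0r !normrN (ger0_norm (vnorm_ge0 _)).
apply: le_trans; rewrite -normc_real.
have eC : uC *m BC ^+ j = map_mx (real_complex R) (u *m B ^+ j).
  by rewrite map_mxM /uC /BC rmorphXn.
rewrite eC; apply: le_trans (vnorm_coord _ i).
by rewrite [X in _ <= normc X]mxE.
Qed.

(** If v A = z v with |z| >= 1, every coordinate of v A^j keeps at least its initial modulus, while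
    it is bounded by a fixed combination of entries of A^j. *)
Lemma eigenvalue_power_lt1 :
  (forall l i, (A ^+ j) l i @[j --> \oo] --> (0 : R)) ->
  forall z, eigenvalue AC z -> normc z < 1.
Proof.
move=> cA z /eigenvalueP[v vA v0]; rewrite ltNge; apply/negP => z1.
have [i vi] : exists i, v 0 i != 0.
  apply: contrapT => h; move/eqP: v0; apply; apply/rowP => i; rewrite [RHS]mxE.
  by apply: contrapT => /eqP vi; apply: h; exists i.
have vAj j : v *m AC ^+ j = z ^+ j *: v.
  elim: j => [|j IH]; first by rewrite !expr0 scale1r mulmx1.
  by rewrite exprSr mulmxA IH -scalemxAl vA scalerA exprSr.
have ci : \sum_l normc (v 0 l) * `|(A ^+ j) l i| @[j --> \oo] --> (0 : R).
  have s0 : \sum_l normc (v 0 l) * `|0 : R| = 0.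
    by rewrite big1// => l _; rewrite normr0 mulr0.
  rewrite -[X in _ --> X]s0; apply: (@cvg_sumr R R^o) => l.
  by apply: cvgM; [exact: cvg_cst|apply: cvg_norm; exact: cA].
have p0 : 0 < normc (v 0 i).
  by rewrite lt_neqAle normc_ge0 andbT eq_sym; apply: contra vi => /eqP/Normc.eq0_normc->.
have p2 : 0 < normc (v 0 i) / 2 by rewrite divr_gt0.
move/cvgrPdist_le : ci => /(_ _ p2)[j _ /(_ j (leqnn j)) /=].
rewrite sub0r normrN ger0_norm; last first.
  by apply: sumr_ge0 => l _; rewrite mulr_ge0// normc_ge0.
apply/negP; rewrite -ltNge.
apply: (@lt_le_trans _ _ (normc (v 0 i))); first lra.
apply: (@le_trans _ _ (normc ((v *m AC ^+ j) 0 i))).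
  by rewrite vAj mxE normcM_eq normcX ler_peMl ?normc_ge0// exprn_ege1.
rewrite mxE; apply: (le_trans (normc_sum _ _)); apply: ler_sum => l _.
by rewrite normcM_eq /AC -rmorphXn/= mxE normc_real.
Qed.

End real_matrix.
End spectral_power.

(** * Real operators and their complex eigenvalues *)

Section operator_spectrum.
Context {R : realType} {K : hilbertType R}.
Local Notation normc := (@Normc.normc R).
Variables (n : nat) (b : 'I_n -> K).
Hypothesis ob : orthonormal_family b.
Hypothesis gb : forall x, x = \sum_i dot x (b i) *: b i.
Variable S : K -> K.
Hypothesis lS : linear S.

(** Row i holds the coordinates of [S (b i)]: the matrix acts on row vectors from the right, the
    convention behind [eigenvalue]. *)
Definition op_matrix : 'M[R]_n := \matrix_(i, j) dot (S (b i)) (b j).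
Let MC := map_mx (real_complex R) op_matrix.

Lemma S_sum (c : 'I_n -> R) : S (\sum_i c i *: b i) = \sum_i c i *: S (b i).
Proof.
have S0 : S 0 = 0.
  by have := lS (-1) 0 0; rewrite scaler0 add0r scaleN1r addNr.
apply: (big_ind2 (fun x y => S x = y)) => // [x y x' y' <- <-|i _].
  by have := lS 1 x x'; rewrite !scale1r.
by have := lS (c i) (b i) 0; rewrite !addr0 S0 addr0.
Qed.

Lemma dot_S x j : dot (S x) (b j) = \sum_i dot x (b i) * op_matrix i j.
Proof.
rewrite {1}(gb x) S_sum dot_suml; apply: eq_bigr => i _.
by rewrite dotZl mxE.
Qed.

Lemma coord_inj x y : (forall j, dot x (b j) = dot y (b j)) -> x = y.
Proof. by move=> h; rewrite (gb x) (gb y); apply: eq_bigr => i _; rewrite h. Qed.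

(** The pair (x, y) corresponds to the complex row with entries <x, b_i> + i <y, b_i>; the two real
    equations are the real and imaginary parts of one complex equation. *)
Lemma complex_eigenvalueE z : complex_eigenvalue S z <-> eigenvalue MC z.
Proof.
case: z => p r; split=> [[x [y [xy0 /= Sx Sy]]]|/eigenvalueP[v vM v0]].
  apply/eigenvalueP; exists (\row_i (Complex (dot x (b i)) (dot y (b i)))).
    apply/rowP => j; rewrite !mxE.
    transitivity (Complex (dot (S x) (b j)) (dot (S y) (b j))).
      rewrite !dot_S; elim/big_rec3: _ => [|i s t u _ ->] //.
      by rewrite !mxE; simpc.
    by rewrite Sx Sy dotBl dotDl !dotZl; simpc; congr Complex; ring.
  apply/eqP => /rowP h; apply: xy0; congr pair; apply: coord_inj => j;
    by have := h j; rewrite !mxE dot0l => -[].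
exists (\sum_i complex.Re (v 0 i) *: b i), (\sum_i complex.Im (v 0 i) *: b i); split=> /=.
- move=> [x0 y0]; move/eqP: v0; apply; apply/rowP => i; rewrite mxE.
  have := orthonormal_dot_sum (fun i => complex.Re (v 0 i)) i ob.
  have := orthonormal_dot_sum (fun i => complex.Im (v 0 i)) i ob.
  by rewrite x0 y0 !dot0l; case: (v 0 i) => ? ? /= <- <-.
- apply: coord_inj => j; rewrite dot_S dotBl !dotZl !orthonormal_dot_sum//.
  rewrite (eq_bigr (fun i => complex.Re (v 0 i) * op_matrix i j));
    last by move=> i _; rewrite orthonormal_dot_sum.
  have := congr1 (fun w : 'rV[R[i]]_n => complex.Re (w 0 j)) vM.
  rewrite /= !mxE; case E : (v 0 j) => [s t] /= <-.
  rewrite -/(complex.Re _) raddf_sum/=; apply: eq_bigr => i _.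
  by rewrite !mxE; case: (v 0 i) => ? ?; simpc.
- apply: coord_inj => j; rewrite dot_S dotDl !dotZl !orthonormal_dot_sum//.
  rewrite (eq_bigr (fun i => complex.Im (v 0 i) * op_matrix i j));
    last by move=> i _; rewrite orthonormal_dot_sum.
  have := congr1 (fun w : 'rV[R[i]]_n => complex.Im (w 0 j)) vM.
  rewrite /= !mxE; case E : (v 0 j) => [s t] /=; rewrite [RHS]addrC => <-.
  rewrite raddf_sum/=; apply: eq_bigr => i _.
  by rewrite !mxE; case: (v 0 i) => ? ?; simpc.
Qed.

(** A supremum of numbers below 1 could still be 1. Here the moduli come from the finitely many
    roots of the characteristic polynomial, so their maximum bounds it. *)
Lemma spectral_radius_lt1 : spectral_radius S < 1 <->
  forall z, eigenvalue MC z -> normc z < 1.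
Proof.
have [rs ers] := closed_field_poly_normal (char_poly MC).
rewrite (monicP (char_poly_monic MC)) scale1r in ers.
have inrs z : eigenvalue MC z = (z \in rs).
  by rewrite eigenvalue_root_char ers root_prod_XsubC.
pose m := \big[Num.max/0]_(z <- rs) normc z.
have ubm : ubound [set normc z | z in [set z | complex_eigenvalue S z]] m.
  move=> _ [z /complex_eigenvalueE zS <-]; rewrite inrs in zS.
  exact: le_bigmax_seq.
split=> [rho1 z zM|h].
  apply: le_lt_trans rho1; apply: ub_le_sup; first by exists m.
  by exists z => //; exact/complex_eigenvalueE.
apply: (@le_lt_trans _ _ m); last first.
  by rewrite /m big_seq; apply: bigmax_lt => // z zrs; apply: h; rewrite inrs.
rewrite /spectral_radius.
(* Without eigenvalues, as in dimension 0, the supremum takes its default value 0. *)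
have [->|/set0P ne] := eqVneq [set normc z | z in [set z | complex_eigenvalue S z]] set0.
  by rewrite sup0; exact: bigmax_ge_id.
exact: ge_sup.
Qed.

End operator_spectrum.

(** * Second moments of a linear random recursion *)

Section second_moment_recursion.
Context {R : realType} {d : measure_display} {Omega : measurableType d}.
Variable P : probability Omega R.
Variable Filt : R -> set (set Omega).
Hypothesis HFilt : is_usual_filtration P Filt.
Variable dt : R.
Hypothesis dt0 : 0 < dt.
Let t (j : nat) : R := j%:R * dt.
Variables (n : nat) (dm : nat -> 'I_n -> 'I_n -> Omega -> R).
Variable sig : 'I_n -> 'I_n -> 'I_n -> 'I_n -> R.
Hypothesis fdm : forall j i k, fmeas (Filt (t j.+1)) (dm j i k).
Hypothesis ldm : forall j i k, L2 P (dm j i k).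
Hypothesis cdm : forall j i k i' k',
  cond_mean P (Filt (t j)) (fun w => dm j i k w * dm j i' k' w) (sig i k i' k').

Let t_ge0 j : 0 <= t j.
Proof. by rewrite mulr_ge0// ltW. Qed.

Let sF j : sigma_algebra setT (Filt (t j)).
Proof. by apply: (filt_sigma_algebra HFilt); exact: t_ge0. Qed.

Let Fm j : Filt (t j) `<=` measurable.
Proof. by apply: (filt_measurable HFilt); exact: t_ge0. Qed.

Let tS j : t j <= t j.+1.
Proof. by rewrite ler_pM2r// ler_nat. Qed.

Record is_solution (x : nat -> 'I_n -> Omega -> R) : Prop := {
  sol_init_meas : forall i, fmeas (Filt 0) (x 0 i);
  sol_init_L2 : forall i, L2 P (x 0 i);
  sol_step : forall j i w, x j.+1 i w = \sum_k dm j i k w * x j k w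
}.

(** The state at step j is known at time t_j, and the entries have constant conditional second
    moments, so [cond_mean_L2] keeps the products square-integrable. *)
Lemma sol_meas_L2 x : is_solution x ->
  forall j i, fmeas (Filt (t j)) (x j i) /\ L2 P (x j i).
Proof.
move=> [f0 l0 xS]; elim=> [|j IH] i.
  by rewrite /t mul0r; split; [exact: f0|exact: l0].
have -> : x j.+1 i = fun w => \sum_k dm j i k w * x j k w.
  by apply/funext => w; rewrite xS.
split.
  apply: fmeas_sum => [|k]; first exact: sF.
  apply: fmeasM; [exact: sF|exact: fdm|].
  by apply: (fmeas_sub _ (IH k).1); exact: (filt_increasing HFilt).
apply: L2_sum => k.
exact: (cond_mean_L2 (sF j) (@Fm j) (ldm j i k) (cdm j i k i k) (IH k).2 (IH k).1).
Qed.

Lemma moment_step x y j i i' : is_solution x -> is_solution y ->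
  Ex P (fun w => x j.+1 i w * y j.+1 i' w) =
  \sum_k \sum_k' Ex P (fun w => x j k w * y j k' w) * sig i k i' k'.
Proof.
move=> sx sy.
have h k k' : L1 P (fun w => (x j k w * y j k' w) * (dm j i k w * dm j i' k' w)) /\
    Ex P (fun w => (x j k w * y j k' w) * (dm j i k w * dm j i' k' w)) =
    sig i k i' k' * Ex P (fun w => x j k w * y j k' w).
  have [fx lx] := sol_meas_L2 sx j k; have [fy ly] := sol_meas_L2 sy j k'.
  apply: (cond_mean_ext (sF j) (@Fm j) (ldm j i k) (ldm j i' k') (cdm j i k i k)
    (cdm j i' k' i' k') (cdm j i k i' k')); first exact: L2M.
  exact: fmeasM.
transitivity (Ex P (fun w => \sum_k \sum_k'
    (x j k w * y j k' w) * (dm j i k w * dm j i' k' w))).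
  congr Ex; apply/funext => w; rewrite (sol_step sx) (sol_step sy) mulr_suml.
  apply: eq_bigr => k _; rewrite mulr_sumr; apply: eq_bigr => k' _; ring.
rewrite Ex_sum; last by move=> k; apply: L1_sum => k'; have [] := h k k'.
apply: eq_bigr => k _; rewrite Ex_sum; last by move=> k'; have [] := h k k'.
by apply: eq_bigr => k' _; have [_ ->] := h k k'; rewrite mulrC.
Qed.

Local Notation T := ('I_n * 'I_n)%type.

Definition moment_row (x y : nat -> 'I_n -> Omega -> R) j : 'rV[R]_#|{: T}| :=
  \row_a Ex P (fun w => x j (enum_val a).1 w * y j (enum_val a).2 w).

(** Rows a are source pairs (k, k') and columns b target pairs (i, i'), so that one time step
    multiplies the row of moments from the right. *)
Definition moment_matrix : 'M[R]_#|{: T}| :=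
  \matrix_(a, b) sig (enum_val b).1 (enum_val a).1 (enum_val b).2 (enum_val a).2.

Lemma moment_row_step x y j : is_solution x -> is_solution y ->
  moment_row x y j.+1 = moment_row x y j *m moment_matrix.
Proof.
move=> sx sy; apply/rowP => b; rewrite !mxE moment_step// pair_big/=.
rewrite (reindex (@enum_val {: T} predT))/=; last first.
  by apply: onW_bij; exact: enum_val_bij.
by apply: eq_bigr => a _; rewrite !mxE.
Qed.

Lemma moment_rowE x y j : is_solution x -> is_solution y ->
  moment_row x y j = moment_row x y 0 *m moment_matrix ^+ j.
Proof.
move=> sx sy; elim: j => [|j IH]; first by rewrite expr0 mulmx1.
by rewrite moment_row_step// IH exprSr mulmxA.
Qed.

End second_moment_recursion.

(** * Series and tensor bases *)

Section dominated_sequences.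
Context {R : realType} {K : hilbertType R}.

(** Majorant criterion: by telescoping, the Cauchy property passes from s to u. It yields the
    convergence that gives the [limn] defining q and q' their meaning. *)
Lemma cvg_dominated_steps (u : nat -> K) (s : nat -> R) :
  (forall n, `|u n.+1 - u n| <= s n.+1 - s n) -> cvgn s -> cvgn u.
Proof.
move=> us cs.
have us_le m n : (m <= n)%N -> `|u n - u m| <= s n - s m.
  move=> /subnKC <-; elim: (n - m)%N => [|k IH]; first by rewrite addn0 !subrr normr0.
  rewrite addnS -(subrKA (u (m + k)%N)) (le_trans (ler_normD _ _))//.
  by have := lerD (us (m + k)%N) IH; rewrite subrKA.
have nds : {homo s : n m / (n <= m)%N >-> n <= m}.
  by move=> m n mn; rewrite -subr_ge0 (le_trans _ (us_le _ _ mn)).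
apply: cauchy_cvg; apply/cauchyP => e e0.
move/cvgrPdist_lt : (cs) => /(_ _ e0)[m _ /(_ m (leqnn m)) /= hm].
exists (u m), m => // n /= mn; rewrite -ball_normE/= distrC.
apply: le_lt_trans (us_le _ _ mn) _; apply: le_lt_trans hm.
by rewrite (le_trans _ (ler_norm _))// lerD2r; exact: nondecreasing_cvgn_le.
Qed.

Lemma cvg_weighted_series (mu : nat -> R) (z : nat -> K) :
  (forall k, 0 <= mu k) -> (forall k, `|z k| <= 1) -> cvgn (series mu) ->
  cvgn (series (fun k => mu k *: z k)).
Proof.
move=> mu0 z1; apply: cvg_dominated_steps => n.
rewrite /series/= !big_nat_recr//= [X in `|X|]addrC addKr [X in _ <= X]addrC addKr.
by rewrite normrZ ger0_norm// ler_piMr.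
Qed.

(** The majorant is the square of the partial sum of mu. Enlarging the square by one adds a column
    and a row, both dominated term by term. *)
Lemma cvg_weighted_square_series (mu : nat -> R) (z : nat -> nat -> K) :
  (forall k, 0 <= mu k) -> (forall k l, `|z k l| <= 1) -> cvgn (series mu) ->
  cvgn (fun n => \sum_(k < n) \sum_(l < n) (mu k * mu l) *: z k l).
Proof.
move=> mu0 z1 cmu.
pose s n : R := \sum_(k < n) \sum_(l < n) mu k * mu l.
have sE : s = (fun n => series mu n * series mu n).
  apply/funext => n; rewrite /s /series/= big_mkord mulr_suml.
  by apply: eq_bigr => k _; rewrite mulr_sumr.
apply: (@cvg_dominated_steps _ s); last first.
  by rewrite sE; apply: is_cvgM.
move=> n; rewrite /s.
have recr (M : zmodType) (F : nat -> nat -> M) :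
    \sum_(k < n.+1) \sum_(l < n.+1) F k l - \sum_(k < n) \sum_(l < n) F k l =
    \sum_(k < n) F k n + \sum_(l < n.+1) F n l.
  rewrite big_ord_recr/=; under eq_bigr do rewrite big_ord_recr/=.
  by rewrite big_split/= -[X in X - _ = _]addrA [LHS]addrC addKr.
rewrite (recr _ (fun k l => (mu k * mu l) *: z k l)) (recr _ (fun k l => mu k * mu l)).
rewrite (le_trans (ler_normD _ _))//; apply: lerD;
  apply: (le_trans (ler_norm_sum _ _ _)); apply: ler_sum => k _;
  by rewrite normrZ ger0_norm ?mulr_ge0// ler_piMr// mulr_ge0.
Qed.

End dominated_sequences.

Section bilinear_continuity.
Context {R : realType} {W K : hilbertType R}.

Lemma bounded_bilinear_cvg (B : W -> K -> K) (u : nat -> W) (l : W) (z y : K) :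
  bounded_bilinear_on setT setT B -> u n @[n --> \oo] --> l ->
  dot (B (u n) z) y @[n --> \oo] --> (dot (B l z) y : R).
Proof.
move=> [Bl _ [M BM]] ul; apply/cvgrPdist_le => e e0.
have B_sub w w' : B (w - w') z = B w z - B w' z.
  have := Bl z Logic.I (-1) w' w Logic.I Logic.I.
  by rewrite !scaleN1r addrC => ->; rewrite addrC.
pose c := `|M| * `|z| * `|y| + 1.
have c0 : 0 < c by rewrite ltr_wpDl// !mulr_ge0.
have d0 : 0 < e / c by rewrite divr_gt0.
move/cvgrPdist_le : ul => /(_ _ d0); apply: filterS => n h.
rewrite -dotBl -B_sub; apply: (le_trans (dot_CS _ _)).
apply: (@le_trans _ _ (`|l - u n| * c)); last first.
  by rewrite -ler_pdivlMr.
have hB := BM (l - u n) z Logic.I Logic.I.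
apply: (@le_trans _ _ (`|M| * `|l - u n| * `|z| * `|y|)).
  apply: ler_wpM2r => //; apply: (le_trans hB); do 2 apply: ler_wpM2r => //.
  exact: ler_norm.
rewrite /c mulrDr mulr1 (_ : `|l - u n| * _ = `|M| * `|l - u n| * `|z| * `|y|); last by ring.
by rewrite lerDl.
Qed.

End bilinear_continuity.

(** * Orthonormal bases of the Galerkin space and of its tensor square *)

Section subspaces.
Context {R : realType}.

Lemma subspace_sum (K : lmodType R) (V : set K) (I : Type) (s : seq I)
    (c : I -> R) (z : I -> K) : linear_subspace V -> (forall i, V (z i)) ->
  V (\sum_(i <- s) c i *: z i).
Proof.
move=> [V0 Vl] Vz; elim: s => [|i s IH]; first by rewrite big_nil.
by rewrite big_cons; exact: Vl.
Qed.

Lemma linear_on_sum (K K' : lmodType R) (V : set K) (T : K -> K') (I : Type)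
    (s : seq I) (c : I -> R) (z : I -> K) : linear_subspace V -> linear_on V T ->
  (forall i, V (z i)) ->
  T (\sum_(i <- s) c i *: z i) = \sum_(i <- s) c i *: T (z i).
Proof.
move=> sV lT Vz; have [V0 Vl] := sV; elim: s => [|i s IH].
  have := lT (-1) 0 0 V0 V0.
  by rewrite !big_nil scaler0 add0r scaleN1r addNr.
by rewrite !big_cons lT ?IH//; exact: subspace_sum.
Qed.

Lemma linear_subspaceT (K : lmodType R) : linear_subspace (setT : set K).
Proof. by []. Qed.

Lemma dim_subspace (K : lmodType R) (V : set K) n :
  is_subspace_of_dim V n -> linear_subspace V.
Proof.
move=> [b [_ ->]]; split=> /=.
  by exists (fun=> 0); rewrite big1// => i _; rewrite scale0r.
move=> a _ _ [c ->] [c' ->]; exists (fun i => a * c i + c' i).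
rewrite scaler_sumr -big_split/=; apply: eq_bigr => i _.
by rewrite scalerDl scalerA.
Qed.

(** Counting dimensions: the coordinates of the n orthonormal vectors in a basis of n elements form
    a square matrix, injective by orthonormality and hence invertible. *)
Lemma orthonormal_expand (H : hilbertType R) (V : set H) n (e : 'I_n -> H) :
  is_subspace_of_dim V n -> orthonormal_family e -> (forall k, V (e k)) ->
  forall v, V v -> v = \sum_k dot v (e k) *: e k.
Proof.
move=> [b [lb VE]] oe Ve v Vv.
have [A eA] : exists A : 'M[R]_n, forall k, e k = \sum_l A k l *: b l.
  have sel k : exists c : 'I_n -> R, e k = \sum_l c l *: b l.
    by have := Ve k; rewrite VE.
  have [c hc] := choice sel; exists (\matrix_(k, l) c k l) => k.
  by rewrite hc; apply: eq_bigr => l _; rewrite mxE.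
have uA : A \in unitmx.
  rewrite -row_free_unit; apply: inj_row_free => u uA0.
  apply/rowP => k; rewrite mxE -(orthonormal_dot_sum (fun k => u 0 k) k oe).
  rewrite (eq_bigr (fun k => \sum_l (u 0 k * A k l) *: b l)); last first.
    by move=> i _; rewrite eA scaler_sumr; apply: eq_bigr => l _; rewrite scalerA.
  rewrite exchange_big/= big1 ?dot0l// => l _; rewrite -scaler_suml.
  by have := congr1 (fun M : 'rV[R]_n => M 0 l) uA0; rewrite !mxE => ->; rewrite scale0r.
have bE l : b l = \sum_k invmx A l k *: e k.
  rewrite (eq_bigr (fun k => \sum_m (invmx A l k * A k m) *: b m)); last first.
    by move=> k _; rewrite eA scaler_sumr; apply: eq_bigr => m _; rewrite scalerA.
  rewrite exchange_big/=; under eq_bigr do rewrite -scaler_suml.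
  have E m : \sum_k invmx A l k * A k m = (l == m)%:R.
    by have := congr1 (fun M : 'M[R]_n => M l m) (mulVmx uA); rewrite !mxE.
  by rewrite (bigD1 l)//= E eqxx scale1r big1 ?addr0// => m ml;
    rewrite E eq_sym (negbTE ml) scale0r.
have [c vE] : exists c : 'I_n -> R, v = \sum_k c k *: e k.
  move: Vv; rewrite VE => -[c ->]; exists (fun k => \sum_l c l * invmx A l k).
  rewrite (eq_bigr (fun l => \sum_k (c l * invmx A l k) *: e k)); last first.
    by move=> l _; rewrite bE scaler_sumr; apply: eq_bigr => k _; rewrite scalerA.
  by rewrite exchange_big/=; apply: eq_bigr => k _; rewrite scaler_suml.
rewrite {1}vE; apply: eq_bigr => k _; congr (_ *: _).
by rewrite vE orthonormal_dot_sum.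
Qed.

End subspaces.

Section tensor_basis.
Context {R : realType} {H K : hilbertType R}.
Variables (V : set H) (n : nat) (e : 'I_n -> H) (t : H -> H -> K).
Hypothesis sV : linear_subspace V.
Hypothesis oe : orthonormal_family e.
Hypothesis Ve : forall k, V (e k).
Hypothesis expand : forall v, V v -> v = \sum_k dot v (e k) *: e k.
Hypothesis Ht : is_hilbert_tensor V V t.

Local Notation T := ('I_n * 'I_n)%type.

Definition tensor_basis (a : 'I_#|{: T}|) : K :=
  t (e (enum_val a).1) (e (enum_val a).2).

Lemma tensor_basis_orthonormal : orthonormal_family tensor_basis.
Proof.
move=> a b; rewrite /tensor_basis (tensor_dot Ht)// !oe -natrM mulnb.
rewrite -(inj_eq enum_val_inj); case: (enum_val a) (enum_val b) => [i j] [k l].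
by rewrite xpair_eqE.
Qed.

(** The remainder is orthogonal to all e_k (x) e_l, hence by bilinearity to all elementary tensors,
    whose span is dense. No dimension of the tensor space has to be known. *)
Lemma tensor_basis_expand z : z = \sum_a dot z (tensor_basis a) *: tensor_basis a.
Proof.
have [Bl Br _] := tensor_bilinear Ht.
apply/eqP; rewrite -subr_eq0; apply/eqP; set z' := z - _.
have z'0 a : dot z' (tensor_basis a) = 0 :> R.
  by rewrite dotBl orthonormal_dot_sum ?subrr//; exact: tensor_basis_orthonormal.
have z'e k l : dot z' (t (e k) (e l)) = 0 :> R.
  by have := z'0 (enum_rank (k, l)); rewrite /tensor_basis enum_rankK.
apply: (dense_orthogonal (tensor_dense Ht)).
apply: lspan_orthogonal => _ [x Vx] [y Vy] <-.
rewrite (expand Vx) (linear_on_sum (T := t ^~ y) _ _ sV (Bl y Vy) Ve).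
rewrite dot_sumr big1// => k _; rewrite dotZr.
rewrite (expand Vy) (linear_on_sum _ _ sV (Br _ (Ve k)) Ve) dot_sumr big1 ?mulr0// => l _.
by rewrite dotZr z'e mulr0.
Qed.

End tensor_basis.

(** * Conditional moments of the coefficients of the scheme *)

Lemma Ex_dominated_cvg (R : realType) d (Omega : measurableType d)
    (P : probability Omega R) (Xs : nat -> Omega -> R) (X g : Omega -> R) :
  (forall n, measurable_fun setT (Xs n)) -> L1 P g ->
  (forall n w, `|Xs n w| <= g w) -> (forall w, Xs n w @[n --> \oo] --> X w) ->
  Ex P (Xs n) @[n --> \oo] --> Ex P X.
Proof.
move=> mXs ig Xg XX.
have iXs n : L1 P (Xs n) by exact: L1_le (Xg n).
have mX : measurable_fun setT X.
  by apply: (measurable_fun_cvg mXs) => w _; exact: XX.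
have iX : L1 P X.
  apply: (L1_le mX ig) => w.
  have cw : `|Xs n w| @[n --> \oo] --> `|X w| by apply: cvg_norm; exact: XX.
  rewrite -(cvg_lim _ cw)//; apply: limr_le; first by apply/cvg_ex; exists `|X w|.
  by apply: nearW => n; exact: Xg.
have [||||_ _] := @dominated_convergence _ _ _ P setT measurableT
  (fun n w => (Xs n w)%:E) (fun w => (X w)%:E) (fun w => (g w)%:E) _ _ _ ig.
- by move=> n; exact/measurable_EFinP.
- exact/measurable_EFinP.
- by apply: aeW => w _; apply: cvg_EFin; [exact: nearW|exact: XX].
- by apply: aeW => w n _; rewrite lee_fin.
rewrite -EFin_Ex//.
rewrite (_ : [sequence _]_n = (fun n => (Ex P (Xs n))%:E)); first by move/fine_cvg.
by apply/funext => n; rewrite EFin_Ex.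
Qed.

Section scheme_coefficients.
Context {R : realType} {d : measure_display} {Omega : measurableType d}.
Variable P : probability Omega R.
Variable Filt : R -> set (set Omega).
Hypothesis HFilt : is_usual_filtration P Filt.
Variable U : hilbertType R.
Variable L : R -> Omega -> U.
Hypothesis HL : is_levy_process P Filt L.
Hypothesis HL2 : square_integrable P L.
Hypothesis HLm : is_martingale P Filt L.
Variable Q : U -> U.
Hypothesis HQsa : forall x y, dot (Q x) y = dot x (Q y) :> R.
Hypothesis HQL : is_covariance_operator P L Q.
Variables (f : nat -> U) (mu : nat -> R).
Hypothesis Hf : hilbert_basis f.
Hypothesis HQf : forall k, Q (f k) = mu k *: f k.
Hypothesis Hmu : forall k, 0 <= mu k.
Variables (a b : R).
Hypothesis a0 : 0 <= a.
Hypothesis ab : a < b.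

Let b0 : 0 <= b. Proof. exact: le_trans a0 (ltW ab). Qed.
Let Fma : Filt a `<=` measurable.
Proof. by apply: (filt_measurable HFilt). Qed.
Let sFb : sigma_algebra setT (Filt b).
Proof. by apply: (filt_sigma_algebra HFilt). Qed.

Lemma cov_basis k p : dot (Q (f k)) (f p) = mu k * (k == p)%:R :> R.
Proof. by rewrite HQf dotZl; have [of_ _] := Hf; rewrite of_. Qed.

Section functional.
Variables (phi : U -> R) (M : R).
Hypothesis lphi : forall c x y, phi (c *: x + y) = c * phi x + phi y.
Hypothesis bphi : forall x, `|phi x| <= M * `|x|.

Let phi0 : phi 0 = 0.
Proof. by have := lphi (-1) 0 0; rewrite scaler0 add0r; lra. Qed.

Let phiB x y : phi (x - y) = phi x - phi y.
Proof. by have := lphi (-1) y x; rewrite scaleN1r addrC => ->; lra. Qed.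

Lemma functional_continuous : continuous phi.
Proof.
move=> x; apply/cvgrPdist_le => e e0.
have n0 : 0 < `|M| + 1 by rewrite ltr_wpDl.
have d0 : 0 < e / (`|M| + 1) by rewrite divr_gt0.
near=> y; rewrite -phiB; apply: (le_trans (bphi _)).
have : `|x - y| <= e / (`|M| + 1).
  by near: y; apply: cvgr_dist_le => //; exact: cvg_id.
rewrite ler_pdivlMr// mulrC => h; apply: le_trans h; apply: ler_wpM2r => //.
by rewrite (le_trans (ler_norm _))// lerDl.
Unshelve. all: by end_near. Qed.

Lemma functional_fourier m u : phi (fourier f m u) = \sum_(l < m) dot u (f l) * phi (f l).
Proof.
rewrite /fourier; apply: (big_ind2 (fun x y => phi x = y)) => // [x r y s xr ys|l _].
  by have := lphi 1 x y; rewrite scale1r mul1r xr ys.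
by have := lphi (dot u (f l)) (f l) 0; rewrite !addr0 phi0 addr0.
Qed.

(** Each matrix entry of the Euler-Maruyama part has this form, with phi a bounded linear functional
    on U. *)
Definition fun_inc (w : Omega) : R := phi (L b w - L a w).
Definition fun_inc_approx m (w : Omega) : R :=
  \sum_(l < m) phi (f l) * inc L (f l) a b w.

Lemma fmeas_fun_inc : fmeas (Filt b) fun_inc.
Proof.
have fphi t : 0 <= t -> fmeas (Filt t) (fun w => phi (L t w)).
  move=> t0; apply: (fmeas_continuous functional_continuous).
  exact: (levy_adapted HL t0).
have -> : fun_inc = fun w => phi (L b w) - phi (L a w).
  by apply/funext => w; rewrite /fun_inc phiB.
apply: fmeasB => //; first exact: fphi.
exact: (fmeas_filt HFilt a0 (ltW ab) (fphi a a0)).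
Qed.

Lemma L2_fun_inc_approx m : L2 P (fun_inc_approx m).
Proof. by apply: L2_sum => l; apply/L2Z/(L2_inc HFilt HL HL2). Qed.

Lemma L1_levy_norm t : 0 <= t -> L1 P (fun w => `|L t w| ^+ 2).
Proof.
move=> t0; apply: ge0_L1 => [|w|]; last 2 first.
- exact: sqr_ge0.
- by have := HL2 t0; rewrite /mean_square unlock.
apply: (@fmeas_measurable _ _ _ (Filt t)); first exact: (filt_measurable HFilt).
apply: (@fmeas_continuous _ _ _ _ _ _ (fun u : U => `|u| ^+ 2)).
  exact: sqr_norm_continuous.
exact: (levy_adapted HL t0).
Qed.

(** The approximation is phi of the Fourier sum of the increment. It converges pointwise, and
    Fourier remainders do not exceed the vector in norm, so dominated convergence applies. *)
Lemma L2cvg_fun_inc : L2cvg P fun_inc_approx fun_inc.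
Proof.
pose g w := M ^+ 2 * (2 * `|L b w| ^+ 2 + 2 * `|L a w| ^+ 2).
have ig : L1 P g by apply/L1Z/L1D; apply/L1Z/L1_levy_norm.
have mfinc : measurable_fun setT fun_inc.
  by apply: (fmeas_measurable _ fmeas_fun_inc); exact: (filt_measurable HFilt).
have norm2 w : `|L b w - L a w| ^+ 2 <= 2 * `|L b w| ^+ 2 + 2 * `|L a w| ^+ 2.
  have h : `|L b w - L a w| <= `|L b w| + `|L a w| by exact: ler_normB.
  apply: (@le_trans _ _ ((`|L b w| + `|L a w|) ^+ 2)).
    by rewrite lerXn2r ?nnegrE// addr_ge0.
  by have := sqr_ge0 (`|L b w| - `|L a w|); nra.
have phi2 u : phi u ^+ 2 <= M ^+ 2 * `|u| ^+ 2.
  rewrite -(real_normK (num_real (phi u))) -exprMn lerXn2r ?nnegrE//.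
  exact: le_trans (bphi u).
have lfinc : L2 P fun_inc.
  split=> //; apply: (L1_le _ ig); first exact: measurable_funX.
  move=> w; rewrite ger0_norm ?sqr_ge0//; apply: (le_trans (phi2 _)).
  by rewrite ler_wpM2l ?sqr_ge0.
have approxE m w : fun_inc_approx m w = phi (fourier f m (L b w - L a w)).
  rewrite functional_fourier; apply: eq_bigr => l _.
  by rewrite incE mulrC.
split=> //; first exact: L2_fun_inc_approx.
rewrite -(Ex_cst P 0); apply: (Ex_dominated_cvg (g := g)) => // [m|m w|w].
- apply: measurable_funX; apply: measurable_funB => //.
  exact: L2_meas (L2_fun_inc_approx m).
- rewrite ger0_norm ?sqr_ge0// approxE /fun_inc -phiB; apply: (le_trans (phi2 _)).
  apply: ler_wpM2l; first exact: sqr_ge0.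
  apply: le_trans (norm2 w); rewrite lerXn2r ?nnegrE//.
  by have [of_ _] := Hf; exact: fourier_le.
- have cphi : fun_inc w - fun_inc_approx m w @[m --> \oo] --> (0 : R).
    rewrite -(subrr (fun_inc w)); apply: cvgB; first exact: cvg_cst.
    under eq_fun do rewrite approxE.
    exact: (cvg_comp _ _ (@cvg_fourier _ _ f _ Hf)
      (@functional_continuous (L b w - L a w))).
  by rewrite -(mulr0 0); apply: cvgM.
Qed.

End functional.

Section functional_pair.
Variables (phi psi : U -> R) (M M' : R).
Hypothesis lphi : forall c x y, phi (c *: x + y) = c * phi x + phi y.
Hypothesis bphi : forall x, `|phi x| <= M * `|x|.
Hypothesis lpsi : forall c x y, psi (c *: x + y) = c * psi x + psi y.
Hypothesis bpsi : forall x, `|psi x| <= M' * `|x|.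

Lemma cond_mean_fun_inc : cond_mean P (Filt a) (fun_inc phi) 0.
Proof.
have := cond_mean_mul_cvg Fma (L2cvg_fun_inc lphi bphi) (L2cvg_cst (L2_cst P 1)) (c_ := fun=> 0) (c := 0).
rewrite (_ : (fun w => fun_inc phi w * 1) = fun_inc phi); last by apply/funext => w; rewrite mulr1.
apply; last exact: cvg_cst.
move=> m; have := cond_mean_sum Fma (index_enum 'I_m) xpredT
  (fun l : 'I_m => cond_meanZ Fma (phi (f l)) (cond_mean_inc HFilt HL HL2 HLm a0 ab (f l))).
rewrite big1 => [|l _]; last by rewrite mulr0.
by congr cond_mean; apply/funext => w; rewrite mulr1.
Qed.

Lemma cond_mean_fun_inc_pair kappa :
  \sum_(l < m) mu l * (phi (f l) * psi (f l)) @[m --> \oo] --> kappa ->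
  cond_mean P (Filt a) (fun w => fun_inc phi w * fun_inc psi w) ((b - a) * kappa).
Proof.
move=> ck; pose c m := (b - a) * \sum_(l < m) mu l * (phi (f l) * psi (f l)).
apply: (cond_mean_mul_cvg Fma (L2cvg_fun_inc lphi bphi) (L2cvg_fun_inc lpsi bpsi) (c_ := c)); last first.
  by apply: cvgM => //; exact: cvg_cst.
move=> m.
have := cond_mean_sum Fma (index_enum 'I_m) xpredT (fun k : 'I_m =>
  cond_mean_sum Fma (index_enum 'I_m) xpredT (fun l : 'I_m =>
    cond_meanZ Fma (phi (f k) * psi (f l))
      (cond_mean_inc_pair HFilt HL HL2 HQsa HQL a0 ab (f k) (f l)))).
rewrite [X in cond_mean _ _ X](_ : _ = fun w => fun_inc_approx phi m w * fun_inc_approx psi m w); last first.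
  apply/funext => w; rewrite /fun_inc_approx mulr_suml; apply: eq_bigr => k _.
  by rewrite mulr_sumr; apply: eq_bigr => l _; ring.
move/cond_mean_eq; apply; rewrite /c mulr_sumr; apply: eq_bigr => k _.
rewrite (bigD1 k)//= cov_basis eqxx big1 ?addr0; first by rewrite mulr1; ring.
move=> l lk; rewrite cov_basis.
by rewrite (_ : (k == l :> nat) = false) ?mulr0//; apply/negbTE; rewrite eq_sym.
Qed.

End functional_pair.

(** Pairing L with this vector gives [levy_coord]. It is 0 when mu k = 0, because the inverse of 0
    is 0. *)
Definition coord_vec k : U := (Num.sqrt (mu k))^-1 *: f k.

(** The scaling cancels the normalisation of the coordinates; when mu k = 0 both sides vanish. *)
Lemma coord_cov k p :
  Num.sqrt (mu k) * Num.sqrt (mu p) * dot (Q (coord_vec k)) (coord_vec p) =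
  mu k * (k == p)%:R.
Proof.
rewrite HQsa /coord_vec dotZl -HQsa HQf dotZl dotZr; have [of_ _] := Hf; rewrite of_.
case: eqVneq => [<-|_]; last by rewrite !mulr0.
rewrite !mulr1; have := sqr_sqrtr (Hmu k).
set s := Num.sqrt _ => <-; have [->|s0] := eqVneq s 0; first by rewrite !mul0r expr0n.
by field.
Qed.

Variable I : nat -> nat -> Omega -> R.
Hypothesis HI : forall k l, iterated P Filt L a b (coord_vec k) (coord_vec l) (I k l).

Lemma cadlag_null_set : exists N : set Omega,
  [/\ measurable N, P N = 0%E & forall w, ~ N w -> is_cadlag (fun t => L t w)].
Proof.
have [N [mN PN sub]] := levy_cadlag HL; exists N; split=> // w wN.
by apply: contrapT => h; apply: wN; exact: sub.
Qed.

Definition scaled_integral k l (w : Omega) : R := Num.sqrt (mu k * mu l) * I k l w.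

Lemma L2_scaled_integral k l : L2 P (scaled_integral k l).
Proof.
have [N [mN PN cadN]] := cadlag_null_set.
by apply/L2Z/(L2_iterated HFilt HL HL2 HLm HQsa HQL a0 ab mN PN cadN (HI k l)).
Qed.

Lemma fmeas_scaled_integral k l : fmeas (Filt b) (scaled_integral k l).
Proof.
have [N [mN PN cadN]] := cadlag_null_set.
apply: fmeasZ => //.
exact: (fmeas_iterated HFilt HL HL2 HLm HQsa HQL a0 ab mN PN cadN (HI k l)).
Qed.

Lemma cond_mean_scaled_integral k l : cond_mean P (Filt a) (scaled_integral k l) 0.
Proof.
have [N [mN PN cadN]] := cadlag_null_set.
rewrite -(mulr0 (Num.sqrt (mu k * mu l))); apply: cond_meanZ => //.
exact: (cond_mean_iterated HFilt HL HL2 HLm HQsa HQL a0 ab mN PN cadN (HI k l)).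
Qed.

Lemma cond_mean_scaled_integral_inc k l z : cond_mean P (Filt a) (fun w => scaled_integral k l w * inc L z a b w) 0.
Proof.
have [N [mN PN cadN]] := cadlag_null_set.
have := cond_mean_iterated_inc HFilt HL HL2 HLm HQsa HQL a0 ab mN PN cadN (HI k l) z.
move/(cond_meanZ Fma (Num.sqrt (mu k * mu l))); rewrite mulr0.
by congr cond_mean; apply/funext => w; rewrite mulrA.
Qed.

Lemma cond_mean_scaled_integral_pair k l p r : cond_mean P (Filt a) (fun w => scaled_integral k l w * scaled_integral p r w)
  ((b - a) ^+ 2 / 2 * (mu k * mu l * ((k == p) && (l == r))%:R)).
Proof.
have [N [mN PN cadN]] := cadlag_null_set.
have := cond_mean_iterated_pair HFilt HL HL2 HLm HQsa HQL a0 ab mN PN cadN (HI k l) (HI p r).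
move/(cond_meanZ Fma (Num.sqrt (mu k * mu l) * Num.sqrt (mu p * mu r))).
rewrite [X in cond_mean _ _ X](_ : _ = fun w => scaled_integral k l w * scaled_integral p r w); last first.
  by apply/funext => w; rewrite /scaled_integral; ring.
move/cond_mean_eq; apply; rewrite !sqrtrM// -mulnb natrM.
transitivity ((b - a) ^+ 2 / 2 *
  ((Num.sqrt (mu k) * Num.sqrt (mu p) * dot (Q (coord_vec k)) (coord_vec p)) *
   (Num.sqrt (mu l) * Num.sqrt (mu r) * dot (Q (coord_vec l)) (coord_vec r)))); first by ring.
by rewrite !coord_cov; ring.
Qed.

Definition milstein_sum (beta : nat -> nat -> R) m (w : Omega) : R :=
  \sum_(k < m) \sum_(l < m) beta k l * scaled_integral k l w.

Lemma L2_milstein_sum beta m : L2 P (milstein_sum beta m).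
Proof. by apply: L2_sum => k; apply: L2_sum => l; apply/L2Z/L2_scaled_integral. Qed.

Section milstein_entries.
Variables (beta beta' : nat -> nat -> R) (Y Y' : Omega -> R).
Hypothesis cY : L2cvg P (milstein_sum beta) Y.
Hypothesis cY' : L2cvg P (milstein_sum beta') Y'.

Lemma fmeas_milstein_entry : fmeas (Filt b) Y.
Proof.
apply: (fmeas_L2cvg _ _ _ cY) => //.
  apply: (subset_trans (filt_null HFilt)).
  exact: (filt_increasing HFilt (lexx 0) b0).
move=> m; apply: fmeas_sum => // k; apply: fmeas_sum => // l.
by apply: fmeasZ => //; exact: fmeas_scaled_integral.
Qed.

Lemma cond_mean_milstein_entry : cond_mean P (Filt a) Y 0.
Proof.
have := cond_mean_mul_cvg Fma cY (L2cvg_cst (L2_cst P 1)) (c_ := fun=> 0) (c := 0).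
rewrite (_ : (fun w => Y w * 1) = Y); last by apply/funext => w; rewrite mulr1.
apply; last exact: cvg_cst.
move=> m; have := cond_mean_sum Fma (index_enum 'I_m) xpredT (fun k : 'I_m =>
  cond_mean_sum Fma (index_enum 'I_m) xpredT (fun l : 'I_m =>
    cond_meanZ Fma (beta k l) (cond_mean_scaled_integral k l))).
rewrite big1 => [|k _]; last by rewrite big1// => l _; rewrite mulr0.
by congr cond_mean; apply/funext => w; rewrite mulr1.
Qed.

Lemma cond_mean_milstein_entry_fun_inc phi M : (forall c x y, phi (c *: x + y) = c * phi x + phi y) ->
  (forall x, `|phi x| <= M * `|x|) ->
  cond_mean P (Filt a) (fun w => Y w * fun_inc phi w) 0.
Proof.
move=> lphi bphi.
apply: (cond_mean_mul_cvg Fma cY (L2cvg_fun_inc lphi bphi) (c_ := fun=> 0)); last exact: cvg_cst.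
move=> m; have := cond_mean_sum Fma (index_enum 'I_m) xpredT (fun k : 'I_m =>
  cond_mean_sum Fma (index_enum 'I_m) xpredT (fun l : 'I_m =>
    cond_mean_sum Fma (index_enum 'I_m) xpredT (fun p : 'I_m =>
    cond_meanZ Fma (beta k l * phi (f p)) (cond_mean_scaled_integral_inc k l (f p))))).
rewrite big1; last first.
  by move=> k _; rewrite big1// => l _; rewrite big1// => p _; rewrite mulr0.
congr cond_mean; apply/funext => w; rewrite /milstein_sum mulr_suml; apply: eq_bigr => k _.
rewrite mulr_suml; apply: eq_bigr => l _; rewrite /fun_inc_approx mulr_sumr.
by apply: eq_bigr => p _; ring.
Qed.

Lemma cond_mean_milstein_entry_pair kappa :
  \sum_(k < m) \sum_(l < m) (mu k * mu l) * (beta k l * beta' k l) @[m --> \oo] --> kappa ->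
  cond_mean P (Filt a) (fun w => Y w * Y' w) ((b - a) ^+ 2 / 2 * kappa).
Proof.
move=> ck; pose c m := (b - a) ^+ 2 / 2 *
  \sum_(k < m) \sum_(l < m) (mu k * mu l) * (beta k l * beta' k l).
apply: (cond_mean_mul_cvg Fma cY cY' (c_ := c)); last first.
  by apply: cvgM => //; exact: cvg_cst.
move=> m.
have := cond_mean_sum Fma (index_enum ('I_m * 'I_m)%type) xpredT (fun p : 'I_m * 'I_m =>
  cond_mean_sum Fma (index_enum ('I_m * 'I_m)%type) xpredT (fun r : 'I_m * 'I_m =>
    cond_meanZ Fma (beta p.1 p.2 * beta' r.1 r.2) (cond_mean_scaled_integral_pair p.1 p.2 r.1 r.2))).
rewrite [X in cond_mean _ _ X](_ : _ = fun w => milstein_sum beta m w * milstein_sum beta' m w); last first.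
  have milstein_sumE be : milstein_sum be m = fun w => \sum_(p : 'I_m * 'I_m) be p.1 p.2 * scaled_integral p.1 p.2 w.
    by apply/funext => w; rewrite /milstein_sum pair_big.
  rewrite !milstein_sumE; apply/funext => w; rewrite mulr_suml; apply: eq_bigr => p _.
  by rewrite mulr_sumr; apply: eq_bigr => r _; ring.
move/cond_mean_eq; apply; rewrite /c [X in _ = _ * X]pair_big/= mulr_sumr; apply: eq_bigr => p _.
rewrite (bigD1 p)//= !eqxx big1 ?addr0; first by rewrite mulr1; ring.
move=> r rp; rewrite (_ : (_ && _) = false) ?mulr0//.
by apply/negbTE; apply: contra rp; case: p r => [p1 p2] [r1 r2] /=;
  rewrite xpair_eqE ![r1 == _]eq_sym ![r2 == _]eq_sym.
Qed.

End milstein_entries.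

End scheme_coefficients.

(** * Stability of linear random recursions *)

Section linear_scheme_stability.
Context {R : realType} {d : measure_display} {Omega : measurableType d}.
Variable P : probability Omega R.
Variable Filt : R -> set (set Omega).
Hypothesis HFilt : is_usual_filtration P Filt.
Variable dt : R.
Hypothesis dt0 : 0 < dt.
Variables (H K : hilbertType R) (V : set H) (n : nat) (e : 'I_n -> H).
Hypothesis sV : linear_subspace V.
Hypothesis oe : orthonormal_family e.
Hypothesis Ve : forall k, V (e k).
Hypothesis expand : forall v, V v -> v = \sum_k dot v (e k) *: e k.
Variable t : H -> H -> K.
Hypothesis Ht : is_hilbert_tensor V V t.
Variable A : nat -> Omega -> H -> H.
Hypothesis A_linear : forall j w, linear_on V (A j w).
Hypothesis A_stable : forall j w v, V v -> V (A j w v).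
Variable scheme : (Omega -> H) -> nat -> Omega -> H.
Hypothesis scheme0 : forall x0 w, scheme x0 0 w = x0 w.
Hypothesis schemeS : forall x0 j w, scheme x0 j.+1 w = A j w (scheme x0 j w).
Variable S : K -> K.
Hypothesis S_linear : linear S.

Definition entry j i k (w : Omega) : R := dot (A j w (e k)) (e i).
Definition coef i k i' k' : R := dot (S (t (e k) (e k'))) (t (e i) (e i')).

Hypothesis entry_meas : forall j i k, fmeas (Filt (j.+1%:R * dt)) (entry j i k).
Hypothesis entry_L2 : forall j i k, L2 P (entry j i k).
Hypothesis entry_cond_mean : forall j i k i' k',
  cond_mean P (Filt (j%:R * dt)) (fun w => entry j i k w * entry j i' k' w) (coef i k i' k').

Let x (x0 : Omega -> H) j i w : R := dot (scheme x0 j w) (e i).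
Let M : 'M[R]_#|{: 'I_n * 'I_n}| := moment_matrix coef.

Lemma norm_coords v : V v -> `|v| ^+ 2 = \sum_i dot v (e i) ^+ 2 :> R.
Proof. by move=> Vv; rewrite {1}(expand Vv) orthonormal_norm. Qed.

Lemma scheme_in (x0 : Omega -> H) j w : (forall w, V (x0 w)) -> V (scheme x0 j w).
Proof.
move=> Vx0; elim: j => [|j IH]; first by rewrite scheme0.
by rewrite schemeS; exact: A_stable.
Qed.

Lemma initial_solution x0 : is_initial_value P Filt V x0 ->
  is_solution P Filt (fun j i k => entry j i k) (x x0).
Proof.
move=> [Vx0 mx0 fx0].
have fx i : fmeas (Filt 0) (x x0 0 i).
  rewrite /x; under [X in fmeas _ X]funext do rewrite scheme0.
  by apply: (fmeas_continuous (phi := fun v => dot v (e i)) _ mx0); exact: dot_continuousl.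
have F0m : Filt 0 `<=` measurable by apply: (filt_measurable HFilt).
split=> // [i|j i w].
  split; first exact: fmeas_measurable (fx i).
  have iN : L1 P (fun w => `|x0 w| ^+ 2).
    apply: ge0_L1 => [|w|]; last 2 first.
    - exact: sqr_ge0.
    - by move: fx0; rewrite /mean_square unlock.
    apply: (fmeas_measurable F0m).
    apply: (fmeas_continuous (phi := fun u : H => `|u| ^+ 2) _ mx0).
    exact: sqr_norm_continuous.
  apply: (L1_le _ iN) => [|w].
    by apply: measurable_funX; exact: fmeas_measurable (fx i).
  rewrite ger0_norm ?sqr_ge0// /x scheme0 norm_coords// (bigD1 i)//= lerDl.
  by apply: sumr_ge0 => k _; exact: sqr_ge0.
rewrite /x schemeS {1}(expand (scheme_in j w Vx0)) (linear_on_sum _ _ sV (A_linear j w) Ve).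
by rewrite dot_suml; apply: eq_bigr => k _; rewrite dotZl mulrC.
Qed.

Lemma mean_square_coords x0 j : is_initial_value P Filt V x0 ->
  mean_square P (scheme x0 j) = (\sum_i Ex P (fun w => x x0 j i w ^+ 2))%:E.
Proof.
move=> ix0; have sx := initial_solution ix0.
have l2 i : L2 P (x x0 j i).
  by have [] := sol_meas_L2 HFilt dt0 entry_meas entry_L2 entry_cond_mean sx j i.
rewrite /mean_square unlock -Ex_sum; last by move=> i; exact: L2_sqr.
rewrite EFin_Ex; last by apply: L1_sum => i; exact: L2_sqr.
apply: eq_integral => w _; rewrite norm_coords//.
by case: ix0 => Vx0 _ _; exact: scheme_in.
Qed.

Lemma momentE x0 y0 j b : is_initial_value P Filt V x0 -> is_initial_value P Filt V y0 ->
  Ex P (fun w => x x0 j (enum_val b).1 w * x y0 j (enum_val b).2 w) =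
  \sum_a Ex P (fun w => x x0 0 (enum_val a).1 w * x y0 0 (enum_val a).2 w) *
    (M ^+ j) a b.
Proof.
move=> ix0 iy0; have sx := initial_solution ix0; have sy := initial_solution iy0.
have := moment_rowE HFilt dt0 entry_meas entry_L2 entry_cond_mean j sx sy.
move=> /(congr1 (fun r : 'rV[R]_#|{: 'I_n * 'I_n}| => r 0 b)); rewrite !mxE => ->.
by apply: eq_bigr => a _; rewrite mxE.
Qed.

Lemma const_initial v : V v -> is_initial_value P Filt V (fun=> v) /\
  mean_square P (fun=> v) = (`|v| ^+ 2)%:E.
Proof.
move=> Vv; have E : mean_square P (fun=> v) = (`|v| ^+ 2)%:E.
  by rewrite /mean_square unlock -EFin_Ex ?Ex_cst//; exact: L1_cst.
split=> //; split=> //; last by rewrite E ltry.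
move=> B _; have sF : sigma_algebra setT (Filt 0) by apply: (filt_sigma_algebra HFilt).
have [F0 _ _] := sF.
have [vB|vB] := pselect (B v).
  rewrite (_ : _ @^-1` B = ~` set0); first exact: sigma_algebraTC.
  by apply/seteqP; split=> [w _ []|w _].
by rewrite (_ : _ @^-1` B = set0)//; apply/seteqP; split=> [w /vB|w].
Qed.

Let b := tensor_basis e t.

(** The moment matrix is the matrix of S in the basis e_k (x) e_k', entry by entry. *)
Let spectral : spectral_radius S < 1 <->
  forall z, eigenvalue (map_mx (real_complex R) M) z -> Normc.normc z < 1.
Proof.
have -> : M = op_matrix b S by apply/matrixP => i j; rewrite !mxE.
apply: spectral_radius_lt1 => //; first exact: (tensor_basis_orthonormal oe Ve Ht).
exact: (tensor_basis_expand sV oe Ve expand Ht).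
Qed.

(** The deterministic initial values s e_k and s e_k' have a single nonzero mixed moment, so the
    later moments are s^2 times row (k, k') of M^j. Cauchy-Schwarz bounds them by the mean squares
    of the two solutions. *)
Lemma stable_power_cvg0 :
  asymptotically_mean_square_stable P Filt V scheme ->
  forall a c, (M ^+ j) a c @[j --> \oo] --> (0 : R).
Proof.
move=> [_ [del del0 hdel]] a c.
(* Then s^2 = del/4, strictly below the admissible size del. *)
pose s := Num.sqrt del / 2.
have s2 : s ^+ 2 = del / 4 by rewrite /s expr_div_n sqr_sqrtr ?ltW//; field.
have s20 : 0 < s ^+ 2 by rewrite s2 divr_gt0.
have ini k : is_initial_value P Filt V (fun=> s *: e k) /\
    mean_square P (fun=> s *: e k) = (s ^+ 2)%:E.
  have [|h1 ->] := @const_initial (s *: e k).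
    by have [V0 Vl] := sV; rewrite -[_ *: _]addr0; apply: Vl.
  split=> //; congr EFin; rewrite -dot_norm dotZl dotZr oe eqxx mulr1; ring.
have coord0 k i : (fun w => x (fun=> s *: e k) 0 i w) = fun=> s * (k == i)%:R.
  by apply/funext => w; rewrite /x scheme0 dotZl oe.
have cvk k i : Num.sqrt (Ex P (fun w => x (fun=> s *: e k) j i w ^+ 2))
    @[j --> \oo] --> (0 : R).
  have [ik mk] := ini k.
  have hm : (mean_square P (fun=> s *: e k) < del%:E)%E.
    by rewrite mk s2 lte_fin; move: del0 => /=; lra.
  have /fine_cvgP[_ c0] := hdel _ ik hm.
  have cx : Ex P (fun w => x (fun=> s *: e k) j i w ^+ 2) @[j --> \oo] --> (0 : R).
    apply: (@squeeze_cvgr _ _ _ _ (fun=> 0)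
      (fun j => fine (mean_square P (scheme (fun=> s *: e k) j)))) => //.
      near=> j; rewrite Ex_sq_ge0/= mean_square_coords//= (bigD1 i)//= lerDl.
      by apply: sumr_ge0 => l _; exact: Ex_sq_ge0.
    exact: cvg_cst.
  by rewrite -sqrtr0; exact: (cvg_comp _ _ cx (@sqrt_continuous R 0)).
set k := (enum_val a).1; set k' := (enum_val a).2.
set i := (enum_val c).1; set i' := (enum_val c).2.
have [ik _] := ini k; have [ik' _] := ini k'.
have E j : (M ^+ j) a c = (s ^+ 2)^-1 *
    Ex P (fun w => x (fun=> s *: e k) j i w * x (fun=> s *: e k') j i' w).
  rewrite (momentE j c ik ik') (bigD1 a)//= big1 ?addr0 => [|a' a'a].
    rewrite /x; under [X in Ex _ X]funext do rewrite !scheme0 !dotZl !oe !eqxx !mulr1.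
    by rewrite Ex_cst -expr2 mulKf// gt_eqF.
  rewrite (_ : (fun w => _) = fun=> 0) ?Ex_cst ?mul0r//.
  apply/funext => w; rewrite /x !scheme0 !dotZl !oe /k /k'.
  suff : ~~ ((enum_val a).1 == (enum_val a').1) || ~~ ((enum_val a).2 == (enum_val a').2).
    by case/orP => /negbTE ->; rewrite !(mulr0, mul0r).
  rewrite -negb_and; apply: contra a'a => /andP[/eqP h1 /eqP h2].
  apply/eqP/enum_val_inj; move: h1 h2.
  by case: (enum_val a) (enum_val a') => [? ?] [? ?] /= -> ->.
apply: (@norm_cvg0 _ R^o).
apply: (@squeeze_cvgr _ _ _ _ (fun=> 0) (fun j => (s ^+ 2)^-1 *
   (Num.sqrt (Ex P (fun w => x (fun=> s *: e k) j i w ^+ 2)) *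
    Num.sqrt (Ex P (fun w => x (fun=> s *: e k') j i' w ^+ 2))))).
- near=> j; rewrite normr_ge0/= E normrM gtr0_norm ?invr_gt0// ler_pM2l ?invr_gt0//.
  have l2 l : is_initial_value P Filt V (fun=> s *: e l) ->
      forall m, L2 P (x (fun=> s *: e l) j m).
    move=> il m; have sl := initial_solution il.
    by have [] := sol_meas_L2 HFilt dt0 entry_meas entry_L2 entry_cond_mean sl j m.
  apply: le_trans (Ex_abs_CS (l2 _ ik i) (l2 _ ik' i')).
  by apply: Ex_norm; apply: L2M; exact: l2.
- exact: cvg_cst.
- have z0 : (s ^+ 2)^-1 * (0 * 0) = 0 :> R by rewrite mul0r mulr0.
  rewrite -[X in _ --> X]z0; apply: cvgM; first exact: cvg_cst.
  by apply: cvgM; exact: cvk.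
Unshelve. all: by end_near. Qed.

(** Only the diagonal target pairs (i, i) enter the mean-square norm, while every source pair a
    contributes. *)
Definition power_bound j : R := \sum_i \sum_a `|(M ^+ j) a (enum_rank (i, i))|.

Lemma mean_square_le x0 j : is_initial_value P Filt V x0 ->
  (mean_square P (scheme x0 j) <= mean_square P x0 * (power_bound j)%:E)%E.
Proof.
move=> ix0.
have m0E : mean_square P x0 = (\sum_i Ex P (fun w => x x0 0 i w ^+ 2))%:E.
  by rewrite -mean_square_coords//; congr mean_square; apply/funext => w; rewrite scheme0.
rewrite m0E mean_square_coords// -EFinM lee_fin.
have sx := initial_solution ix0.
have l2 j' i : L2 P (x x0 j' i).
  by have [] := sol_meas_L2 HFilt dt0 entry_meas entry_L2 entry_cond_mean sx j' i.
set m0 := \sum_i Ex P (fun w => x x0 0 i w ^+ 2).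
(* Pointwise, the product of two coordinates is at most the full sum of squares. *)
have hm a : `|Ex P (fun w => x x0 0 (enum_val a).1 w * x x0 0 (enum_val a).2 w)| <= m0.
  apply: (le_trans (Ex_norm (L2M (l2 _ _) (l2 _ _)))).
  rewrite /m0 -Ex_sum; last by move=> i; exact: L2_sqr.
  apply: Ex_le; [by apply: L1_norm; exact: L2M|by apply: L1_sum => i; exact: L2_sqr|].
  move=> w; have hk k : x x0 0 k w ^+ 2 <= \sum_i x x0 0 i w ^+ 2.
    rewrite (bigD1 k)//= lerDl; apply: sumr_ge0 => i _; exact: sqr_ge0.
  have := hk (enum_val a).1; have := hk (enum_val a).2; rewrite normrM.
  rewrite -(real_normK (num_real (x x0 0 (enum_val a).1 w))).
  rewrite -(real_normK (num_real (x x0 0 (enum_val a).2 w))).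
  set p := `|_|; set q := `|_|; set s := \sum_i _ => h1 h2.
  by have := sqr_ge0 (p - q); nra.
rewrite /power_bound mulr_sumr; apply: ler_sum => i _.
have := momentE j (enum_rank (i, i)) ix0 ix0; rewrite enum_rankK/=.
under [X in Ex _ X]funext do rewrite -expr2.
move=> ->; apply: (le_trans (ler_norm _)); apply: (le_trans (ler_norm_sum _ _ _)).
rewrite mulr_sumr; apply: ler_sum => a _; rewrite normrM.
by apply: ler_wpM2r.
Qed.

Lemma power_cvg0_stable : (forall a c, (M ^+ j) a c @[j --> \oo] --> (0 : R)) ->
  asymptotically_mean_square_stable P Filt V scheme.
Proof.
move=> cM.
have B0 j : 0 <= power_bound j by apply: sumr_ge0 => i _; exact: sumr_ge0.
have cB : power_bound j @[j --> \oo] --> (0 : R).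
  have z0 : \sum_(i < n) \sum_(a < #|{: 'I_n * 'I_n}|) `|0 : R| = 0.
    by rewrite big1// => i _; rewrite big1// => a _; rewrite normr0.
  rewrite -[X in _ --> X]z0; apply: (@cvg_sumr R R^o) => i; apply: (@cvg_sumr R R^o) => a.
  by apply: cvg_norm; exact: cM.
(* The bound is at most 1 from some J on; the finitely many earlier values are added. Stability then
   holds with delta = eps / B. *)
have [B hB] : exists2 B : R, 0 < B & forall j, power_bound j <= B.
  move/cvgrPdist_le : (cB) => /(_ 1 ltr01)[J _ hJ].
  exists (1 + \sum_(j < J) power_bound j); first by rewrite ltr_wpDr// sumr_ge0.
  move=> j; have [jJ|Jj] := ltnP j J.
    rewrite (bigD1 (Ordinal jJ))//= addrCA lerDl addr_ge0// sumr_ge0//.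
  have := hJ j Jj; rewrite /= sub0r normrN ger0_norm// => /le_trans; apply.
  by rewrite lerDl sumr_ge0.
have finite x0 : is_initial_value P Filt V x0 ->
    exists2 m : R, 0 <= m & mean_square P x0 = m%:E.
  move=> ix0; exists (\sum_i Ex P (fun w => x x0 0 i w ^+ 2)).
    by apply: sumr_ge0 => i _; exact: Ex_sq_ge0.
  by rewrite -mean_square_coords//; congr mean_square; apply/funext => w; rewrite scheme0.
split=> [eps eps0|].
  exists (eps / B); first by rewrite divr_gt0.
  move=> x0 ix0 hx0 j; apply: le_lt_trans (mean_square_le j ix0) _.
  have [m m0 mE] := finite _ ix0; move: hx0; rewrite mE -EFinM !lte_fin => hm.
  apply: (@le_lt_trans _ _ (m * B)); first exact: ler_wpM2l.
  by rewrite -ltr_pdivlMr.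
exists 1 => // x0 ix0 _; have [m m0 mE] := finite _ ix0.
rewrite (_ : (fun j => mean_square P (scheme x0 j)) =
   (fun j => (\sum_i Ex P (fun w => x x0 j i w ^+ 2))%:E)); last first.
  by apply/funext => j; rewrite mean_square_coords.
apply: cvg_EFin; first exact: nearW.
apply: (@squeeze_cvgr _ _ _ _ (fun=> 0) (fun j => m * power_bound j)).
- near=> j; apply/andP; split; first by apply: sumr_ge0 => i _; exact: Ex_sq_ge0.
  by have := mean_square_le j ix0; rewrite mE mean_square_coords.
- exact: cvg_cst.
- by rewrite -(mulr0 m); apply: cvgM => //; exact: cvg_cst.
Unshelve. all: by end_near. Qed.

Lemma linear_scheme_stability :
  asymptotically_mean_square_stable P Filt V scheme <-> spectral_radius S < 1.
Proof.
split=> [h|/spectral h].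
  by apply/spectral; apply: eigenvalue_power_lt1; exact: stable_power_cvg0.
apply: power_cvg0_stable => a c.
have := power_cvg0 h (delta_mx 0 a) c.
by under eq_fun do rewrite -rowE mxE.
Qed.

End linear_scheme_stability.

(** * The Milstein scheme *)

(** Turns mean-square convergence of vectors, given by extended-real integrals, into [L2cvg] of a
    coordinate. Square-integrability of the limit Y is derived, not assumed. *)
Lemma L2cvg_squeeze (R : realType) d (Omega : measurableType d)
    (P : probability Omega R) (Ys Z : nat -> Omega -> R) (Y : Omega -> R) :
  measurable_fun setT Y -> (forall m, L2 P (Ys m)) ->
  (forall m, measurable_fun setT (Z m)) ->
  (forall m w, (Y w - Ys m w) ^+ 2 <= Z m w) ->
  (\int[P]_w (Z m w)%:E)%E @[m --> \oo] --> 0%E -> L2cvg P Ys Y.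
Proof.
move=> mY lYs mZ YZ cZ.
have mD m : measurable_fun setT (fun w => Y w - Ys m w).
  by apply: measurable_funB => //; exact: L2_meas.
have le m : (\int[P]_w ((Y w - Ys m w) ^+ 2)%:E <= \int[P]_w (Z m w)%:E)%E.
  apply: ge0_le_integral => //.
  - by move=> w _; rewrite lee_fin sqr_ge0.
  - by apply/measurable_EFinP; exact: measurable_funX.
  - exact/measurable_EFinP.
  - by move=> w _; rewrite lee_fin.
have lD m (c : R) : (\int[P]_w (Z m w)%:E <= c%:E)%E ->
    L2 P (fun w => Y w - Ys m w) /\ Ex P (fun w => (Y w - Ys m w) ^+ 2) <= c.
  move=> h; have h' := le_trans (le m) h.
  have l : L2 P (fun w => Y w - Ys m w).
    split=> //; apply: ge0_L1 => [|w|]; [exact: measurable_funX|exact: sqr_ge0|].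
    exact: le_lt_trans h' (ltry _).
  by split=> //; rewrite -lee_fin EFin_Ex//; exact: L2_sqr.
have lY : L2 P Y.
  have [m _ /(_ m (leqnn m)) /= h] := cvge0_small cZ ltr01.
  have [l _] := lD m _ h; have := L2D l (lYs m).
  by congr L2; apply/funext => w; rewrite subrK.
split=> //; apply/cvgrPdist_le => eps e0.
have := cvge0_small cZ e0; apply: filterS => m /lD[_ h].
by rewrite sub0r normrN ger0_norm ?Ex_sq_ge0.
Qed.

Lemma functional_calculus_dot (R : realType) (H : hilbertType R) n
    (lam : 'I_n -> R) (e : 'I_n -> H) dt g v i : orthonormal_family e ->
  dot (functional_calculus lam e dt g v) (e i) = g (- (dt * lam i)) * dot v (e i).
Proof. by move=> oe; rewrite /functional_calculus orthonormal_dot_sum. Qed.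

Theorem proposition3p5 (R : realType)
  (* filtered probability space, Hilbert spaces *)
  (d : measure_display) (Omega : measurableType d) (P : probability Omega R)
  (Filt : R -> set (set Omega)) (HFilt : is_usual_filtration P Filt)
  (H U : hilbertType R) (Hsep : separable H) (Usep : separable U)
  (* the operator -A, its square root, F and G *)
  (D : set H) (mA : H -> H) (D12 : set H) (mA12 : H -> H)
  (HA : is_self_adjoint D mA) (HApos : positive_definite D mA)
  (HAinv : has_compact_inverse D mA) (HA12 : is_square_root D mA D12 mA12)
  (F : H -> H) (HF : bounded_linear F)
  (G : H -> U -> H) (HG : bounded_bilinear_on setT setT G)
  (* the Levy process and its covariance operator *)
  (L : R -> Omega -> U) (HL : is_levy_process P Filt L)
  (HL2 : square_integrable P L) (HLm : is_martingale P Filt L)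
  (Q : U -> U) (HQ : bounded_linear Q)
  (HQsa : forall x y, dot (Q x) y = dot x (Q y))
  (HQpos : positive_semidefinite setT Q)
  (HQL : is_covariance_operator P L Q)
  (f : nat -> U) (mu : nat -> R) (Hf : hilbert_basis f)
  (HQf : forall k, Q (f k) = mu k *: f k)
  (Hmu : forall k, 0 <= mu k) (Hmu_dec : forall k, mu k.+1 <= mu k)
  (HQtr : trace_class f Q)
  (* Galerkin spaces *)
  (V : R -> set H) (N : R -> nat)
  (HV : forall h, 0 < h <= 1 -> is_subspace_of_dim (V h) (N h))
  (HVD : forall h, 0 < h <= 1 -> V h `<=` D12)
  (h : R) (Hh : 0 < h <= 1)
  (Ph : H -> H) (HPh : is_orthogonal_projection (V h) Ph)
  (mAh : H -> H) (HAh : is_galerkin_operator mA12 (V h) mAh)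
  (lam : 'I_(N h) -> R) (e : 'I_(N h) -> H)
  (He : is_eigenbasis (V h) mAh lam e)
  (* time step and rational approximation *)
  (dt : R) (Hdt : 0 < dt)
  (p : nat) (rn rd : {poly R}) (HR : is_rational_exp_approximation rn rd p)
  (Hrd : forall k, rd.[- (dt * lam k)] != 0) :
  let RA := functional_calculus lam e dt (fun x => rn.[x] / rd.[x]) in
  let rdinv := functional_calculus lam e dt (fun x => (rd.[x])^-1) in
  let t := fun j : nat => j%:R * dt in
  forall
  (* the iterated integrals, and the operators of the scheme *)
  (I : nat -> nat -> nat -> Omega -> R)
  (HI : forall j k l, is_iterated_integral P Filt
     (levy_coord mu f L k) (levy_coord mu f L l) (t j) (t j.+1) (I j k l)),
  let Ddet := fun v => RA v + rdinv (dt *: Ph (F v)) in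
  let DEM := fun (j : nat) w v =>
     rdinv (Ph (G v (L (t j.+1) w - L (t j) w))) in
  forall
  (DM : nat -> Omega -> H -> H)
  (HDM : forall j, is_random_operator_series P (V h)
     (fun k l w v => (Num.sqrt (mu k * mu l) * I j k l w) *:
        rdinv (Ph (G (G v (f k)) (f l))))
     (DM j))
  (* Hilbert tensor products U^(2), U^(4) and V_h^(2) *)
  (U2 U4 V2 : hilbertType R)
  (tU : U -> U -> U2) (tU2 : U2 -> U2 -> U4) (tV : H -> H -> V2)
  (HtU : is_hilbert_tensor setT setT tU)
  (HtU2 : is_hilbert_tensor setT setT tU2)
  (HtV : is_hilbert_tensor (V h) (V h) tV),
  let C := fun u v => rdinv (Ph (G v u)) in
  forall
  (C' : U2 -> H -> H)
  (HC' : is_unique_bounded_extension (V h) tU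
     (fun u1 u2 v => rdinv (Ph (G (G v u1) u2))) C')
  (DD : V2 -> V2) (HDD : is_operator_tensor (V h) tV Ddet Ddet DD)
  (CC : U2 -> V2 -> V2) (HCC : is_map_tensor (V h) tU tV C CC)
  (CC' : U4 -> V2 -> V2) (HCC' : is_map_tensor (V h) tU2 tV C' CC'),
  let q : U2 := limn (series (fun k => mu k *: tU (f k) (f k))) in
  let q' : U4 := limn (fun n => \sum_(k < n) \sum_(l < n)
     (mu k * mu l) *: tU2 (tU (f k) (f l)) (tU (f k) (f l))) in
  let S := fun z : V2 => DD z + dt *: CC q z + (dt ^+ 2 / 2) *: CC' q' z in
  asymptotically_mean_square_stable P Filt (V h) (milstein Ddet DEM DM)
  <-> spectral_radius S < 1.
Proof.
move=> RA rdinv t I HI Ddet DEM DM HDM U2 U4 V2 tU tU2 tV HtU HtU2 HtV C C' HC'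
  DD HDD CC HCC CC' HCC' q q' S.
have dimV := HV h Hh; have sV := dim_subspace dimV.
have oe := eb_orthonormal He; have Ve := eb_mem He.
have expand := orthonormal_expand dimV oe Ve.
have tS j : t j.+1 - t j = dt by rewrite /t -natr1; ring.
have t0 j : 0 <= t j by rewrite mulr_ge0// ltW.
have tlt j : t j < t j.+1 by rewrite -subr_gt0 tS.
pose rk i := (rd.[- (dt * lam i)])^-1.
have rdinvE v i : dot (rdinv v) (e i) = rk i * dot v (e i).
  exact: functional_calculus_dot.
(* The e_i lie in V_h, so the orthogonal projection is invisible in these coordinates. *)
have PhE v i : dot (Ph v) (e i) = dot v (e i).
  by have [_ /(_ _ (Ve i))/eqP] := HPh v; rewrite dotBl subr_eq0 => /eqP.
have rdinvV v : V h (rdinv v) by apply: subspace_sum.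
have coord_eq v w : V h v -> V h w -> (forall i, dot v (e i) = dot w (e i)) -> v = w.
  by move=> Vv Vw vw; rewrite (expand v)// (expand w)//; apply: eq_bigr => i _; rewrite vw.
have rdinvPh_lin : linear (fun v => rdinv (Ph v)).
  move=> c v w; apply: coord_eq => //; first by have [_] := sV; apply.
  by move=> i; rewrite dotDl dotZl !rdinvE !PhE dotDl dotZl; ring.
have [Gl Gr [MG GM]] := HG.
have [lF _] := HF.
have Vadd v w : V h v -> V h w -> V h (v + w).
  by move=> Vv Vw; rewrite -[v]scale1r; have [_] := sV; apply.
have DdetV v : V h (Ddet v) by apply: Vadd => //; exact: subspace_sum.
have DdetE v i : dot (Ddet v) (e i) =
    rn.[- (dt * lam i)] / rd.[- (dt * lam i)] * dot v (e i) + rk i * (dt * dot (F v) (e i)).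
  by rewrite /Ddet dotDl functional_calculus_dot// rdinvE dotZl PhE.
have Ddet_lin : linear Ddet.
  move=> c v w; apply: coord_eq => //.
    by have [_] := sV; apply.
  move=> i; rewrite (dotDl (c *: Ddet v)) (dotZl c (Ddet v)) !DdetE lF.
  by rewrite (dotDl (c *: v)) (dotDl (c *: F v)) !dotZl; ring.
pose A j w v := Ddet v + DEM j w v + DM j w v.
pose phi i k (u : U) : R := rk i * dot (G (e k) u) (e i).
pose beta i k l l' : R := rk i * dot (G (G (e k) (f l)) (f l')) (e i).
have lphi i k c u v : phi i k (c *: u + v) = c * phi i k u + phi i k v.
  by rewrite /phi (Gr (e k) Logic.I c u v Logic.I Logic.I) dotDl dotZl; ring.
have bphi i k u : `|phi i k u| <= `|rk i| * (MG * `|e k|) * `|e i| * `|u|.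
  rewrite /phi normrM -!mulrA; apply: ler_wpM2l => //.
  apply: (le_trans (dot_CS _ _)).
  rewrite (_ : MG * _ = MG * `|e k| * `|u| * `|e i|); last by ring.
  by apply: ler_wpM2r => //; exact: GM.
have DEME j w i k : dot (DEM j w (e k)) (e i) = fun_inc L (t j) (t j.+1) (phi i k) w.
  by rewrite /DEM rdinvE PhE.
have HIt j k l : iterated P Filt L (t j) (t j.+1) (coord_vec f mu k) (coord_vec f mu l) (I j k l).
  have E m : levy_coord mu f L m = fun s w => dot (L s w) (coord_vec f mu m).
    by apply/funext => s; apply/funext => w; rewrite /coord_vec dotZr.
  by have := HI j k l; rewrite /is_iterated_integral !E.
pose y j i k w : R := dot (DM j w (e k)) (e i).
have cY j i k : L2cvg P (milstein_sum mu (I j) (beta i k)) (y j i k).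
  have [_ DMV mDM cDM] := HDM j.
  have my i' : measurable_fun setT (y j i' k).
    apply: (@fmeas_measurable _ _ _ measurable) => //.
    apply: (fmeas_continuous (phi := fun v : H => dot v (e i'))).
      exact: dot_continuousl.
    exact: mDM.
  have l2w i' m : L2 P (milstein_sum mu (I j) (beta i' k) m).
    exact: (L2_milstein_sum HFilt HL HL2 HLm HQsa HQL (t0 j) (tlt j) (HIt j)).
  (* The remainder of the series applied to e_k stays in V_h, so its squared norm is the sum of the
     squared errors of the entries and dominates each of them. *)
  pose W m w := DM j w (e k) - \sum_(l < m) \sum_(l' < m)
     (Num.sqrt (mu l * mu l') * I j l l' w) *: rdinv (Ph (G (G (e k) (f l)) (f l'))).
  have WV m w : V h (W m w).
    rewrite /W -scaleN1r addrC; have [_] := sV; apply; last exact: DMV.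
    rewrite pair_big; exact: subspace_sum.
  have WE m w i' : dot (W m w) (e i') = y j i' k w - milstein_sum mu (I j) (beta i' k) m w.
    rewrite dotBl dot_suml; congr (_ - _); apply: eq_bigr => l _.
    rewrite dot_suml; apply: eq_bigr => l' _.
    by rewrite dotZl rdinvE PhE /beta /scaled_integral; ring.
  have NE m w : `|W m w| ^+ 2 = \sum_i' (y j i' k w - milstein_sum mu (I j) (beta i' k) m w) ^+ 2.
    by rewrite (norm_coords oe expand)//; apply: eq_bigr => i' _; rewrite WE.
  apply: (@L2cvg_squeeze _ _ _ P _ (fun m w => `|W m w| ^+ 2)) => //.
  - move=> m; rewrite (_ : (fun w => _) = fun w =>
        \sum_i' (y j i' k w - milstein_sum mu (I j) (beta i' k) m w) ^+ 2); last exact/funext.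
    apply: measurable_sum => i'; apply: measurable_funX; apply: measurable_funB => //.
    exact: L2_meas (l2w i' m).
  - move=> m w; rewrite NE (bigD1 i)//= lerDl; apply: sumr_ge0 => i' _; exact: sqr_ge0.
  - by have := cDM (e k) (Ve k); rewrite /mean_square unlock.
pose z k k' := tV (e k) (e k').
pose kap i k i' k' := dot (CC q (z k k')) (z i i').
pose kap' i k i' k' := dot (CC' q' (z k k')) (z i i').
have n1 (K1 K2 K : hilbertType R) (tt : K1 -> K2 -> K) u v :
    is_hilbert_tensor setT setT tt -> `|u| <= 1 -> `|v| <= 1 -> `|tt u v| <= 1.
  move=> htt u1 v1; rewrite -(ler_pXn2r (n:=2))// ?nnegrE// expr1n.
  rewrite -dot_norm (tensor_dot htt)// !dot_norm.
  by rewrite mulr_ile1 ?sqr_ge0// expr_le1.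
have nf k : `|f k| <= 1.
  rewrite -(ler_pXn2r (n:=2))// ?nnegrE// expr1n -dot_norm.
  by have [of_ _] := Hf; rewrite of_ eqxx.
have cmu : cvgn (series mu).
  rewrite (_ : mu = fun k => dot (Q (f k)) (f k)) //.
  by apply/funext => k; rewrite (cov_basis Hf HQf) eqxx mulr1.
have cq : series (fun k => mu k *: tU (f k) (f k)) n @[n --> \oo] --> q.
  by apply: cvg_weighted_series => // k; exact: n1.
have cq' : (\sum_(k < n) \sum_(l < n)
     (mu k * mu l) *: tU2 (tU (f k) (f l)) (tU (f k) (f l))) @[n --> \oo] --> q'.
  apply: (cvg_weighted_square_series (z := fun k l => tU2 (tU (f k) (f l)) (tU (f k) (f l)))) => //.
  by move=> k l; apply: (n1 _ _ _ _ _ _ HtU2); exact: n1.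
(* CC is continuous in its first argument, and CC (f_l (x) f_l) maps e_k (x) e_k' to C f_l e_k (x) C
   f_l e_k', whose pairing with e_i (x) e_i' factorises. *)
have ckap i k i' k' : \sum_(l < m) mu l * (phi i k (f l) * phi i' k' (f l))
    @[m --> \oo] --> kap i k i' k'.
  have [bCC hCC] := HCC.
  have := @bounded_bilinear_cvg _ _ _ CC _ _ (z k k') (z i i') bCC cq.
  rewrite (_ : (fun m => dot _ _) = fun m => \sum_(l < m) mu l * (phi i k (f l) * phi i' k' (f l)))//.
  apply/funext => m; have [CCl _ _] := bCC.
  rewrite /series/= (linear_on_sum (T := CC ^~ (z k k')) _ _ (linear_subspaceT _) (CCl _ Logic.I))//.
  rewrite dot_suml big_mkord; apply: eq_bigr => l _; rewrite dotZl.
  have [_ hl] := hCC (f l) (f l); rewrite hl// (tensor_dot HtV)//; last 2 first.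
    exact: rdinvV. exact: rdinvV.
  by rewrite /C !rdinvE !PhE.
have [C'bil C'V C'E] := HC'.1.
have ckap' i k i' k' : \sum_(l < m) \sum_(l' < m)
    (mu l * mu l') * (beta i k l l' * beta i' k' l l') @[m --> \oo] --> kap' i k i' k'.
  have [bCC hCC] := HCC'.
  have := @bounded_bilinear_cvg _ _ _ CC' _ _ (z k k') (z i i') bCC cq'.
  rewrite (_ : (fun m => dot _ _) = fun m => \sum_(l < m) \sum_(l' < m)
    (mu l * mu l') * (beta i k l l' * beta i' k' l l'))//.
  apply/funext => m; have [CCl _ _] := bCC; rewrite pair_big/=.
  rewrite (linear_on_sum (T := CC' ^~ (z k k')) _ _ (linear_subspaceT _) (CCl _ Logic.I))//.
  rewrite dot_suml pair_big/=; apply: eq_bigr => l _; rewrite dotZl.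
  have [_ hl] := hCC (tU (f l.1) (f l.2)) (tU (f l.1) (f l.2)).
  rewrite hl// (tensor_dot HtV)//; try exact: C'V.
  by rewrite !C'E// !rdinvE !PhE.
have [DDb DDE] := HDD; have [DDl _] := DDb.
have S_lin : linear S.
  have [[CCl1 CCl2 _] _] := HCC; have [[CCl1' CCl2' _] _] := HCC'.
  move=> c u v; rewrite /S DDl (CCl2 q Logic.I c u v Logic.I Logic.I).
  rewrite (CCl2' q' Logic.I c u v Logic.I Logic.I) !scalerDr !scalerA.
  rewrite (mulrC dt c) (mulrC (dt ^+ 2 / 2) c) [X in X + _ = _]addrACA.
  by rewrite [LHS]addrACA.
have SE i k i' k' : dot (S (z k k')) (z i i') =
    dot (Ddet (e k)) (e i) * dot (Ddet (e k')) (e i') +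
    dt * kap i k i' k' + dt ^+ 2 / 2 * kap' i k i' k'.
  rewrite /S (dotDl (DD (z k k') + dt *: CC q (z k k'))) (dotDl (DD (z k k'))).
  by rewrite !dotZl DDE// (tensor_dot HtV).
have DEM_lin j w : linear (DEM j w).
  by move=> c u v; rewrite /DEM (Gl _ Logic.I c u v Logic.I Logic.I) rdinvPh_lin.
pose det i k := dot (Ddet (e k)) (e i).
have entE j i k : entry e A j i k =
    fun w => det i k + fun_inc L (t j) (t j.+1) (phi i k) w + y j i k w.
  apply/funext => w; rewrite /entry /A (dotDl (Ddet (e k) + DEM j w (e k))).
  by rewrite (dotDl (Ddet (e k))) DEME.
have cE j i k := L2cvg_fun_inc HFilt HL HL2 Hf (t0 j) (tlt j) (lphi i k) (bphi i k).
have sF j : sigma_algebra setT (Filt (t j)) by apply: (filt_sigma_algebra HFilt).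
have Fm j : Filt (t j) `<=` measurable by apply: (filt_measurable HFilt).
apply: (@linear_scheme_stability _ _ _ P Filt HFilt dt Hdt H V2 (V h) _ e sV oe Ve
   expand tV HtV A) => //.
- move=> j w c u v Vu Vv; have [DMl _ _ _] := HDM j.
  rewrite /A Ddet_lin DEM_lin DMl// !scalerDr [X in X + _ = _]addrACA.
  by rewrite [LHS]addrACA.
- move=> j w v Vv; apply: (Vadd); last by have [_ DMV _ _] := HDM j; exact: DMV.
  by apply: (Vadd); [exact: DdetV|exact: rdinvV].
- move=> j i k; rewrite entE; apply: fmeasD; first exact: (sF j.+1).
    apply: fmeasD; [exact: (sF j.+1)|exact: (fmeas_cst (sF j.+1))|].
    exact: (fmeas_fun_inc HFilt HL (t0 j) (tlt j) (lphi i k) (bphi i k)).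
  exact: (fmeas_milstein_entry HFilt HL HL2 HLm HQsa HQL (t0 j) (tlt j) (HIt j) (cY j i k)).
- move=> j i k; rewrite entE; apply: L2D; last by case: (cY j i k).
  by apply: L2D; [exact: L2_cst|case: (cE j i k)].
move=> j i k i' k'; rewrite !entE.
have cst0 : cond_mean P (Filt (t j)) (fun=> det i k * det i' k') (det i k * det i' k').
  exact: (cond_mean_cst P (@Fm j)).
have ce i1 k1 := cond_mean_fun_inc HFilt HL HL2 HLm Hf (t0 j) (tlt j) (lphi i1 k1) (bphi i1 k1).
have cy i1 k1 := cond_mean_milstein_entry HFilt HL HL2 HLm HQsa HQL (t0 j) (tlt j) (HIt j) (cY j i1 k1).
have cye i1 k1 i2 k2 := cond_mean_milstein_entry_fun_inc HFilt HL HL2 HLm HQsa HQL Hf (t0 j) (tlt j)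
  (HIt j) (cY j i1 k1) (lphi i2 k2) (bphi i2 k2).
have cee := cond_mean_fun_inc_pair HFilt HL HL2 HQsa HQL Hf HQf (t0 j) (tlt j) (lphi i k)
  (bphi i k) (lphi i' k') (bphi i' k') (ckap i k i' k').
have cyy := cond_mean_milstein_entry_pair HFilt HL HL2 HLm HQsa HQL Hf HQf Hmu (t0 j) (tlt j) (HIt j)
  (cY j i k) (cY j i' k') (ckap' i k i' k').
rewrite !tS in cee cyy.
have FF := @Fm j.
(* Nine products arise from two entries with three summands each. The six mixed ones have
   conditional mean zero; the other three match the summands of S. *)
have := cond_meanD FF (cond_meanD FF (cond_meanD FF (cond_meanD FF (cond_meanD FF (cond_meanD FF (cond_meanD FF (cond_meanD FF cst0
  (cond_meanZ FF (det i k) (ce i' k'))) (cond_meanZ FF (det i k) (cy i' k')))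
  (cond_meanZ FF (det i' k') (ce i k))) (cond_meanZ FF (det i' k') (cy i k)))
  cee) cyy) (cye i k i' k')) (cye i' k' i k).
rewrite [X in cond_mean _ _ X](_ : _ = fun w =>
  (det i k + fun_inc L (t j) (t j.+1) (phi i k) w + y j i k w) *
  (det i' k' + fun_inc L (t j) (t j.+1) (phi i' k') w + y j i' k' w)); last first.
  by apply/funext => w; ring.
by move/cond_mean_eq; apply; rewrite /coef SE /det; ring.
Qed.
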